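(* Suppose that $\mathfrak F[f](\xi)$ exists for $\xi\in\mathbb R$, and that $f$ is holomorphic in the horizontal strip $\Xi_0=\{z\in\mathbb C:\ |\Im(z)|<a_0\}$, for some $a_0>a>0$, except for finitely many poles $z_1,\ldots,z_m$. Let $a=\min_{1\le k\le m}|\Im(z_k)|$ be attained by $z_{k_1},\ldots,z_{k_n}$ ($k_j\le m$), that is, $|\Im(z_{k_1})|=\cdots=|\Im(z_{k_n})|=a$, let their orders be $j_{k_1},\ldots,j_{k_n}$ respectively, and let $m_0=\max\{j_{k_1},\ldots,j_{k_n}\}$. If $$\lim_{x\to\pm\infty}\int_{-a_0}^{a_0}|f(x+i\eta)|\,\mathrm d\eta=0\qquad\text{and}\qquad B_0^{\pm}:=\int_{-\infty}^{+\infty}|f(x\pm ia_0)|\,\mathrm dx<+\infty$$ hold, then $$|\mathfrak F[f](\xi)|\le B(|\xi|^{m_0-1}+1)e^{-2\pi a|\xi|}$$ for some constant $B$. In addition, for each $h>0$ it holds that $$E(h):=\left|\int_{\mathbb R}f(x)\,\mathrm dx-h\sum_{n=-\infty}^{+\infty}f(nh)\right|\le\sum_{n\ne0}\left|\mathfrak F[f]\left(\frac nh\right)\right|\le\frac{2B}{e^{\frac{2a\pi}{h}}-1}+\widetilde B\max\left\{\frac1{h^{m_0-1}},h\right\}e^{-\frac{2a\pi}{h}}$$ for some constant $\widetilde B$. Moreover, suppose $f$ is continuous and of moderate decrease on $\mathbb R$ and $\mathfrak F[f](\xi)$ satisfies the decay condition $$|\mathfrak F[f](\xi)|\le 2B(|\xi|^{m_0-1}+1)e^{-2\pi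 a|\xi|}$$ for some constants $a,B>0$ and a positive integer $m_0$. Then $f(x)$ is the restriction to $\mathbb R$ of a function $f(z)$ holomorphic in the strip $\{z\in\mathbb C:\ |\Im(z)|<a\}$.
   Context: $\Im(z)$ is the imaginary part of $z$. The Fourier transform is $\mathfrak F[f](\xi)=\int_{-\infty}^{+\infty}f(x)e^{-2\pi ix\xi}\,\mathrm dx$, and the validity of the Fourier inversion formula $f(x)=\int_{-\infty}^{+\infty}\mathfrak F[f](\xi)e^{2\pi ix\xi}\,\mathrm d\xi$ is assumed throughout. The quantities $f(x\pm ia_0)$ are the values of $f$ on the boundary lines of the strip $\Xi_0$. A function $f$ on $\mathbb R$ is of moderate decrease if $|f(x)|\le A/(1+x^2)$ for some constant $A$ and all $x\in\mathbb R$. *)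

(* Defs.v *)
From HB Require Import structures.
From mathcomp Require Import all_boot all_order all_algebra.
From mathcomp Require Import all_classical all_reals all_analysis.
From mathcomp Require Import complex.

Set Implicit Arguments.
Unset Strict Implicit.
Unset Printing Implicit Defensive.

Import Order.TTheory GRing.Theory Num.Theory.
Import numFieldNormedType.Exports.

Local Open Scope classical_set_scope.
Local Open Scope complex_scope.
Local Open Scope ring_scope.

(* The topology and normed-module structure that R[i] has as a numFieldType
   (the one already carried by R[i]^o), made available on R[i] itself. *)
HB.instance Definition _ (R : rcfType) := NormedModule.copy R[i] R[i]^o.

(* The modulus with values in R; the generic norm of R[i] has values in R[i]. *)
Notation cmod := (@ComplexField.Normc.normc _).

Section ComplexAnalysis.
Context {R : realType}.
Implicit Types (f : R[i] -> R[i]) (z : R[i]) (A : set R[i]).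

Definition strip (b : R) : set R[i] := [set z | `|complex.Im z| < b].

Definition closed_strip (b : R) : set R[i] := [set z | `|complex.Im z| <= b].

(* Since the scalar field is R[i], [derivable f z 1] is complex
   differentiability of f at z. *)
Definition holomorphic_on A f := forall z, A z -> derivable f z 1.

(* The value of f at the pole itself is irrelevant. *)
Definition has_pole f z (j : nat) :=
  (0 < j)%N /\
  exists g : R[i] -> R[i],
    [/\ \forall w \near z, derivable g w 1,
        g z != 0
      & \forall w \near z^', f w = g w / (w - z) ^+ j].

Definition vertical_mass f (b x : R) : \bar R :=
  (\int[@lebesgue_measure R]_(eta in [set` `[(- b)%R, b]])
     (cmod (f (x +i* eta)))%:E)%E.

Definition horizontal_mass f (y : R) : \bar R :=
  (\int[@lebesgue_measure R]_x (cmod (f (x +i* y)))%:E)%E.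

End ComplexAnalysis.

Section FourierTransform.
Context {R : realType}.
Implicit Types (f g : R -> R[i]).

Local Notation mu := (@lebesgue_measure R).

Definition cintegrable g :=
  mu.-integrable setT (EFin \o (fun x => complex.Re (g x))) /\
  mu.-integrable setT (EFin \o (fun x => complex.Im (g x))).

Definition cintegral g : R[i] :=
  (\int[mu]_x complex.Re (g x)) +i* (\int[mu]_x complex.Im (g x)).

(* e^(i t) for real t *)
Definition expi (t : R) : R[i] := cos t +i* sin t.

Definition fourier f (xi : R) : R[i] :=
  cintegral (fun x => f x * expi (- (2 * pi * x * xi))).

Definition fourier_exists f :=
  forall xi : R, cintegrable (fun x => f x * expi (- (2 * pi * x * xi))).

Definition fourier_inversion f :=
  forall x : R,
    cintegrable (fun xi => fourier f xi * expi (2 * pi * x * xi)) /\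
    f x = cintegral (fun xi => fourier f xi * expi (2 * pi * x * xi)).

Definition moderate_decrease f :=
  exists A : R, forall x : R, cmod (f x) <= A / (1 + x ^+ 2).

(* s is the sum of the two-sided series of the u n: both halves converge. *)
Definition is_bilateral_sum (u : int -> R[i]) (s : R[i]) :=
  exists s1 s2 : R[i],
    [/\ series (fun k : nat => u k%:Z) @ \oo --> s1,
        series (fun k : nat => u (- k.+1%:Z)) @ \oo --> s2
      & s = s1 + s2].

End FourierTransform.

(* Main.v *)
Require Import Defs.
From HB Require Import structures.
From mathcomp Require Import all_boot all_order all_algebra.
From mathcomp Require Import all_classical all_reals all_analysis.
From mathcomp Require Import measurable_realfun complex ring lra zify.

Set Implicit Arguments.
Unset Strict Implicit.
Unset Printing Implicit Defensive.

Import Order.TTheory GRing.Theory Num.Theory.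
Import numFieldNormedType.Exports.

Local Open Scope classical_set_scope.
Local Open Scope complex_scope.
Local Open Scope ring_scope.

(** Both directions rest on moving a horizontal line of integration.

    Decay of the transform. For xi > 0 the character e^(-2 pi i xi z) decreases
    exponentially below the real axis, and for xi < 0 above it. Pushing the
    real line to the edge of the half-strip where it decreases turns the
    transform into an integral of order e^(-2 pi a0 |xi|), plus contour
    integrals around the poles that were crossed ([half_shift],
    [fourier_Lhalf]). A pole p of order j is estimated on a square of half-side
    1/|xi|: there f is of order |xi|^j, the path has length of order 1/|xi|,
    and the character has modulus e^(-2 pi |Im p| |xi|) up to a bounded factor.
    The poles closest to the axis thus give |xi|^(m0 - 1) e^(-2 pi a |xi|), and
    the others contribute no more ([residue_decay], [fourier_decay_half]). All of
    this works with contour integrals along rectangles, for which Goursat's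
    theorem is proved by bisection ([goursat]) and extended to functions that
    are only continuous on the horizontal sides ([goursat_closed]); the role of
    a residue is played by the integral along any small square ([rint_poles]).

    The trapezoidal rule. The pushed integral [Lhalf sg G] is linear in G and
    bounded by the supremum of G away from the axis. Applied to the geometric
    series of the characters of frequencies sg n / h, whose sum is the
    h-periodic kernel [kern], it gives the sum of the F (sg n / h) over n > 0
    ([fourier_sum_half]). On the other hand, the contour integral of f * kern
    around the strip |Im z| < a/2 is h times the sum of the f (n h), one cell
    for each sampling point ([fkern_cell]). On the upper side
    kern = -1 - kern', with kern' the kernel of opposite sign, so that the
    contour integral also equals F 0 plus the two sums of the transform
    ([poisson_joint]). This is Poisson summation; it yields at once the
    convergence of both halves of the series of samples and the bound of the
    error by the sum of the |F (n / h)|, n <> 0. Inserting the decay of F,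
    Abel summation bounds the resulting series ([weighted_sum_le]).

    The converse. Under the decay condition the inversion integral converges
    absolutely when x is replaced by z with |Im z| < a, because
    |e^(2 pi i xi z)| <= e^(2 pi |Im z| |xi|), and may be differentiated under
    the integral sign ([decay_mul], [derivable_inversion_ext]). *)

(** * Modulus and differentiability in the complex plane *)

Section Modulus.
Context {R : realType}.
Implicit Types (z w : R[i]).

Lemma cmod_norm z : `|z| = (cmod z)%:C.
Proof. by []. Qed.

Lemma cmod_ge0 z : 0 <= cmod z.
Proof. by rewrite -ler0c -cmod_norm normr_ge0. Qed.

Lemma cmodM z w : cmod (z * w) = cmod z * cmod w.
Proof. exact: ComplexField.Normc.normcM. Qed.

Lemma cmodV z : cmod z^-1 = (cmod z)^-1.
Proof. exact: ComplexField.Normc.normcV. Qed.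

Lemma cmodX z n : cmod (z ^+ n) = cmod z ^+ n.
Proof.
elim: n => [|n IH]; first by rewrite !expr0 ComplexField.Normc.normc1.
by rewrite !exprS cmodM IH.
Qed.

Lemma cmod0 : cmod (0 : R[i]) = 0. Proof. exact: ComplexField.Normc.normc0. Qed.
Lemma cmod1 : cmod (1 : R[i]) = 1. Proof. exact: ComplexField.Normc.normc1. Qed.

Lemma cmodD z w : cmod (z + w) <= cmod z + cmod w.
Proof. exact: le_normcD. Qed.

Lemma cmodN z : cmod (- z) = cmod z.
Proof. exact: normcN. Qed.

Lemma cmodB z w : cmod (z - w) <= cmod z + cmod w.
Proof. by rewrite -(cmodN w) cmodD. Qed.

Lemma cmod_distC z w : cmod (z - w) = cmod (w - z).
Proof. by rewrite -cmodN opprB. Qed.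

Lemma cmod_eq0 z : (cmod z == 0) = (z == 0).
Proof.
apply/eqP/eqP => [|->]; first exact: ComplexField.Normc.eq0_normc.
exact: cmod0.
Qed.

Lemma cmod_gt0 z : (0 < cmod z) = (z != 0).
Proof. by rewrite lt0r cmod_eq0 cmod_ge0 andbT. Qed.

Lemma cmod_real (x : R) : cmod x%:C = `|x|.
Proof. by rewrite /= expr0n /= addr0 sqrtr_sqr. Qed.

Lemma cmod_imag (x : R) : cmod (0 +i* x) = `|x|.
Proof. by rewrite /= expr0n /= add0r sqrtr_sqr. Qed.

Lemma Re_le_cmod z : `|complex.Re z| <= cmod z.
Proof. by have := normc_ge_Re z; rewrite cmod_norm lecR. Qed.

Lemma Im_le_cmod z : `|complex.Im z| <= cmod z.
Proof.
by case: z => a b /=; rewrite -sqrtr_sqr ler_wsqrtr// lerDr sqr_ge0.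
Qed.

Lemma cmod_le_ReIm z : cmod z <= `|complex.Re z| + `|complex.Im z|.
Proof.
case: z => a b; have -> : a +i* b = a%:C + (0 +i* b) by simpc.
by rewrite (le_trans (cmodD _ _))// cmod_real cmod_imag; simpc.
Qed.

Lemma complex_eq z w :
  complex.Re z = complex.Re w -> complex.Im z = complex.Im w -> z = w.
Proof. by case: z w => a b [c d] /= -> ->. Qed.

Lemma ReD z w : complex.Re (z + w) = complex.Re z + complex.Re w.
Proof. by case: z w => a b [c d]. Qed.
Lemma ImD z w : complex.Im (z + w) = complex.Im z + complex.Im w.
Proof. by case: z w => a b [c d]. Qed.
Lemma ReN z : complex.Re (- z) = - complex.Re z.
Proof. by case: z. Qed.
Lemma ImN z : complex.Im (- z) = - complex.Im z.
Proof. by case: z. Qed.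
Lemma ReM z w : complex.Re (z * w) =
  complex.Re z * complex.Re w - complex.Im z * complex.Im w.
Proof. by case: z w => a b [c d]. Qed.
Lemma ImM z w : complex.Im (z * w) =
  complex.Re z * complex.Im w + complex.Im z * complex.Re w.
Proof. by case: z w => a b [c d]. Qed.

End Modulus.
Arguments ComplexField.Normc.normc : simpl never.

Section Topology.
Context {R : realType}.
Implicit Types (z w : R[i]).

Lemma nbhsC_cmod z (A : set R[i]) :
  nbhs z A <-> exists2 d : R, 0 < d & forall w, cmod (w - z) < d -> A w.
Proof.
split=> [/nbhs_ballP[e /= e0 zA]|[d d0 dA]].
  have er : e \is Num.real by rewrite realE (ltW e0).
  have ee : (complex.Re e)%:C = e by exact: RRe_real.
  exists (complex.Re e) => [|w wz]; first by rewrite -ltcR ee.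
  by apply: zA; rewrite -ball_normE /= distrC cmod_norm -ee ltcR.
apply/nbhs_ballP; exists d%:C => /=; first by rewrite ltcR.
by move=> w; rewrite -ball_normE /= distrC cmod_norm ltcR; exact: dA.
Qed.

Lemma cvgC_cmod (T : Type) (F : set_system T) {FF : Filter F}
    (f : T -> R[i]) (l : R[i]) :
  f @ F --> l <-> forall e : R, 0 < e -> \forall t \near F, cmod (f t - l) < e.
Proof.
split=> [fl e e0|H].
  have : nbhs l [set w | cmod (w - l) < e] by apply/nbhsC_cmod; exists e.
  exact: fl.
move=> A /nbhsC_cmod[d d0 dA]; near=> t; apply: dA; near: t; exact: H.
Unshelve. all: by end_near. Qed.

(** The linear remainder with real bounds is the form in which the bisection
    of Goursat's theorem, and differentiation under the integral sign, meet
    complex differentiability. *)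
Lemma derivableC_cmod (f : R[i] -> R[i]) z :
  derivable f z 1 <-> exists l : R[i], forall e : R, 0 < e -> exists2 d : R,
    0 < d & forall w, cmod (w - z) < d ->
      cmod (f w - f z - l * (w - z)) <= e * cmod (w - z).
Proof.
split.
  move=> /cvg_ex[l /cvgC_cmod fl]; exists l => e e0.
  have /nbhsC_cmod[d d0 H] := fl _ e0; exists d => // w wz.
  have [->|wz0] := eqVneq w z; first by rewrite !subrr mulr0 subr0 cmod0 mulr0.
  have wz1 : w - z != 0 by rewrite subr_eq0.
  have := H (w - z); rewrite subr0 => /(_ wz wz1).
  rewrite /= scaler1 subrK => {}H; rewrite -ler_pdivrMr ?cmod_gt0//.
  rewrite -cmodV -cmodM; apply: (le_trans _ (ltW H)).
  rewrite le_eqVlt; apply/orP; left; apply/eqP; congr (cmod _).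
  by rewrite /GRing.scale /= mulrBl mulrC mulfK.
move=> [l H]; apply/cvg_ex; exists l; apply/cvgC_cmod => e e0.
have e20 : 0 < e / 2 by rewrite divr_gt0.
have [d d0 {}H] := H _ e20; apply/nbhsC_cmod; exists d => // k.
rewrite subr0 => kd k0; have := H (k + z); rewrite addrK => /(_ kd) {}H.
rewrite /= scaler1.
have -> : k^-1 *: (f (k + z) - f z) - l = k^-1 * (f (k + z) - f z - l * k).
  by rewrite [RHS]mulrBr [_ * (l * k)]mulrCA mulVf// mulr1.
rewrite cmodM cmodV mulrC ltr_pdivrMr ?cmod_gt0//.
apply: (le_lt_trans H); rewrite ltr_pM2r ?cmod_gt0//.
by rewrite ltr_pdivrMr// ltr_pMr// ltr1n.
Qed.

Lemma derivable_contC (f : R[i] -> R[i]) z : derivable f z 1 ->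
  {for z, continuous f}.
Proof. by move=> /derivable1_diffP /differentiable_continuous. Qed.

Lemma Re_continuous : continuous (fun z : R[i] => complex.Re z).
Proof.
move=> z A /nbhs_ballP[e /= e0 eA]; apply/nbhsC_cmod; exists e => // w wz.
apply: eA; rewrite -ball_normE /= distrC (le_lt_trans _ wz)//.
by rewrite -ReN -ReD Re_le_cmod.
Qed.

Lemma Im_continuous : continuous (fun z : R[i] => complex.Im z).
Proof.
move=> z A /nbhs_ballP[e /= e0 eA]; apply/nbhsC_cmod; exists e => // w wz.
apply: eA; rewrite -ball_normE /= distrC (le_lt_trans _ wz)//.
by rewrite -ImN -ImD Im_le_cmod.
Qed.

Lemma hline_continuous (y : R) : continuous (fun x : R => x +i* y).
Proof.
move=> x; apply/cvgC_cmod => e e0; near=> t.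
have -> : t +i* y - (x +i* y) = (t - x)%:C by apply: complex_eq => /=; ring.
rewrite cmod_real distrC; near: t.
by have /cvgrPdist_lt := @cvg_id R (nbhs x); apply.
Unshelve. all: by end_near. Qed.

Lemma vline_continuous (x : R) : continuous (fun y : R => x +i* y).
Proof.
move=> y; apply/cvgC_cmod => e e0; near=> t.
have -> : x +i* t - (x +i* y) = 0 +i* (t - y) by apply: complex_eq => /=; ring.
rewrite cmod_imag distrC; near: t.
by have /cvgrPdist_lt := @cvg_id R (nbhs y); apply.
Unshelve. all: by end_near. Qed.

Lemma within_continuous_comp (A : set R[i]) (B : set R) (f : R[i] -> R[i])
    (p : R -> R[i]) :
  {within A, continuous f} -> continuous p -> (forall x, B x -> A (p x)) ->
  {within B, continuous (f \o p)}.
Proof.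
move=> /subspace_continuousP fA cp BA; apply/subspace_continuousP => x Bx.
apply: (cvg_comp _ _ _ (fA _ (BA _ Bx))) => U /= AU.
have H : \forall t \near x, (fun v => A v -> U v) (p t) := cp x _ AU.
apply: filterS H => t tU Bt; exact/tU/BA.
Qed.

End Topology.

(** * Integrals of complex-valued functions *)

Section Integral.
Context {R : realType}.
Local Notation mu := (@lebesgue_measure R).
Implicit Types (A B D E : set (measurableTypeR R)) (g : R -> R[i]).

Definition cint_on D g :=
  mu.-integrable D (EFin \o (fun x => complex.Re (g x))) /\
  mu.-integrable D (EFin \o (fun x => complex.Im (g x))).

Definition Cint D g : R[i] :=
  (\int[mu]_(x in D) complex.Re (g x)) +i* (\int[mu]_(x in D) complex.Im (g x)).

Lemma eq_Cint D g1 g2 : (forall x, D x -> g1 x = g2 x) -> Cint D g1 = Cint D g2.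
Proof.
by move=> e; congr (_ +i* _); apply: eq_Rintegral => x /set_mem Dx; rewrite e.
Qed.

Lemma eq_cint_on D g1 g2 : measurable D -> (forall x, D x -> g1 x = g2 x) ->
  cint_on D g1 -> cint_on D g2.
Proof.
by move=> mD e [i1 i2]; split;
  [apply: eq_integrable i1|apply: eq_integrable i2] =>
  // x /set_mem Dx /=; rewrite e.
Qed.

Lemma cint_onS D E g : measurable D -> measurable E -> D `<=` E ->
  cint_on E g -> cint_on D g.
Proof. by move=> mD mE DE [i1 i2]; split; [exact: integrableS i1|exact: integrableS i2]. Qed.

Lemma cint_on_measurable D g : measurable D -> cint_on D g ->
  measurable_fun D (fun x : measurableTypeR R => cmod (g x)).
Proof.
move=> mD [/integrableP[/measurable_EFinP m1 _]
  /integrableP[/measurable_EFinP m2 _]].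
have -> : (fun x => cmod (g x)) =
    (fun x => Num.sqrt (complex.Re (g x) ^+ 2 + complex.Im (g x) ^+ 2)).
  by apply/funext => x; case: (g x).
apply: (measurableT_comp (continuous_measurable_fun (@sqrt_continuous R))).
by apply: measurable_funD; exact: measurable_funX.
Qed.

Lemma cint_on_cmod D g : measurable D -> cint_on D g ->
  mu.-integrable D (EFin \o (fun x => cmod (g x))).
Proof.
move=> mD ig; have [i1 i2] := ig.
have i3 := integrableD mD (integrable_norm i1) (integrable_norm i2).
apply: (le_integrable mD _ _ i3).
  by apply/measurable_EFinP; exact: cint_on_measurable.
move=> x Dx /=; rewrite lee_fin ger0_norm ?cmod_ge0//.
by rewrite ger0_norm ?addr_ge0// cmod_le_ReIm.
Qed.

Lemma cmod_cint_on D g (b : R -> R) : measurable D ->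
  measurable_fun D (fun x : measurableTypeR R => complex.Re (g x)) ->
  measurable_fun D (fun x : measurableTypeR R => complex.Im (g x)) ->
  mu.-integrable D (EFin \o b) -> (forall x, D x -> cmod (g x) <= b x) ->
  cint_on D g.
Proof.
move=> mD m1 m2 ib gb; split; apply: le_integrable ib => //.
- exact/measurable_EFinP.
- move=> x Dx /=; rewrite lee_fin (le_trans (Re_le_cmod _))//.
  by rewrite (le_trans (gb _ Dx))// ler_norm.
- exact/measurable_EFinP.
- move=> x Dx /=; rewrite lee_fin (le_trans (Im_le_cmod _))//.
  by rewrite (le_trans (gb _ Dx))// ler_norm.
Qed.

Lemma cint_onD D g1 g2 : measurable D -> cint_on D g1 -> cint_on D g2 ->
  cint_on D (fun x => g1 x + g2 x).
Proof.
move=> mD [i1 j1] [i2 j2]; split.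
- by under eq_fun do rewrite ReD; exact: (integrableD mD i1 i2).
- by under eq_fun do rewrite ImD; exact: (integrableD mD j1 j2).
Qed.

Lemma CintD D g1 g2 : measurable D -> cint_on D g1 -> cint_on D g2 ->
  Cint D (fun x => g1 x + g2 x) = Cint D g1 + Cint D g2.
Proof.
move=> mD [i1 j1] [i2 j2]; apply: complex_eq => /=.
- by under eq_Rintegral do rewrite ReD; exact: RintegralD.
- by under eq_Rintegral do rewrite ImD; exact: RintegralD.
Qed.

Lemma cint_onZ D (c : R[i]) g : measurable D -> cint_on D g ->
  cint_on D (fun x => c * g x).
Proof.
move=> mD [i1 i2]; split.
- under eq_fun do rewrite ReM.
  exact: (integrableB mD (integrableZl mD (complex.Re c) i1)
                        (integrableZl mD (complex.Im c) i2)).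
- under eq_fun do rewrite ImM.
  exact: (integrableD mD (integrableZl mD (complex.Re c) i2)
                        (integrableZl mD (complex.Im c) i1)).
Qed.

Lemma CintZ D (c : R[i]) g : measurable D -> cint_on D g ->
  Cint D (fun x => c * g x) = c * Cint D g.
Proof.
move=> mD [i1 i2]; apply: complex_eq; rewrite ?ReM ?ImM /=.
- under eq_Rintegral do rewrite ReM.
  rewrite RintegralB//; [|exact: (integrableZl mD _ i1)|exact: (integrableZl mD _ i2)].
  by rewrite !RintegralZl.
- under eq_Rintegral do rewrite ImM.
  rewrite RintegralD//; [|exact: (integrableZl mD _ i2)|exact: (integrableZl mD _ i1)].
  by rewrite !RintegralZl.
Qed.

Lemma cint_onN D g : measurable D -> cint_on D g ->
  cint_on D (fun x => - g x).
Proof.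
move=> mD ig; apply: eq_cint_on (cint_onZ (-1) mD ig) => // x _.
by rewrite mulN1r.
Qed.

Lemma CintN D g : measurable D -> cint_on D g ->
  Cint D (fun x => - g x) = - Cint D g.
Proof.
move=> mD ig; rewrite -mulN1r -CintZ//; apply: eq_Cint => x _.
by rewrite mulN1r.
Qed.

Lemma cint_onB D g1 g2 : measurable D -> cint_on D g1 -> cint_on D g2 ->
  cint_on D (fun x => g1 x - g2 x).
Proof. by move=> mD i1 i2; apply: cint_onD => //; exact: cint_onN. Qed.

Lemma CintB D g1 g2 : measurable D -> cint_on D g1 -> cint_on D g2 ->
  Cint D (fun x => g1 x - g2 x) = Cint D g1 - Cint D g2.
Proof. by move=> mD i1 i2; rewrite CintD// ?CintN//; exact: cint_onN. Qed.

(** A unimodular factor [u] rotates the integral onto the positive real axis;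
    the real part of [u * g x] is at most its modulus. *)
Lemma cmod_Cint_le D g : measurable D -> cint_on D g ->
  cmod (Cint D g) <= \int[mu]_(x in D) cmod (g x).
Proof.
move=> mD ig; have [I0|I0] := eqVneq (Cint D g) 0.
  by rewrite I0 cmod0 Rintegral_ge0// => x _; exact: cmod_ge0.
set I := Cint D g in I0 *; have cI : 0 < cmod I by rewrite cmod_gt0.
(* the phase that makes u * I a nonnegative real *)
pose u : R[i] := (conjc I) / (cmod I)%:C.
have cu : cmod u = 1.
  rewrite cmodM cmodV cmod_real ger0_norm ?cmod_ge0//.
  have -> : cmod (conjc I) = cmod I.
    by have [] : (`|conjc I| = `|I|) := normcJ I.
  by rewrite mulfV// gt_eqF.
have uI : u * I = (cmod I)%:C.
  rewrite /u mulrAC (mulrC _ I) -sqr_normc cmod_norm expr2 mulfK//.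
  by rewrite -cmod_norm normr_eq0.
have -> : cmod I = complex.Re (Cint D (fun x => u * g x)).
  by rewrite CintZ// -/I uI.
have iu := cint_onZ u mD ig; rewrite /=; apply: le_Rintegral => //.
- by case: iu.
- exact: cint_on_cmod.
- move=> x Dx; rewrite (le_trans (ler_norm _))// (le_trans (Re_le_cmod _))//.
  by rewrite cmodM cu mul1r.
Qed.

Lemma CintU A B g : measurable A -> measurable B -> cint_on (A `|` B) g ->
  [disjoint A & B] -> Cint (A `|` B) g = Cint A g + Cint B g.
Proof.
by move=> mA mB [i1 i2] AB; apply: complex_eq; rewrite /= Rintegral_setU.
Qed.

End Integral.
Arguments Cint : simpl never.

(** * Contour integrals along rectangles *)

Section Segment.
Context {R : realType}.
Local Notation mu := (@lebesgue_measure R).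
Implicit Types (g : R -> R[i]) (a b c : R).

Definition scont a b g := {within `[a, b], continuous g}.

Definition sint a b g : R[i] := Cint `[a, b]%classic g.

Lemma scont_sub a b c d g : a <= c -> d <= b -> scont a b g -> scont c d g.
Proof.
move=> ac db; apply: continuous_subspaceW => x /=; rewrite !in_itv /=.
by move=> /andP[cx xd]; rewrite (le_trans ac cx) (le_trans xd db).
Qed.

Lemma continuous_scont a b g : continuous g -> scont a b g.
Proof. exact: continuous_subspaceT. Qed.

Lemma scontD a b g1 g2 : scont a b g1 -> scont a b g2 ->
  scont a b (fun x => g1 x + g2 x).
Proof. by move=> c1 c2 x; exact: continuousD (c1 x) (c2 x). Qed.

Lemma scontB a b g1 g2 : scont a b g1 -> scont a b g2 ->
  scont a b (fun x => g1 x - g2 x).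
Proof. by move=> c1 c2 x; exact: continuousB (c1 x) (c2 x). Qed.

Lemma scontM a b g1 g2 : scont a b g1 -> scont a b g2 ->
  scont a b (fun x => g1 x * g2 x).
Proof. by move=> c1 c2 x; exact: continuousM (c1 x) (c2 x). Qed.

Lemma scont_cst a b (c : R[i]) : scont a b (fun=> c).
Proof. by apply: continuous_scont => x; exact: cvg_cst. Qed.

Lemma scont_cint a b g : scont a b g -> cint_on `[a, b]%classic g.
Proof.
move=> cg; split; (apply: continuous_compact_integrable;
  [exact: segment_compact|]) => x.
- by apply: continuous_comp; [exact: cg|exact: Re_continuous].
- by apply: continuous_comp; [exact: cg|exact: Im_continuous].
Qed.

Lemma eq_sint a b g1 g2 : (forall x, a <= x <= b -> g1 x = g2 x) ->
  sint a b g1 = sint a b g2.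
Proof. by move=> e; apply: eq_Cint => x /=; rewrite in_itv; exact: e. Qed.

Lemma sintD a b g1 g2 : scont a b g1 -> scont a b g2 ->
  sint a b (fun x => g1 x + g2 x) = sint a b g1 + sint a b g2.
Proof. by move=> c1 c2; apply: CintD => //; exact: scont_cint. Qed.

Lemma sintB a b g1 g2 : scont a b g1 -> scont a b g2 ->
  sint a b (fun x => g1 x - g2 x) = sint a b g1 - sint a b g2.
Proof. by move=> c1 c2; apply: CintB => //; exact: scont_cint. Qed.

Lemma sintZ a b (c : R[i]) g : scont a b g ->
  sint a b (fun x => c * g x) = c * sint a b g.
Proof. by move=> c1; apply: CintZ => //; exact: scont_cint. Qed.

Lemma sint_cst a b (c : R[i]) : a <= b -> sint a b (fun=> c) = (b - a)%:C * c.
Proof.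
move=> ab; rewrite /sint /Cint !Rintegral_cst//=.
rewrite lebesgue_measure_itv /= lte_fin.
move: ab; rewrite le_eqVlt => /predU1P[->|ab].
  by rewrite ltxx subrr mul0r /= !mulr0; apply: complex_eq.
by rewrite ab -EFinB /=; apply: complex_eq; rewrite ?ReM ?ImM /=; ring.
Qed.

Lemma cmod_sint_le a b g : scont a b g ->
  cmod (sint a b g) <= \int[mu]_(x in `[a, b]) cmod (g x).
Proof. by move=> cg; apply: cmod_Cint_le => //; exact: scont_cint. Qed.

Lemma cmod_sint_leM a b g M : a <= b -> scont a b g ->
  (forall x, a <= x <= b -> cmod (g x) <= M) ->
  cmod (sint a b g) <= M * (b - a).
Proof.
move=> ab cg gM; rewrite (le_trans (cmod_sint_le cg))//.
have -> : M * (b - a) = \int[mu]_(x in `[a, b]) M.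
  rewrite Rintegral_cst//= lebesgue_measure_itv /= lte_fin.
  move: ab; rewrite le_eqVlt => /predU1P[->|ab]; last by rewrite ab -EFinB.
  by rewrite ltxx subrr.
apply: le_Rintegral => //.
- by apply: cint_on_cmod => //; exact: scont_cint.
- apply: continuous_compact_integrable; first exact: segment_compact.
  by apply: continuous_subspaceT => x; exact: cvg_cst.
Qed.

Lemma sint_split a c b g : a <= c -> c <= b -> scont a b g ->
  sint a b g = sint a c g + sint c b g.
Proof.
move=> ac cb cg; have [i1 i2] := scont_cint cg.
have E (h : R -> R) : mu.-integrable `[a, b] (EFin \o h) ->
    \int[mu]_(x in `[a, b]) h x =
    \int[mu]_(x in `[a, c]) h x + \int[mu]_(x in `[c, b]) h x.
  move=> ih; have := @Rintegral_itvB R h (BLeft a) (BRight b) c ih.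
  rewrite !bnd_simp => /(_ ac cb) H.
  apply/eqP; rewrite addrC -subr_eq H; apply/eqP.
  apply: Rintegral_itv_obnd_cbnd.
  apply: integrableS ih => // x /=; rewrite !in_itv /= => /andP[cx ->].
  by rewrite (le_trans ac (ltW cx)).
by apply: complex_eq; rewrite /= E.
Qed.

End Segment.
Arguments sint : simpl never.

Local Ltac abstract_sint := repeat match goal with
  |- context [sint ?a ?b ?g] => generalize (sint a b g); intro end.

Section Rectangle.
Context {R : realType}.
Implicit Types (g : R[i] -> R[i]) (x y : R).

(** The contour integral along the boundary of a rectangle, counterclockwise. *)
Definition rint g x1 x2 y1 y2 : R[i] :=
  sint x1 x2 (fun x => g (x +i* y1)) - sint x1 x2 (fun x => g (x +i* y2)) +
  'i%C * (sint y1 y2 (fun y => g (x2 +i* y)) - sint y1 y2 (fun y => g (x1 +i* y))).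

Definition hcont g x1 x2 y := scont x1 x2 (fun x => g (x +i* y)).
Definition vcont g x y1 y2 := scont y1 y2 (fun y => g (x +i* y)).

Definition bcont g x1 x2 y1 y2 :=
  [/\ hcont g x1 x2 y1, hcont g x1 x2 y2, vcont g x1 y1 y2 & vcont g x2 y1 y2].

Lemma rint_splitx g x1 x x2 y1 y2 : x1 <= x -> x <= x2 ->
  hcont g x1 x2 y1 -> hcont g x1 x2 y2 ->
  rint g x1 x2 y1 y2 = rint g x1 x y1 y2 + rint g x x2 y1 y2.
Proof.
move=> h1 h2 c1 c2; rewrite /rint (sint_split h1 h2 c1) (sint_split h1 h2 c2).
by abstract_sint; ring.
Qed.

Lemma rint_splity g x1 x2 y1 y y2 : y1 <= y -> y <= y2 ->
  vcont g x1 y1 y2 -> vcont g x2 y1 y2 ->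
  rint g x1 x2 y1 y2 = rint g x1 x2 y1 y + rint g x1 x2 y y2.
Proof.
move=> h1 h2 c1 c2; rewrite /rint (sint_split h1 h2 c1) (sint_split h1 h2 c2).
by abstract_sint; ring.
Qed.

Lemma cmod_i : cmod ('i%C : R[i]) = 1.
Proof. by rewrite cmod_imag normr1. Qed.

Lemma cmod_rint_le g x1 x2 y1 y2 M : x1 <= x2 -> y1 <= y2 ->
  bcont g x1 x2 y1 y2 ->
  (forall x, x1 <= x <= x2 -> cmod (g (x +i* y1)) <= M) ->
  (forall x, x1 <= x <= x2 -> cmod (g (x +i* y2)) <= M) ->
  (forall y, y1 <= y <= y2 -> cmod (g (x1 +i* y)) <= M) ->
  (forall y, y1 <= y <= y2 -> cmod (g (x2 +i* y)) <= M) ->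
  cmod (rint g x1 x2 y1 y2) <= M * (2 * ((x2 - x1) + (y2 - y1))).
Proof.
move=> xx yy [c1 c2 c3 c4] b1 b2 b3 b4.
have := cmod_sint_leM xx c1 b1; have := cmod_sint_leM xx c2 b2.
have := cmod_sint_leM yy c3 b3; have := cmod_sint_leM yy c4 b4.
rewrite /rint; set s1 := sint _ _ _; set s2 := sint _ _ _.
set s3 := sint _ _ _; set s4 := sint _ _ _ => h1 h2 h3 h4.
have := cmodD (s4 - s3) ('i%C * (s1 - s2)); rewrite cmodM cmod_i mul1r.
by have := cmodB s4 s3; have := cmodB s1 s2; lra.
Qed.

Lemma bcontB g1 g2 x1 x2 y1 y2 : bcont g1 x1 x2 y1 y2 -> bcont g2 x1 x2 y1 y2 ->
  bcont (fun z => g1 z - g2 z) x1 x2 y1 y2.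
Proof.
by case=> a1 a2 a3 a4 [b1 b2 b3 b4]; split;
  [exact: scontB a1 b1|exact: scontB a2 b2|exact: scontB a3 b3|exact: scontB a4 b4].
Qed.

Lemma bcontM g1 g2 x1 x2 y1 y2 : bcont g1 x1 x2 y1 y2 -> bcont g2 x1 x2 y1 y2 ->
  bcont (fun z => g1 z * g2 z) x1 x2 y1 y2.
Proof.
by case=> a1 a2 a3 a4 [b1 b2 b3 b4]; split;
  [exact: scontM a1 b1|exact: scontM a2 b2|exact: scontM a3 b3|exact: scontM a4 b4].
Qed.

Lemma rintD g1 g2 x1 x2 y1 y2 : bcont g1 x1 x2 y1 y2 -> bcont g2 x1 x2 y1 y2 ->
  rint (fun z => g1 z + g2 z) x1 x2 y1 y2 =
  rint g1 x1 x2 y1 y2 + rint g2 x1 x2 y1 y2.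
Proof.
move=> [a1 a2 a3 a4] [b1 b2 b3 b4]; rewrite /rint (sintD a1 b1) (sintD a2 b2).
rewrite (sintD a3 b3) (sintD a4 b4); abstract_sint; ring.
Qed.

Lemma rintB g1 g2 x1 x2 y1 y2 : bcont g1 x1 x2 y1 y2 -> bcont g2 x1 x2 y1 y2 ->
  rint (fun z => g1 z - g2 z) x1 x2 y1 y2 =
  rint g1 x1 x2 y1 y2 - rint g2 x1 x2 y1 y2.
Proof.
move=> [a1 a2 a3 a4] [b1 b2 b3 b4]; rewrite /rint (sintB a1 b1) (sintB a2 b2).
rewrite (sintB a3 b3) (sintB a4 b4); abstract_sint; ring.
Qed.

Lemma rintZ (c : R[i]) g x1 x2 y1 y2 : bcont g x1 x2 y1 y2 ->
  rint (fun z => c * g z) x1 x2 y1 y2 = c * rint g x1 x2 y1 y2.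
Proof.
move=> [a1 a2 a3 a4]; rewrite /rint (sintZ c a1) (sintZ c a2) (sintZ c a3) (sintZ c a4).
abstract_sint; ring.
Qed.

Lemma eq_rint g1 g2 x1 x2 y1 y2 :
  (forall x, x1 <= x <= x2 -> g1 (x +i* y1) = g2 (x +i* y1)) ->
  (forall x, x1 <= x <= x2 -> g1 (x +i* y2) = g2 (x +i* y2)) ->
  (forall y, y1 <= y <= y2 -> g1 (x1 +i* y) = g2 (x1 +i* y)) ->
  (forall y, y1 <= y <= y2 -> g1 (x2 +i* y) = g2 (x2 +i* y)) ->
  rint g1 x1 x2 y1 y2 = rint g2 x1 x2 y1 y2.
Proof.
move=> e1 e2 e3 e4; rewrite /rint.
by rewrite (eq_sint e1) (eq_sint e2) (eq_sint e3) (eq_sint e4).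
Qed.

Lemma continuous_bcont g x1 x2 y1 y2 : continuous g -> bcont g x1 x2 y1 y2.
Proof.
move=> cg; split; apply: continuous_scont => t; apply: continuous_comp;
  do ?[exact: cg|exact: hline_continuous|exact: vline_continuous].
Qed.

Lemma affine_continuous (al be : R[i]) : continuous (fun z => al + be * z).
Proof.
move=> z; apply: (@continuousD _ _ _ (fun=> al)); first exact: cst_continuous.
by apply: (@continuousM _ _ (fun=> be) id); [exact: cst_continuous|].
Qed.

(** Opposite sides differ by a constant, so that each pair of sides
    contributes the area of the rectangle times [be] and plus or minus i; the two
    pairs cancel. *)
Lemma rint_affine (al be : R[i]) x1 x2 y1 y2 : x1 <= x2 -> y1 <= y2 ->
  rint (fun z => al + be * z) x1 x2 y1 y2 = 0.
Proof.
move=> xx yy.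
have [c1 c2 c3 c4] := continuous_bcont x1 x2 y1 y2
  (@affine_continuous al be).
rewrite /rint -(sintB c1 c2) -(sintB c4 c3).
have -> : sint x1 x2 (fun x => al + be * (x +i* y1) - (al + be * (x +i* y2))) =
    sint x1 x2 (fun=> be * (0 +i* (y1 - y2))).
  apply: eq_sint => x _.
  have -> : 0 +i* (y1 - y2) = x +i* y1 - x +i* y2 :> R[i].
    by apply: complex_eq => /=; ring.
  by ring.
have -> : sint y1 y2 (fun y => al + be * (x2 +i* y) - (al + be * (x1 +i* y))) =
    sint y1 y2 (fun=> be * (x2 - x1)%:C).
  apply: eq_sint => y _.
  have -> : (x2 - x1)%:C = x2 +i* y - x1 +i* y :> R[i].
    by apply: complex_eq => /=; ring.
  by ring.
rewrite !sint_cst//.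
have -> : 0 +i* (y1 - y2) = 'i%C * (y1 - y2)%:C :> R[i].
  by apply: complex_eq; rewrite ?ReM ?ImM /=; ring.
have -> : (y1 - y2)%:C = - (y2 - y1)%:C :> R[i].
  by apply: complex_eq => /=; ring.
by ring.
Qed.

End Rectangle.
Arguments rint : simpl never.

(** * Goursat's theorem *)

Section Goursat.
Context {R : realType}.
Implicit Types (g : R[i] -> R[i]) (x y : R).

Definition in_rect x1 x2 y1 y2 : set R[i] :=
  [set z | x1 <= complex.Re z <= x2 /\ y1 <= complex.Im z <= y2].

Lemma within_bcont (A : set R[i]) g x1 x2 y1 y2 :
  {within A, continuous g} ->
  (forall x, x1 <= x <= x2 -> A (x +i* y1)) ->
  (forall x, x1 <= x <= x2 -> A (x +i* y2)) ->
  (forall y, y1 <= y <= y2 -> A (x1 +i* y)) ->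
  (forall y, y1 <= y <= y2 -> A (x2 +i* y)) ->
  bcont g x1 x2 y1 y2.
Proof.
move=> cg h1 h2 h3 h4; split;
  (apply: within_continuous_comp cg _ _;
    [exact: hline_continuous || exact: vline_continuous|]) => t /=;
  by rewrite in_itv /=; auto.
Qed.

Lemma derivable_within (A : set R[i]) g :
  (forall z, A z -> derivable g z 1) -> {within A, continuous g}.
Proof.
move=> dg; apply: continuous_in_subspaceT => z /set_mem Az.
exact/derivable_contC/dg.
Qed.

Lemma derivable_bcont g x1 x2 y1 y2 : x1 <= x2 -> y1 <= y2 ->
  (forall z, in_rect x1 x2 y1 y2 z -> derivable g z 1) -> bcont g x1 x2 y1 y2.
Proof.
by move=> xx yy /derivable_within cg; apply: within_bcont cg _ _ _ _ => t tt;
  split; rewrite /= ?lexx ?xx ?yy.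
Qed.

Lemma exists_divX_lt (x d : R) : 0 < d -> exists n, x / 2 ^+ n < d.
Proof.
move=> d0; have [x0|x0] := lerP x 0.
  by exists 0%N; rewrite expr0 divr1 (le_lt_trans x0).
have := archi_boundP (ltW (divr_gt0 x0 d0)); set n := Num.bound _ => H.
exists n; rewrite ltr_pdivrMr ?exprn_gt0// mulrC -ltr_pdivrMr//.
apply: (lt_le_trans H); rewrite -natrX ler_nat ltnW//; exact: ltn_expl.
Qed.

Lemma rint_quarters g x1 x2 x y1 y2 y : x1 <= x <= x2 -> y1 <= y <= y2 ->
  (forall z, in_rect x1 x2 y1 y2 z -> derivable g z 1) ->
  rint g x1 x2 y1 y2 = rint g x1 x y1 y + rint g x1 x y y2 +
    (rint g x x2 y1 y + rint g x x2 y y2).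
Proof.
move=> /andP[h1 h2] /andP[h3 h4] dg.
have xx := le_trans h1 h2; have yy := le_trans h3 h4.
have [c1 c2 c3 c4] := derivable_bcont xx yy dg.
have c5 : vcont g x y1 y2.
  have dg' : forall z, in_rect x x2 y1 y2 z -> derivable g z 1.
    move=> z [/andP[z1 z2] z3]; apply: dg; split => //.
    by rewrite z2 andbT (le_trans h1).
  by have [] := derivable_bcont h2 yy dg'.
by rewrite (rint_splitx h1 h2 c1 c2) (rint_splity h3 h4 c3 c5)
  (rint_splity h3 h4 c5 c4).
Qed.

(** By [rint_affine] the affine part may be subtracted; what is left is at
    most [eps] times the size of the rectangle, on a path of the same size. *)
Lemma rint_nearly_affine g x1 x2 y1 y2 z0 l eps : 0 <= eps ->
  in_rect x1 x2 y1 y2 z0 -> bcont g x1 x2 y1 y2 ->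
  (forall z, in_rect x1 x2 y1 y2 z ->
    cmod (g z - g z0 - l * (z - z0)) <= eps * cmod (z - z0)) ->
  cmod (rint g x1 x2 y1 y2) <= eps * (2 * ((x2 - x1) + (y2 - y1)) ^+ 2).
Proof.
move=> eps0 [/andP[u1 u2] /andP[u3 u4]] bg gz.
have xx := le_trans u1 u2; have yy := le_trans u3 u4.
set d := _ + _.
have close z : in_rect x1 x2 y1 y2 z -> cmod (z - z0) <= d.
  move=> [/andP[z1 z2] /andP[z3 z4]]; rewrite (le_trans (cmod_le_ReIm _))//.
  rewrite !ReD !ImD !ReN !ImN lerD// ler_norml; clear -z1 z2 z3 z4 u1 u2 u3 u4.
    by lra.
  by lra.
pose al := g z0 - l * z0.
have ba := continuous_bcont x1 x2 y1 y2 (@affine_continuous _ al l).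
have -> : rint g x1 x2 y1 y2 = rint (fun z => g z - (al + l * z)) x1 x2 y1 y2.
  by rewrite rintB// rint_affine// subr0.
have small z : in_rect x1 x2 y1 y2 z -> cmod (g z - (al + l * z)) <= eps * d.
  move=> zr; have -> : g z - (al + l * z) = g z - g z0 - l * (z - z0).
    by rewrite /al; ring.
  by rewrite (le_trans (gz _ zr))// ler_wpM2l// close.
have -> : eps * (2 * d ^+ 2) = eps * d * (2 * d) by ring.
apply: (cmod_rint_le xx yy (bcontB bg ba)).
all: by move=> t /andP[t1 t2]; apply: small; split; rewrite /= ?lexx ?xx ?yy ?t1 ?t2.
Qed.

(** Four quarters below [e] would leave the whole below [4 e]. *)
Lemma quarter_large g a b w h e :
  0 <= w -> 0 <= h ->
  (forall z, in_rect a (a + (w + w)) b (b + (h + h)) z -> derivable g z 1) ->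
  e + e + (e + e) <= cmod (rint g a (a + (w + w)) b (b + (h + h))) ->
  exists q : R * R, [/\ e <= cmod (rint g q.1 (q.1 + w) q.2 (q.2 + h)),
    q.1 = a \/ q.1 = a + w & q.2 = b \/ q.2 = b + h].
Proof.
move=> w0 h0 dg; rewrite !addrA in dg *.
rewrite (@rint_quarters g a _ (a + w) b _ (b + h)) ?lerDl ?w0 ?h0// => He.
apply/not_existsP => Hn.
have K q : (q.1 = a \/ q.1 = a + w) -> (q.2 = b \/ q.2 = b + h) ->
    cmod (rint g q.1 (q.1 + w) q.2 (q.2 + h)) < e.
  by move=> k1 k2; rewrite ltNge; apply/negP => k3; apply: (Hn q).
have := K (a, b) (or_introl erefl) (or_introl erefl).
have := K (a, b + h) (or_introl erefl) (or_intror erefl).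
have := K (a + w, b) (or_intror erefl) (or_introl erefl).
have := K (a + w, b + h) (or_intror erefl) (or_intror erefl).
move: He; rewrite leNgt => /negP + /= k1 k2 k3 k4; apply.
move: k1 k2 k3 k4; move: (rint _ _ _ _ _) (rint _ _ _ _ _) => s1 s2.
move: (rint _ _ _ _ _) (rint _ _ _ _ _) => s3 s4; clear=> k1 k2 k3 k4.
have := cmodD (s3 + s4) (s1 + s2); have := cmodD s3 s4; have := cmodD s1 s2.
by lra.
Qed.

(** Bisection: if the integral had modulus [e > 0], there would be nested
    rectangles of size 2^-n whose integrals are at least e / 4^n, while
    differentiability at their common point makes these integrals [o(4^-n)]. *)
Lemma goursat g x1 x2 y1 y2 : x1 <= x2 -> y1 <= y2 ->
  (forall z, in_rect x1 x2 y1 y2 z -> derivable g z 1) ->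
  rint g x1 x2 y1 y2 = 0.
Proof.
move=> xx yy dg; apply/eqP; rewrite -cmod_eq0 eq_le cmod_ge0 andbT leNgt.
apply/negP => e0; set e := cmod _ in e0.
pose w := x2 - x1; pose h := y2 - y1.
have w0 : 0 <= w by rewrite subr_ge0.
have h0 : 0 <= h by rewrite subr_ge0.
pose J n (p : R * R) :=
  rint g p.1 (p.1 + w / 2 ^+ n) p.2 (p.2 + h / 2 ^+ n).
pose P n (p : R * R) := [/\ e / 4 ^+ n <= cmod (J n p),
  x1 <= p.1, p.1 + w / 2 ^+ n <= x2, y1 <= p.2 & p.2 + h / 2 ^+ n <= y2].
have dv (v : R) n : v / 2 ^+ n = v / 2 ^+ n.+1 + v / 2 ^+ n.+1.
  by rewrite exprS; field; rewrite expf_neq0.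
have step n p : P n p -> exists q, P n.+1 q /\
    [/\ p.1 <= q.1, q.1 + w / 2 ^+ n.+1 <= p.1 + w / 2 ^+ n,
        p.2 <= q.2 & q.2 + h / 2 ^+ n.+1 <= p.2 + h / 2 ^+ n].
  case: p => a b [] /= He h1 h2 h3 h4.
  have wn : 0 <= w / 2 ^+ n.+1 by rewrite divr_ge0// exprn_ge0.
  have hn : 0 <= h / 2 ^+ n.+1 by rewrite divr_ge0// exprn_ge0.
  have E4 : e / 4 ^+ n = e / 4 ^+ n.+1 + e / 4 ^+ n.+1 +
      (e / 4 ^+ n.+1 + e / 4 ^+ n.+1).
    by rewrite exprS; field; rewrite expf_neq0.
  move: He h2 h4; rewrite /J /P /= E4 !(dv _ n).
  set w' := w / _ in wn *; set h' := h / _ in hn * => He h2 h4.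
  have [|q [Hq q1 q2]] := quarter_large wn hn _ He.
    move=> z [/andP[z1 z2] /andP[z3 z4]]; apply: dg; split.
      by rewrite (le_trans h1 z1) (le_trans z2 h2).
    by rewrite (le_trans h3 z3) (le_trans z4 h4).
  have [u1 u2 u3 u4] : [/\ x1 <= q.1, q.1 + w' <= x2, a <= q.1 &
      q.1 + w' <= a + (w' + w')].
    clear -h1 h2 wn q1; move: w' (q.1) wn q1 h2 => v c v0 q1 h2.
    by case: q1 => ->; split; lra.
  have [v1 v2 v3 v4] : [/\ y1 <= q.2, q.2 + h' <= y2, b <= q.2 &
      q.2 + h' <= b + (h' + h')].
    clear -h3 h4 hn q2; move: h' (q.2) hn q2 h4 => v c v0 q1 h2.
    by case: q1 => ->; split; lra.
  by exists q.
have P0 : P 0%N (x1, y1).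
  rewrite /P /J /= !expr0 !divr1 /w /h !(addrC x1) !(addrC y1) !subrK.
  by split.
(* dependent choice of one large quarter at each stage *)
pose F : forall n, {p | P n p} := fix F n := match n with
  | 0%N => exist _ (x1, y1) P0
  | n'.+1 => let s := F n' in
     let c := cid (step n' (sval s) (svalP s)) in
     exist _ (sval c) (proj1 (svalP c)) end.
pose p n := sval (F n).
have Pp n : P n (p n) := svalP (F n).
have pS n : [/\ (p n).1 <= (p n.+1).1,
    (p n.+1).1 + w / 2 ^+ n.+1 <= (p n).1 + w / 2 ^+ n,
    (p n).2 <= (p n.+1).2 &
    (p n.+1).2 + h / 2 ^+ n.+1 <= (p n).2 + h / 2 ^+ n].
  exact: (proj2 (svalP (cid (step n (sval (F n)) (svalP (F n)))))).
have pM n k : [/\ (p n).1 <= (p (n + k)%N).1,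
    (p (n + k)%N).1 + w / 2 ^+ (n + k) <= (p n).1 + w / 2 ^+ n,
    (p n).2 <= (p (n + k)%N).2 &
    (p (n + k)%N).2 + h / 2 ^+ (n + k) <= (p n).2 + h / 2 ^+ n].
  elim: k => [|k [a1 a2 a3 a4]]; first by rewrite addn0.
  have [b1 b2 b3 b4] := pS (n + k)%N; rewrite addnS; split.
  - exact: le_trans b1.
  - exact: le_trans a2.
  - exact: le_trans b3.
  - exact: le_trans a4.
have pos (v : R) n : 0 <= v -> 0 <= v / 2 ^+ n.
  by move=> v0; rewrite divr_ge0// exprn_ge0.
have ub n m : (p m).1 <= (p n).1 + w / 2 ^+ n /\ (p m).2 <= (p n).2 + h / 2 ^+ n.
  have [/subnKC <-|/ltnW/subnKC <-] := leqP n m.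
    have [_ a2 _ a4] := pM n (m - n)%N.
    by split; apply: le_trans _ a2 || apply: le_trans _ a4; rewrite lerDl pos.
  have [a1 _ a3 _] := pM m (n - m)%N.
  by split; apply: le_trans a1 _ || apply: le_trans a3 _; rewrite lerDl pos.
(* the lower left corners increase to a point common to all rectangles *)
pose xs := sup (range (fun n => (p n).1)); pose ys := sup (range (fun n => (p n).2)).
have s1 : has_sup (range (fun n => (p n).1)).
  split; first by exists (p 0%N).1, 0%N.
  by exists ((p 0%N).1 + w / 2 ^+ 0) => _ [m _ <-]; have [] := ub 0%N m.
have s2 : has_sup (range (fun n => (p n).2)).
  split; first by exists (p 0%N).2, 0%N.
  by exists ((p 0%N).2 + h / 2 ^+ 0) => _ [m _ <-]; have [] := ub 0%N m.
have lx n : (p n).1 <= xs by apply: ub_le_sup; [case: s1|exists n].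
have ly n : (p n).2 <= ys by apply: ub_le_sup; [case: s2|exists n].
have ux n : xs <= (p n).1 + w / 2 ^+ n.
  by apply: ge_sup => [|_ [m _ <-]]; [case: s1|have [] := ub n m].
have uy n : ys <= (p n).2 + h / 2 ^+ n.
  by apply: ge_sup => [|_ [m _ <-]]; [case: s2|have [] := ub n m].
have /derivableC_cmod[l dl] : derivable g (xs +i* ys) 1.
  apply: dg; have [_ a1 a2 a3 a4] := Pp 0%N.
  by split => /=; rewrite ?(le_trans a1 (lx _)) ?(le_trans (ux _) a2)
    ?(le_trans a3 (ly _)) ?(le_trans (uy _) a4).
pose d := w + h; have d0 : 0 <= d by rewrite addr_ge0.
(* small enough for 2 eps d^2 < e, also when d = 0 *)
pose eps := e / (4 * (d ^+ 2 + 1)).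
have d21 : 0 < 4 * (d ^+ 2 + 1) by rewrite mulr_gt0// ltr_wpDl// sqr_ge0.
have eps0 : 0 < eps by rewrite divr_gt0.
have [del del0 {}dl] := dl _ eps0.
have [n nd] := exists_divX_lt d del0.
have [He a1 a2 a3 a4] := Pp n.
have dn : d / 2 ^+ n = w / 2 ^+ n + h / 2 ^+ n by rewrite mulrDl.
have z0n : in_rect (p n).1 ((p n).1 + w / 2 ^+ n) (p n).2
    ((p n).2 + h / 2 ^+ n) (xs +i* ys).
  by split; rewrite /= ?lx ?ux ?ly ?uy.
have bg : bcont g (p n).1 ((p n).1 + w / 2 ^+ n) (p n).2
    ((p n).2 + h / 2 ^+ n).
  apply: derivable_bcont => [||z [/andP[z1 z2] /andP[z3 z4]]].
  - by rewrite lerDl pos.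
  - by rewrite lerDl pos.
  apply: dg; split.
    by rewrite (le_trans a1 z1) (le_trans z2 a2).
  by rewrite (le_trans a3 z3) (le_trans z4 a4).
have := rint_nearly_affine (ltW eps0) z0n bg (l := l).
rewrite !(addrC _ (w / _)) !(addrC _ (h / _)) !addrK -dn.
rewrite !(addrC (w / _)) !(addrC (h / _)) => H.
have {H} : cmod (J n (p n)) <= eps * (2 * (d / 2 ^+ n) ^+ 2).
  apply: H => z [/andP[z1 z2] /andP[z3 z4]]; apply: dl.
  rewrite (le_lt_trans (cmod_le_ReIm _))//; apply: le_lt_trans nd.
  have := lx n; have := ly n; have := ux n; have := uy n; rewrite dn.
  rewrite !ReD !ImD !ReN !ImN /=; clear -z1 z2 z3 z4 => k1 k2 k3 k4.
  by apply: lerD; rewrite ler_norml; lra.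
move=> /(le_trans He); apply/negP; rewrite -ltNge.
have -> : eps * (2 * (d / 2 ^+ n) ^+ 2) = (eps * (2 * d ^+ 2)) / 4 ^+ n.
  by rewrite expr_div_n -exprM mulnC exprM -[2 ^+ 2]natrX /= !mulrA.
rewrite ltr_pM2r ?invr_gt0 ?exprn_gt0// /eps mulrAC ltr_pdivrMr// ltr_pM2l//.
by have := sqr_ge0 d; clear; lra.
Qed.

End Goursat.

(** * Goursat's theorem with continuous boundary values *)

Section GoursatClosed.
Context {R : realType}.
Implicit Types (g : R[i] -> R[i]) (x y : R).

Lemma within_cont_cmod (A : set R[i]) g :
  {within A, continuous g} <-> forall z, A z -> forall e : R, 0 < e ->
    exists2 d : R, 0 < d & forall w, A w -> cmod (w - z) < d ->
      cmod (g w - g z) < e.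
Proof.
split=> [/subspace_continuousP cg z Az e e0|H].
  have /cvgC_cmod/(_ _ e0)/nbhsC_cmod[d d0 dH] := cg _ Az.
  by exists d => // w Aw wz; exact: dH.
apply/subspace_continuousP => z Az; apply/cvgC_cmod => e e0.
have [d d0 dH] := H _ Az _ e0; apply/nbhsC_cmod; exists d => // w wz Aw.
exact: dH.
Qed.

Lemma within_continuousM (A : set R[i]) (f g : R[i] -> R[i]) : {within A, continuous f} ->
  {within A, continuous g} -> {within A, continuous (fun z => f z * g z)}.
Proof. by move=> cf cg z; apply: continuousM; [exact: cf|exact: cg]. Qed.

Lemma cmod_continuous : continuous (fun z : R[i] => cmod z).
Proof.
move=> z A /nbhs_ballP[e /= e0 eA]; apply/nbhsC_cmod; exists e => // w wz.
apply: eA; rewrite -ball_normE /= distrC (le_lt_trans _ wz)//.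
have := cmodD (w - z) z; have := cmodD (z - w) w.
by rewrite !subrK (cmod_distC z w) ler_norml => ? ?; lra.
Qed.

Lemma scont_bounded a b (g : R -> R[i]) : scont a b g ->
  exists2 M, 0 <= M & forall x, a <= x <= b -> cmod (g x) <= M.
Proof.
move=> cg; have [ab|ba] := leP a b; last first.
  by exists 0 => // x /andP[ax xb]; have := lt_le_trans ba (le_trans ax xb);
    rewrite ltxx.
have [|c _ H] := @EVT_max R (fun x => cmod (g x)) a b ab.
  by move=> x; apply: continuous_comp; [exact: cg|exact: cmod_continuous].
exists (cmod (g c)); first exact: cmod_ge0.
by move=> x xab; apply: H; rewrite in_itv.
Qed.

(** Compactness of [[x1, x2]] makes the continuity in the height uniform
    along a horizontal segment. *)
Lemma hline_uniform g x1 x2 y1 y2 y0 (e : R) : y1 <= y0 <= y2 -> 0 < e ->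
  {within in_rect x1 x2 y1 y2, continuous g} ->
  exists2 d : R, 0 < d & forall y, y1 <= y <= y2 -> `|y - y0| < d ->
    forall x, x1 <= x <= x2 -> cmod (g (x +i* y) - g (x +i* y0)) <= e.
Proof.
move=> y0I e0 /within_cont_cmod cg.
have /compact_near_coveringP/near_covering_withinP := @segment_compact R x1 x2.
pose P (y x : R) := cmod (g (x +i* y) - g (x +i* y0)) <= e.
have FF : Filter (within [set y | y1 <= y <= y2] (nbhs y0)).
  exact: within_filter.
move=> /(_ R (within [set y | y1 <= y <= y2] (nbhs y0)) P FF) H.
have {H} : \forall y \near within [set y | y1 <= y <= y2] (nbhs y0),
    forall x, x1 <= x <= x2 -> P y x.
  suff : \forall y \near within [set y | y1 <= y <= y2] (nbhs y0),
      `[x1, x2] `<=` P y.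
    by apply: filterS => y + x xI; apply; rewrite /= in_itv.
  apply: H => x; rewrite /= in_itv /= => xI.
  have e20 : 0 < e / 2 by rewrite divr_gt0.
  have [//|d d0 dH] := cg (x +i* y0) _ _ e20.
  have d20 : 0 < d / 2 by rewrite divr_gt0.
  exists (ball x (d / 2), [set y | y1 <= y <= y2 /\ `|y - y0| < d / 2]).
    split; first exact: nbhsx_ballx.
    by apply/nbhs_ballP; exists (d / 2) => // y yd yI; split => //;
      move: yd; rewrite -ball_normE /= distrC.
  move=> [x' y] /= [+ [yI yy]]; rewrite -ball_normE /= distrC in_itv /=.
  move=> xx x'I.
  have k1 : cmod (x' +i* y - x +i* y0) < d.
    rewrite (le_lt_trans (cmod_le_ReIm _))// !ReD !ImD !ReN !ImN /=.
    by rewrite (splitr d) ltrD.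
  have k2 : cmod (x' +i* y0 - x +i* y0) < d.
    rewrite (le_lt_trans (cmod_le_ReIm _))// !ReD !ImD !ReN !ImN /= subrr.
    by rewrite normr0 addr0 (lt_trans xx)// gtr_pMr// invf_lt1// ltr1n.
  have := dH (x' +i* y) (conj x'I yI) k1.
  have := dH (x' +i* y0) (conj x'I y0I) k2.
  rewrite /P; have := cmodB (g (x' +i* y) - g (x +i* y0))
    (g (x' +i* y0) - g (x +i* y0)).
  have -> : g (x' +i* y) - g (x +i* y0) - (g (x' +i* y0) - g (x +i* y0)) =
    g (x' +i* y) - g (x' +i* y0) by ring.
  clear; move: (cmod _) (cmod _) (cmod _) => a b c; lra.
move=> /nbhs_ballP[d /= d0 dP]; exists d => // y yI yd x xI.
by apply: dP => //; rewrite -ball_normE /= distrC.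
Qed.

Lemma sint_hline_cont g x1 x2 y1 y2 y0 (e : R) : x1 <= x2 -> y1 <= y0 <= y2 ->
  0 < e -> {within in_rect x1 x2 y1 y2, continuous g} ->
  exists2 d : R, 0 < d & forall y, y1 <= y <= y2 -> `|y - y0| < d ->
    cmod (sint x1 x2 (fun x => g (x +i* y)) -
          sint x1 x2 (fun x => g (x +i* y0))) <= e.
Proof.
move=> xx y0I e0 cg.
have L0 : 0 < x2 - x1 + 1 by rewrite ltr_wpDl// subr_ge0.
have [d d0 dH] := hline_uniform y0I (divr_gt0 e0 L0) cg.
exists d => // y yI yd.
have hc y' : y1 <= y' <= y2 -> hcont g x1 x2 y'.
  move=> y'I; apply: within_continuous_comp cg _ _.
    exact: hline_continuous.
  by move=> t /=; rewrite in_itv /=.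
rewrite -sintB; [|exact: hc..].
apply: (le_trans (cmod_sint_leM xx (scontB (hc _ yI) (hc _ y0I)) (dH _ yI yd))).
rewrite mulrAC ler_pdivrMr// ler_wpM2l ?(ltW e0)// lerDl//.
Qed.

(** The function of the theorem is only continuous on the edges of its strip.
    Here the rectangle is cut at distance [d] from its horizontal sides: the inner
    part contributes nothing by [goursat], and the rest tends to 0 with [d]. *)
Lemma goursat_closed g x1 x2 y1 y2 : x1 <= x2 -> y1 < y2 ->
  (forall z, x1 <= complex.Re z <= x2 -> y1 < complex.Im z < y2 ->
     derivable g z 1) ->
  {within in_rect x1 x2 y1 y2, continuous g} ->
  rint g x1 x2 y1 y2 = 0.
Proof.
move=> xx yy dg cg; have yy' := ltW yy.
apply/eqP; rewrite -cmod_eq0 eq_le cmod_ge0 andbT; apply/ler_addgt0Pl => e e0.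
rewrite addr0.
have vc x : x1 <= x <= x2 -> vcont g x y1 y2.
  move=> xI; apply: within_continuous_comp cg _ _; first exact: vline_continuous.
  by move=> t /=; rewrite in_itv /=.
have c1 := vc x1; rewrite lexx xx in c1; have {}c1 := c1 isT.
have c2 := vc x2; rewrite lexx xx in c2; have {}c2 := c2 isT.
have [M1 M10 b1] := scont_bounded c1; have [M2 M20 b2] := scont_bounded c2.
have e8 : 0 < e / 4 by rewrite divr_gt0.
have i1 : y1 <= y1 <= y2 by rewrite lexx.
have i2 : y1 <= y2 <= y2 by rewrite lexx yy'.
have [d1 d10 D1] := sint_hline_cont xx i1 e8 cg.
have [d2 d20 D2] := sint_hline_cont xx i2 e8 cg.
pose M := M1 + M2 + 1; have M0 : 0 < M by rewrite ltr_wpDl// addr_ge0.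
pose d := Num.min (Num.min (d1 / 2) (d2 / 2))
  (Num.min ((y2 - y1) / 2) (e / (4 * M))).
have yy0 : 0 < y2 - y1 by rewrite subr_gt0.
have d0 : 0 < d by rewrite !lt_min !divr_gt0// mulr_gt0.
have dd1 : d <= d1 / 2 by rewrite !ge_min lexx.
have dd2 : d <= d2 / 2 by rewrite !ge_min lexx !orbT.
have dd3 : d <= (y2 - y1) / 2 by rewrite !ge_min lexx !orbT.
have dd4 : d <= e / (4 * M) by rewrite !ge_min lexx !orbT.
have dM : M * d <= e / 4.
  by rewrite mulrC -ler_pdivlMr// (le_trans dd4)// invfM mulrA.
have := D1 (y1 + d); have := D2 (y2 - d).
have -> : y1 <= y2 - d <= y2 by apply/andP; split; lra.
have -> : y1 <= y1 + d <= y2 by apply/andP; split; lra.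
have -> : `|y2 - d - y2| < d2 by rewrite ltr_norml; apply/andP; split; lra.
have -> : `|y1 + d - y1| < d1 by rewrite ltr_norml; apply/andP; split; lra.
move=> /(_ isT isT) h2 /(_ isT isT) h1.
have := @goursat R g x1 x2 (y1 + d) (y2 - d) xx.
have -> : y1 + d <= y2 - d by lra.
move=> /(_ isT) G0.
have {}G0 : rint g x1 x2 (y1 + d) (y2 - d) = 0.
  apply: G0 => z [z1 /andP[z2 z3]]; apply: dg => //.
  by rewrite (lt_le_trans _ z2) ?ltrDl// (le_lt_trans z3)// gtrDl oppr_lt0.
have S x : vcont g x y1 y2 -> sint y1 y2 (fun y => g (x +i* y)) =
    sint y1 (y1 + d) (fun y => g (x +i* y)) +
    sint (y1 + d) (y2 - d) (fun y => g (x +i* y)) +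
    sint (y2 - d) y2 (fun y => g (x +i* y)).
  move=> c; have u1 : y1 <= y1 + d by lra.
  have u2 : y1 + d <= y2 by lra.
  have u3 : y1 + d <= y2 - d by lra.
  have u4 : y2 - d <= y2 by lra.
  rewrite (sint_split u1 u2 c) (sint_split u3 u4); first by rewrite addrA.
  by apply: scont_sub c.
have B x M' : vcont g x y1 y2 -> (forall y, y1 <= y <= y2 -> cmod (g (x +i* y)) <= M') ->
    cmod (sint y1 (y1 + d) (fun y => g (x +i* y))) <= M' * d /\
    cmod (sint (y2 - d) y2 (fun y => g (x +i* y))) <= M' * d.
  move=> c bM; have -> : M' * d = M' * (y1 + d - y1) by ring.
  split; last have -> : M' * (y1 + d - y1) = M' * (y2 - (y2 - d)) by ring.
    apply: cmod_sint_leM; first by lra.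
      by apply: scont_sub c => //; lra.
    by move=> t /andP[t1 t2]; apply: bM; apply/andP; split; lra.
  apply: cmod_sint_leM; first by lra.
    by apply: scont_sub c => //; lra.
  by move=> t /andP[t1 t2]; apply: bM; apply/andP; split; lra.
have [k1 k2] := B _ _ c1 b1; have [k3 k4] := B _ _ c2 b2.
move: G0; rewrite /rint (S _ c1) (S _ c2) => G0.
move: h1 h2 k1 k2 k3 k4 G0.
move: (sint _ _ _) (sint _ _ _) => T1 T2 h1.
move: (sint _ _ _) (sint _ _ _) => T3 T4 h2.
move: (sint _ _ _) => V1 k1.
move: (sint _ _ _) => V2 k2.
move: (sint _ _ _) => V3 k3.
move: (sint _ _ _) => V4 k4.
move: (sint _ _ _) (sint _ _ _) => U1 U2 G0.
have -> : T1 - T3 + 'i%C * (V3 + U2 + V4 - (V1 + U1 + V2)) =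
    (T4 - T3 - (T2 - T1)) + 'i%C * ((V3 + V4) - (V1 + V2)) +
    (T2 - T4 + 'i%C * (U2 - U1)) by ring.
rewrite G0 addr0.
have hM : (M1 + M2) * d <= e / 4.
  by rewrite (le_trans _ dM)// ler_wpM2r ?(ltW d0)// lerDl.
have q1 := cmodB (T4 - T3) (T2 - T1).
have q2 := cmodD (T4 - T3 - (T2 - T1)) ('i%C * ((V3 + V4) - (V1 + V2))).
rewrite cmodM cmod_i mul1r in q2.
have q3 := cmodB (V3 + V4) (V1 + V2).
have q4 := cmodD V3 V4; have q5 := cmodD V1 V2.
rewrite mulrDl in hM.
clear -hM h1 h2 k1 k2 k3 k4 q1 q2 q3 q4 q5.
by lra.
Qed.

End GoursatClosed.

(** * Isolated singularities *)

Section Poles.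
Context {R : realType}.
Implicit Types (g : R[i] -> R[i]) (x y r : R) (p z : R[i]) (S : seq R[i]).

(** The contour integral along the square of centre [p] and half-side [r]. *)
Definition sq g p r := rint g (complex.Re p - r) (complex.Re p + r)
  (complex.Im p - r) (complex.Im p + r).

Definition poles_in S g x1 x2 y1 y2 :=
  (forall p, p \in S -> x1 < complex.Re p < x2 /\ y1 < complex.Im p < y2) /\
  (forall z, in_rect x1 x2 y1 y2 z -> z \notin S -> derivable g z 1).

Lemma poles_bcont S g x1 x2 y1 y2 : x1 <= x2 -> y1 <= y2 ->
  poles_in S g x1 x2 y1 y2 -> bcont g x1 x2 y1 y2.
Proof.
move=> xx yy [Sin dg].
have cg : {within in_rect x1 x2 y1 y2 `&` [set z | z \notin S], continuous g}.
  by apply: derivable_within => z [zr zS]; exact: dg.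
apply: (within_bcont cg) => t tt; split => /=; first by split; rewrite /= ?lexx ?yy.
- by apply/negP => /Sin /= [_]; rewrite ltxx.
- by split; rewrite /= ?lexx ?yy.
- by apply/negP => /Sin /= [_]; rewrite ltxx andbF.
- by split; rewrite /= ?lexx ?xx.
- by apply/negP => /Sin /= []; rewrite ltxx.
- by split; rewrite /= ?lexx ?xx.
- by apply/negP => /Sin /= []; rewrite ltxx andbF.
Qed.

(** The rectangle minus the square consists of four rectangles without
    singularity. *)
Lemma rint_sq g p x1 x2 y1 y2 r : 0 < r ->
  poles_in [:: p] g x1 x2 y1 y2 ->
  x1 <= complex.Re p - r -> complex.Re p + r <= x2 ->
  y1 <= complex.Im p - r -> complex.Im p + r <= y2 ->
  rint g x1 x2 y1 y2 = sq g p r.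
Proof.
case: p => a b /= r0 Sg h1 h2 h3 h4; have [_ dg] := Sg.
have xx : x1 <= x2 by lra.
have yy : y1 <= y2 by lra.
have [c1 c2 _ _] := poles_bcont xx yy Sg.
have Sm : poles_in [:: a +i* b] g (a - r) (a + r) y1 y2.
  split=> [p|z [z1 z2] zp].
    by rewrite inE => /eqP -> /=; split; apply/andP; split; lra.
  by apply: dg => //; split => //; apply/andP; case/andP: z1; split; lra.
have l1 : a - r <= a + r by lra.
have [_ _ c3 c4] := poles_bcont l1 yy Sm.
have G u1 u2 v1 v2 : u1 <= u2 -> v1 <= v2 -> x1 <= u1 -> u2 <= x2 -> y1 <= v1 ->
    v2 <= y2 -> [|| u2 < a, a < u1, v2 < b | b < v1] -> rint g u1 u2 v1 v2 = 0.
  move=> uu vv k1 k2 k3 k4 out; apply: goursat => // z [/andP[z1 z2] /andP[z3 z4]].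
  apply: dg; first by split; apply/andP; split; lra.
  rewrite inE; apply/negP => /eqP ze; move: out z1 z2 z3 z4; rewrite ze /=.
  by case/or4P; lra.
have l2 : a + r <= x2 by [].
have l3 : a - r <= x2 by lra.
have l4 : b - r <= y2 by lra.
have l5 : b - r <= b + r by lra.
have G1 : rint g x1 (a - r) y1 y2 = 0 by apply: G; lra.
have G2 : rint g (a + r) x2 y1 y2 = 0 by apply: G; lra.
have G3 : rint g (a - r) (a + r) y1 (b - r) = 0 by apply: G; lra.
have G4 : rint g (a - r) (a + r) (b + r) y2 = 0 by apply: G; lra.
rewrite (rint_splitx h1 l3 c1 c2) G1 add0r.
rewrite (rint_splitx l1 l2 (scont_sub h1 (lexx _) c1) (scont_sub h1 (lexx _) c2)).
rewrite G2 addr0 (rint_splity h3 l4 c3 c4) G3 add0r.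
rewrite (rint_splity l5 h4 (scont_sub h3 (lexx _) c3) (scont_sub h3 (lexx _) c4)).
by rewrite G4 addr0.
Qed.

Lemma exists_between_notin (s : seq R) u v : u < v ->
  exists c, [/\ u < c, c < v & c \notin s].
Proof.
elim: s u v => [|t s IH] u v uv.
  by exists ((u + v) / 2); rewrite midf_lt// midf_lt.
have [ut|tu] := ltP u t; last first.
  have [c [uc cv cs]] := IH _ _ uv; exists c; split => //.
  by rewrite inE negb_or cs andbT gt_eqF// (le_lt_trans tu).
have [|c [uc cv cs]] := IH u (Num.min t v); first by rewrite lt_min ut.
move: cv; rewrite lt_min => /andP[ct cv]; exists c; split => //.
by rewrite inE negb_or cs andbT lt_eqF.
Qed.

Lemma size_filter_lt (T : eqType) (a : pred T) (s : seq T) (u : T) :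
  u \in s -> ~~ a u -> (size (seq.filter a s) < size s)%N.
Proof.
move=> xs ax; rewrite size_filter ltn_neqAle count_size andbT.
rewrite -all_count; apply/negP => /allP/(_ _ xs); exact/negP.
Qed.

(** The residue theorem for rectangles, where [phi p] takes the place of
    2 pi i times the residue at [p]: it is the common value of the integrals along
    all small squares about [p]. By induction on the number of singularities: two
    of them differ in a coordinate, and a line between them that misses all the
    others separates the rectangle into two with fewer singularities. *)
Lemma rint_poles g (phi : R[i] -> R[i]) S x1 x2 y1 y2 : uniq S ->
  x1 <= x2 -> y1 <= y2 -> poles_in S g x1 x2 y1 y2 ->
  (forall p, p \in S -> exists2 rho : R, 0 < rho &
     forall r, 0 < r -> r < rho -> sq g p r = phi p) ->
  rint g x1 x2 y1 y2 = \sum_(p <- S) phi p.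
Proof.
elim: {S}(size S) {-2}S (leqnn (size S)) x1 x2 y1 y2 => [|n IH] S.
  rewrite leqn0 size_eq0 => /eqP -> x1 x2 y1 y2 _ xx yy [_ dg] _.
  by rewrite big_nil goursat// => z zr; exact: dg.
case: S => [|p [|q S]] sS x1 x2 y1 y2 uS xx yy Sg ph.
- rewrite big_nil goursat// => z zr; exact: (proj2 Sg).
- rewrite big_seq1; have [rho rho0 sqp] := ph p (mem_head _ _).
  have [/andP[p1 p2] /andP[p3 p4]] := proj1 Sg p (mem_head _ _).
  pose r := Num.min (rho / 2) (Num.min
    (Num.min (complex.Re p - x1) (x2 - complex.Re p))
    (Num.min (complex.Im p - y1) (y2 - complex.Im p))).
  have r0 : 0 < r by rewrite !lt_min !subr_gt0 p1 p2 p3 p4 divr_gt0.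
  have r1 : r <= rho / 2 by rewrite !ge_min lexx.
  have r2 : r <= complex.Re p - x1 by rewrite !ge_min lexx !orbT.
  have r3 : r <= x2 - complex.Re p by rewrite !ge_min lexx !orbT.
  have r4 : r <= complex.Im p - y1 by rewrite !ge_min lexx !orbT.
  have r5 : r <= y2 - complex.Im p by rewrite !ge_min lexx !orbT.
  by rewrite (rint_sq r0 Sg) ?sqp//; lra.
set T := [:: p, q & S] in sS uS Sg ph *.
have pT : p \in T by rewrite mem_head.
have qT : q \in T by rewrite !inE eqxx orbT.
have pq : p != q by move: uS; rewrite /= inE negb_or => /andP[/andP[]].
have cut (a : pred R[i]) : (exists2 s, s \in T & a s) ->
    (exists2 s, s \in T & ~~ a s) -> forall u1 u2 v1 v2 u1' u2' v1' v2',
    u1 <= u2 -> v1 <= v2 -> u1' <= u2' -> v1' <= v2' ->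
    poles_in (seq.filter a T) g u1 u2 v1 v2 ->
    poles_in (seq.filter (predC a) T) g u1' u2' v1' v2' ->
    rint g u1 u2 v1 v2 + rint g u1' u2' v1' v2' = \sum_(t <- T) phi t.
  move=> [s sT as_] [s' s'T as'] u1 u2 v1 v2 u1' u2' v1' v2' uu vv uu' vv' P1 P2.
  rewrite (bigID a) /=; congr (_ + _); rewrite -big_filter; apply: IH => //.
  - by rewrite -ltnS (leq_trans _ sS)// (size_filter_lt s'T).
  - exact: filter_uniq.
  - by move=> t; rewrite mem_filter => /andP[_]; exact: ph.
  - by rewrite -ltnS (leq_trans _ sS)// (size_filter_lt sT)//= as_.
  - exact: filter_uniq.
  - by move=> t; rewrite mem_filter => /andP[_]; exact: ph.
have [c1 c2 c3 c4] := poles_bcont xx yy Sg.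
have [Sin dg] := Sg.
have [Re_ne|Re_eq] := eqVneq (complex.Re p) (complex.Re q).
  have Im_ne : complex.Im p != complex.Im q.
    by apply: contra_neq pq => Im_eq; exact: complex_eq.
  have [c [mc cM cT]] : exists c, [/\
      Num.min (complex.Im p) (complex.Im q) < c,
      c < Num.max (complex.Im p) (complex.Im q) &
      c \notin map (@complex.Im R) T].
    apply: exists_between_notin; rewrite lt_max !gt_min !ltxx /=.
    by rewrite orbF orbC -neq_lt.
  have ne s : s \in T -> complex.Im s != c.
    by move=> sT; apply: contraNneq cT => <-; exact: map_f.
  have [y1c cy2] : y1 <= c /\ c <= y2.
    have [_ /andP[? ?]] := Sin _ pT; have [_ /andP[? ?]] := Sin _ qT.
    by move: mc cM; rewrite gt_min lt_max => /orP[] ? /orP[] ?; lra.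
  rewrite (rint_splity y1c cy2 c3 c4).
  apply: (cut [pred s | complex.Im s < c]) => //.
  - move: mc; rewrite gt_min => /orP[]; [by exists p|by exists q].
  - move: cM; rewrite lt_max => /orP[] /ltW; rewrite leNgt; [by exists p|by exists q].
  - split=> [s|z [z1 /andP[z2 z3]]].
      by rewrite mem_filter /= => /andP[-> /Sin[-> /andP[-> _]]].
    rewrite mem_filter /= => zS; apply: dg; first by split; rewrite // z2 (le_trans z3).
    apply: contra zS => zT; rewrite zT andbT lt_neqAle z3 andbT; exact: ne.
  - split=> [s|z [z1 /andP[z2 z3]]].
      rewrite mem_filter /= -leNgt => /andP[cs sT].
      have [-> /andP[_ ->]] := Sin _ sT.
      by rewrite andbT lt_neqAle cs andbT eq_sym ne.
    rewrite mem_filter /= => zS; apply: dg.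
      by split; rewrite // z3 andbT (le_trans y1c).
    by apply: contra zS => zT; rewrite zT andbT -leNgt.
have [c [mc cM cT]] : exists c, [/\
    Num.min (complex.Re p) (complex.Re q) < c,
    c < Num.max (complex.Re p) (complex.Re q) &
    c \notin map (@complex.Re R) T].
  apply: exists_between_notin; rewrite lt_max !gt_min !ltxx /=.
  by rewrite orbF orbC -neq_lt.
have ne s : s \in T -> complex.Re s != c.
  by move=> sT; apply: contraNneq cT => <-; exact: map_f.
have [x1c cx2] : x1 <= c /\ c <= x2.
  have [/andP[? ?] _] := Sin _ pT; have [/andP[? ?] _] := Sin _ qT.
  by move: mc cM; rewrite gt_min lt_max => /orP[] ? /orP[] ?; lra.
rewrite (rint_splitx x1c cx2 c1 c2).
apply: (cut [pred s | complex.Re s < c]) => //.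
- move: mc; rewrite gt_min => /orP[]; [by exists p|by exists q].
- move: cM; rewrite lt_max => /orP[] /ltW; rewrite leNgt; [by exists p|by exists q].
- split=> [s|z [/andP[z1 z2] z3]].
    by rewrite mem_filter /= => /andP[-> /Sin[/andP[-> _] ->]].
  rewrite mem_filter /= => zS; apply: dg; first by split; rewrite // z1 (le_trans z2).
  apply: contra zS => zT; rewrite zT andbT lt_neqAle z2 andbT; exact: ne.
- split=> [s|z [/andP[z1 z2] z3]].
    rewrite mem_filter /= -leNgt => /andP[cs sT].
    have [/andP[_ ->] ->] := Sin _ sT.
    by rewrite andbT lt_neqAle cs andbT eq_sym ne.
  rewrite mem_filter /= => zS; apply: dg.
    by split; rewrite // z2 andbT (le_trans x1c).
  by apply: contra zS => zT; rewrite zT andbT -leNgt.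
Qed.

End Poles.

(** * The complex exponential *)

Section Exponential.
Context {R : realType}.
Implicit Types (x y t : R) (z w c : R[i]).

Definition cexp z : R[i] := (expR (complex.Re z))%:C * expi (complex.Im z).

Lemma cmod_expi t : cmod (expi t) = 1.
Proof. by rewrite /expi /ComplexField.Normc.normc cos2Dsin2 sqrtr1. Qed.

Lemma cmod_cexp z : cmod (cexp z) = expR (complex.Re z).
Proof. by rewrite cmodM cmod_expi mulr1 cmod_real ger0_norm ?expR_ge0. Qed.

Lemma expiD s t : expi (s + t) = expi s * expi t :> R[i].
Proof. by rewrite /expi cosD sinD; apply: complex_eq; rewrite ?ReM ?ImM //=; ring. Qed.

Lemma cexpD z w : cexp (z + w) = cexp z * cexp w.
Proof. by rewrite /cexp ReD ImD expRD expiD rmorphM /=; ring. Qed.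

Lemma expi0 : expi 0 = 1 :> R[i].
Proof. by rewrite /expi cos0 sin0. Qed.

Lemma cexp0 : cexp 0 = 1.
Proof. by rewrite /cexp /= expR0 expi0 mulr1. Qed.

Lemma cexp_imag t : cexp (0 +i* t) = expi t.
Proof. by rewrite /cexp /= expR0 mul1r. Qed.

Lemma cexp_neq0 z : cexp z != 0.
Proof. by rewrite -cmod_gt0 cmod_cexp expR_gt0. Qed.

Lemma cexpN z : cexp (- z) = (cexp z)^-1.
Proof.
apply: (mulfI (cexp_neq0 z)); rewrite -cexpD subrr cexp0 mulfV//; exact: cexp_neq0.
Qed.

Lemma cexpX n z : cexp z ^+ n = cexp (n%:R * z).
Proof.
elim: n => [|n IH]; first by rewrite expr0 mul0r cexp0.
by rewrite exprS IH -cexpD -{1}(mul1r z) -mulrDl -natr1 addrC.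
Qed.

Lemma expi_2pi : expi (2 * pi) = 1 :> R[i].
Proof. by rewrite /expi mulr_natl cos2pi sin2pi. Qed.

Lemma expR_sub1_le x : `|expR x - 1| <= `|x| * expR `|x|.
Proof.
have h1 := expR_ge1Dx x; have h2 := expR_ge1Dx (- x).
have e0 := expR_gt0 x.
have h3 : expR x - 1 <= x * expR x.
  by have := ler_wpM2l (ltW e0) h2; rewrite expRxMexpNx_1; lra.
have [x0|x0] := leP 0 x.
  by rewrite !ger0_norm//; lra.
rewrite ler0_norm; last by rewrite subr_le0 -expR0 ler_expR ltW.
have : 1 <= expR (- x) by rewrite -expR0 ler_expR; lra.
rewrite ltr0_norm// => e1; apply: (@le_trans _ _ (- x)); first by lra.
by rewrite ler_peMr//; lra.
Qed.

Lemma expR_taylor1_le x : `|expR x - 1 - x| <= x ^+ 2 * expR `|x|.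
Proof.
have h1 := expR_ge1Dx x; have h2 := expR_ge1Dx (- x).
have e0 := expR_gt0 x; rewrite ger0_norm; last by lra.
have h3 : expR x - 1 - x <= x * (expR x - 1).
  by have := ler_wpM2l (ltW e0) h2; rewrite expRxMexpNx_1; lra.
rewrite (le_trans h3)// (le_trans (ler_norm _))// normrM.
rewrite (le_trans (ler_wpM2l _ (expR_sub1_le x)))//.
by rewrite mulrA -expr2 -normrX ger0_norm ?sqr_ge0.
Qed.

Lemma sin_le_abs x : `|sin x| <= `|x|.
Proof.
wlog x0 : x / 0 <= x => [H|].
  have [x0|x0] := leP 0 x; first exact: H.
  by rewrite -normrN -sinN -(normrN x); apply: H; lra.
have [|c _] := @MVT_segment R sin cos 0 x x0.
  by apply: continuous_subspaceT; exact: continuous_sin.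
by rewrite sin0 !subr0 => ->; rewrite normrM ler_piMl// cos_max.
Qed.

Lemma cos_sub1 x : 1 - cos x = 2 * sin (x / 2) ^+ 2.
Proof.
have {1}-> : x = (x / 2) *+ 2 by rewrite mulr2n -splitr.
by rewrite cos_mulr2n cos2sin2 mulr2n; ring.
Qed.

Lemma cos_sub1_le x : `|cos x - 1| <= `|x|.
Proof.
rewrite distrC ger0_norm ?subr_ge0 ?cos_le1// cos_sub1.
have := sin_le_abs (x / 2); rewrite normrM [`|2^-1|]ger0_norm// => h.
have h1 := sin_max (x / 2); rewrite -real_normK ?num_real// expr2.
set s := `|_| in h h1 *; have s0 : 0 <= s by exact: normr_ge0.
rewrite (@le_trans _ _ (2 * (s * 1)))//; last by lra.
by rewrite ler_pM2l// ler_wpM2l.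
Qed.

Lemma cos_sub1_le_sqr x : `|cos x - 1| <= x ^+ 2.
Proof.
rewrite distrC ger0_norm ?subr_ge0 ?cos_le1// cos_sub1.
have := sin_le_abs (x / 2); rewrite -ler_sqr ?nnegrE// !real_normK ?num_real//.
by rewrite expr_div_n; have := sqr_ge0 x; lra.
Qed.

Lemma sin_sub_le_sqr x : `|sin x - x| <= x ^+ 2.
Proof.
wlog x0 : x / 0 <= x => [H|].
  have [x0|x0] := leP 0 x; first exact: H.
  have := H (- x); rewrite sinN sqrrN -opprD normrN; apply; lra.
have [|c cx] := @MVT_segment R sin cos 0 x x0.
  by apply: continuous_subspaceT; exact: continuous_sin.
rewrite sin0 !subr0 => ->; rewrite -{2}[x]mul1r -mulrBl normrM expr2.
move: cx; rewrite in_itv /= => /andP[c0 cx].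
rewrite [`|x|]ger0_norm// ler_wpM2r// (le_trans (cos_sub1_le c))//.
by rewrite ger0_norm.
Qed.

(** Four terms come from the real and imaginary parts, each bounded by the
    remainders of the real exponential, sine and cosine; whence the constant. *)
Lemma cexp_taylor1_le w :
  cmod (cexp w - 1 - w) <= 4 * cmod w ^+ 2 * expR (cmod w).
Proof.
set m := cmod w; set E := expR m.
have m0 : 0 <= m := cmod_ge0 w.
have E0 : 0 < E := expR_gt0 m.
have hx := Re_le_cmod w; have hy := Im_le_cmod w.
case: w @m @E m0 E0 hx hy => a b m E m0 E0 /= hx hy.
rewrite -/m in hx hy.
have a0 := normr_ge0 a; have b0 := normr_ge0 b.
have Ea : expR `|a| <= E by rewrite ler_expR.
have Ea' : expR a <= E by rewrite ler_expR (le_trans (ler_norm a)).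
have a2 : a ^+ 2 <= m ^+ 2 by rewrite -real_normK ?num_real// ler_sqr ?nnegrE.
have b2 : b ^+ 2 <= m ^+ 2 by rewrite -real_normK ?num_real// ler_sqr ?nnegrE.
have ab : `|a| * `|b| <= m ^+ 2 by rewrite expr2 ler_pM.
have e1 : cexp (a +i* b) - 1 - (a +i* b) =
    ((expR a - 1 - a) + expR a * (cos b - 1)) +i*
    (expR a * (sin b - b) + (expR a - 1) * b).
  by rewrite /cexp /expi; apply: complex_eq; rewrite /= ?ReM ?ImM /=; ring.
rewrite e1 (le_trans (cmod_le_ReIm _))//=.
have q1 : `|expR a - 1 - a| <= m ^+ 2 * E.
  by rewrite (le_trans (expR_taylor1_le a))// ler_pM ?sqr_ge0 ?expR_ge0.
have q2 : `|expR a * (cos b - 1)| <= m ^+ 2 * E.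
  rewrite normrM mulrC (ger0_norm (expR_ge0 a)) ler_pM ?expR_ge0//.
  exact: le_trans (cos_sub1_le_sqr b) b2.
have q3 : `|expR a * (sin b - b)| <= m ^+ 2 * E.
  rewrite normrM mulrC (ger0_norm (expR_ge0 a)) ler_pM ?expR_ge0//.
  exact: le_trans (sin_sub_le_sqr b) b2.
have q4 : `|(expR a - 1) * b| <= m ^+ 2 * E.
  rewrite normrM (le_trans (ler_wpM2r b0 (expR_sub1_le a)))//.
  by rewrite mulrAC ler_pM ?mulr_ge0 ?expR_ge0.
have := ler_normD (expR a - 1 - a) (expR a * (cos b - 1)).
have := ler_normD (expR a * (sin b - b)) ((expR a - 1) * b).
by clear -q1 q2 q3 q4; lra.
Qed.

Lemma derivable_cexp c z : derivable (fun w => cexp (c * w)) z 1.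
Proof.
apply/derivableC_cmod; exists (c * cexp (c * z)) => e e0.
pose K := cmod (cexp (c * z)) * (4 * cmod c ^+ 2 * expR (cmod c)).
have K0 : 0 <= K by rewrite !mulr_ge0 ?cmod_ge0 ?expR_ge0 ?sqr_ge0.
exists (Num.min 1 (e / (K + 1))); first by rewrite lt_min ltr01 divr_gt0// ltr_wpDl.
move=> w; set h := w - z; rewrite lt_min => /andP[h1 hK].
have h0 := cmod_ge0 h.
have -> : cexp (c * w) - cexp (c * z) - c * cexp (c * z) * h =
    cexp (c * z) * (cexp (c * h) - 1 - c * h).
  have -> : c * w = c * z + c * h by rewrite /h; ring.
  by rewrite cexpD; ring.
rewrite cmodM (le_trans (ler_wpM2l (cmod_ge0 _) (cexp_taylor1_le (c * h))))//.
rewrite cmodM.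
have : cmod (cexp (c * z)) * (4 * (cmod c * cmod h) ^+ 2 * expR (cmod c * cmod h))
    <= K * cmod h ^+ 2.
  have -> : K * cmod h ^+ 2 = cmod (cexp (c * z)) *
      (4 * (cmod c * cmod h) ^+ 2 * expR (cmod c)) by rewrite /K; ring.
  rewrite ler_wpM2l ?cmod_ge0// ler_wpM2l ?mulr_ge0 ?cmod_ge0//.
  by rewrite ler_expR ler_piMr ?cmod_ge0// ltW.
move=> /le_trans; apply; rewrite expr2 mulrA ler_wpM2r//.
rewrite (le_trans (_ : _ <= (K + 1) * cmod h))//.
  by rewrite ler_wpM2r// lerDl.
by rewrite mulrC -ler_pdivlMr ?ltr_wpDl// ltW.
Qed.

Lemma continuous_cexp c : continuous (fun w => cexp (c * w)).
Proof. by move=> z; apply: derivable_contC; exact: derivable_cexp. Qed.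

End Exponential.

(** * Integrals over the line as limits *)

Section Lim2.
Context {R : realType}.
Local Notation mu := (@lebesgue_measure R).
Implicit Types (u v : R -> R -> R[i]) (l : R[i]).

(** Convergence of a function of an interval as the interval exhausts the
    line; both ends move independently, as in an improper integral. *)
Definition lim2 u l := forall e : R, 0 < e -> exists X0 : R, forall X1 X2,
  X1 <= - X0 -> X0 <= X2 -> cmod (u X1 X2 - l) <= e.

Lemma lim2_eq u v l : (forall X1 X2, X1 <= 0 -> 0 <= X2 -> u X1 X2 = v X1 X2) ->
  lim2 u l -> lim2 v l.
Proof.
move=> uv ul e /ul[X0 H]; exists (Num.max X0 0) => X1 X2.
rewrite lerNr !ge_max => /andP[h1 h2] /andP[h3 h4]; rewrite -uv; [|lra|lra].
by apply: H => //; lra.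
Qed.

Lemma lim2D u v l m : lim2 u l -> lim2 v m ->
  lim2 (fun X1 X2 => u X1 X2 + v X1 X2) (l + m).
Proof.
move=> ul vm e e0; have e2 : 0 < e / 2 by rewrite divr_gt0.
have [X HX] := ul _ e2; have [Y HY] := vm _ e2.
exists (Num.max X Y) => X1 X2; rewrite lerNr !ge_max => /andP[h1 h2] /andP[h3 h4].
have -> : u X1 X2 + v X1 X2 - (l + m) = (u X1 X2 - l) + (v X1 X2 - m) by ring.
rewrite (le_trans (cmodD _ _))// [leRHS]splitr lerD//.
  by apply: HX => //; lra.
by apply: HY => //; lra.
Qed.

Lemma lim2Z u l (c : R[i]) : lim2 u l -> lim2 (fun X1 X2 => c * u X1 X2) (c * l).
Proof.
move=> ul e e0; have c0 : 0 < cmod c + 1 by rewrite ltr_wpDl// cmod_ge0.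
have [X HX] := ul _ (divr_gt0 e0 c0); exists X => X1 X2 h1 h2.
rewrite -mulrBr cmodM (le_trans (ler_wpM2l (cmod_ge0 c) (HX _ _ h1 h2)))//.
by rewrite mulrCA ler_piMr ?(ltW e0)// ler_pdivrMr// mul1r lerDl.
Qed.

Lemma lim2B u v l m : lim2 u l -> lim2 v m ->
  lim2 (fun X1 X2 => u X1 X2 - v X1 X2) (l - m).
Proof.
move=> ul /(@lim2Z _ _ (-1)) vm; have := lim2D ul vm; rewrite mulN1r.
by apply: lim2_eq => X1 X2 _ _; rewrite mulN1r.
Qed.

Lemma lim2_unique u l m : lim2 u l -> lim2 u m -> l = m.
Proof.
move=> ul um; apply/eqP; rewrite -subr_eq0 -cmod_eq0 eq_le cmod_ge0 andbT.
apply/ler_addgt0Pl => e e0; rewrite addr0.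
have e2 : 0 < e / 2 by rewrite divr_gt0.
have [X HX] := ul _ e2; have [Y HY] := um _ e2.
pose Z := Num.max X Y.
have ZX : X <= Z by rewrite le_max lexx.
have ZY : Y <= Z by rewrite le_max lexx orbT.
have := HX (- Z) Z; rewrite lerN2 => /(_ ZX ZX) h1.
have := HY (- Z) Z; rewrite lerN2 => /(_ ZY ZY) h2.
have -> : l - m = (u (- Z) Z - m) - (u (- Z) Z - l) by ring.
by rewrite (le_trans (cmodB _ _))// [leRHS]splitr lerD.
Qed.

(** The mass of [[-n, n]] increases to the total mass, so that the
    complement of a large interval contributes little. *)
Lemma lim2_Cint (g : R -> R[i]) : cint_on setT g ->
  lim2 (fun X1 X2 => sint X1 X2 g) (Cint setT g).
Proof.
move=> ig e e0.
have ic : mu.-integrable setT (EFin \o (fun x => cmod (g x))) by exact: cint_on_cmod.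
have iS (D : set (measurableTypeR R)) : measurable D ->
    mu.-integrable D (EFin \o (fun x => cmod (g x))).
  by move=> mD; apply: integrableS ic.
pose I (D : set (measurableTypeR R)) := \int[mu]_(x in D) cmod (g x).
have [n Hn] : exists n : nat, I setT - I `[- n%:R, n%:R]%classic <= e.
  pose F (k : nat) : set (measurableTypeR R) := `[- k%:R, k%:R]%classic.
  have nd : nondecreasing_seq F.
    move=> a b ab; apply/subsetPset => x; rewrite /F /= !in_itv /= => /andP[h1 h2].
    have abR : a%:R <= b%:R :> R by rewrite ler_nat.
    by apply/andP; split; lra.
  have := @ge0_nondecreasing_set_cvg_integral _ (measurableTypeR R) R F
    (EFin \o (fun x => cmod (g x))) mu nd.
  rewrite bigcup_itvT => H.
  have fin (D : set (measurableTypeR R)) : measurable D ->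
      (\int[mu]_(x in D) ((EFin \o (fun x => cmod (g x))) x))%E = (I D)%:E.
    move=> mD; rewrite /I /Rintegral fineK//; apply: integrable_fin_num => //.
    exact: iS.
  have mF k : measurable (F k) by exact: measurable_itv.
  have {}H := H mF (fun k => measurable_int _ (iS _ (mF k)))
    (fun k x _ => cmod_ge0 (g x)).
  rewrite fin// in H.
  have e1 : (fun k => \int[mu]_(x in F k) ((EFin \o (fun x => cmod (g x))) x))%E =
      EFin \o (fun k => I (F k)) by apply/funext => k; rewrite fin.
  rewrite e1 in H; have {H} /fine_cvgP[_ H] := H.
  have /cvgrPdist_le/(_ _ e0)[N _ HN] := H; exists N.
  by have := HN N (leqnn _); rewrite ler_norml => /andP[_].
exists n%:R => X1 X2 h1 h2.
pose D : set (measurableTypeR R) := `[X1, X2]%classic.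
have mD : measurable D by exact: measurable_itv.
have mDC : measurable (~` D) by exact: measurableC.
have DD : D `|` ~` D = setT by exact: setUv.
have dj : [disjoint D & ~` D] by apply/disj_setPS; rewrite setICr.
have isub (E : set (measurableTypeR R)) : measurable E -> cint_on E g.
  by move=> mE; apply: cint_onS ig.
have E1 : Cint setT g = Cint D g + Cint (~` D) g.
  by rewrite -CintU// DD.
have E2 : I setT = I D + I (~` D).
  by rewrite /I -Rintegral_setU// DD.
have -> : sint X1 X2 g - Cint setT g = - Cint (~` D) g.
  by rewrite E1 /sint -/D; ring.
rewrite cmodN (le_trans (cmod_Cint_le mDC (isub _ mDC)))//.
apply: le_trans Hn; rewrite E2 -/(I _) lerBrDl lerD2r.
apply: fine_le.
- by apply: integrable_fin_num => //; exact: iS.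
- by apply: integrable_fin_num => //; exact: iS.
apply: ge0_subset_integral => //.
- by apply: measurable_int; exact: iS.
- by move=> x _ /=; rewrite lee_fin cmod_ge0.
move=> x; rewrite /D /= !in_itv /= => /andP[k1 k2].
by rewrite (le_trans h1 k1) (le_trans k2 h2).
Unshelve. all: by end_near. Qed.

End Lim2.

(** * Shifting a horizontal line of integration *)

Section Strip.
Context {R : realType}.
Local Notation mu := (@lebesgue_measure R).
Implicit Types (f g G : R[i] -> R[i]) (S : seq R[i]) (p z : R[i]).

Definition square p r : set R[i] :=
  in_rect (complex.Re p - r) (complex.Re p + r)
          (complex.Im p - r) (complex.Im p + r).

Lemma sq_shrink g p r r0 : 0 < r -> r <= r0 ->
  (forall z, square p r0 z -> z != p -> derivable g z 1) ->
  sq g p r0 = sq g p r.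
Proof.
move=> r1 rr dg; apply: rint_sq => //; try lra; split=> [q|z zr].
  by rewrite inE => /eqP ->; split; apply/andP; split; lra.
by rewrite inE; exact: dg.
Qed.

Lemma exists_margin (s : seq R) y1 y2 : y1 < y2 ->
  (forall t, t \in s -> y1 < t < y2) -> exists d : R, [/\ 0 < d,
  y1 + d < y2 - d & forall t, t \in s -> y1 + d < t < y2 - d].
Proof.
move=> yy; elim: s => [|u s IH] us.
  exists ((y2 - y1) / 4); split => //.
    by rewrite divr_gt0// subr_gt0.
  by lra.
have [|d [d0 dd ds]] := IH; first by move=> t ts; apply: us; rewrite inE ts orbT.
have /andP[u1 u2] := us u (mem_head _ _).
pose e := Num.min d (Num.min ((u - y1) / 2) ((y2 - u) / 2)).
have e0 : 0 < e by rewrite !lt_min d0 !divr_gt0// subr_gt0.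
have e1 : e <= d by rewrite !ge_min lexx.
have e2 : e <= (u - y1) / 2 by rewrite !ge_min lexx !orbT.
have e3 : e <= (y2 - u) / 2 by rewrite !ge_min lexx !orbT.
exists e; split => //; first by lra.
move=> t; rewrite inE => /predU1P[->|/ds /andP[t1 t2]]; apply/andP; split; lra.
Qed.

(** Along the two horizontal sides run thin strips free of singularities,
    where [goursat_closed] applies; between them [rint_poles] does. *)
Lemma rint_poles_closed g (phi : R[i] -> R[i]) S x1 x2 y1 y2 : uniq S ->
  x1 <= x2 -> y1 < y2 ->
  (forall p, p \in S -> x1 < complex.Re p < x2 /\ y1 < complex.Im p < y2) ->
  (forall z, x1 <= complex.Re z <= x2 -> y1 < complex.Im z < y2 ->
     z \notin S -> derivable g z 1) ->
  {within in_rect x1 x2 y1 y2 `&` [set z | z \notin S], continuous g} ->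
  (forall p, p \in S -> exists2 rho : R, 0 < rho &
     forall r, 0 < r -> r < rho -> sq g p r = phi p) ->
  rint g x1 x2 y1 y2 = \sum_(p <- S) phi p.
Proof.
move=> uS xx yy Sin dg cg ph; have yy' := ltW yy.
have [|d [d0 dd ds]] := @exists_margin (map (@complex.Im R) S) y1 y2 yy.
  by move=> t /mapP[p pS ->]; have [] := Sin _ pS.
have vc x : (forall p, p \in S -> complex.Re p != x) -> x1 <= x <= x2 ->
    vcont g x y1 y2.
  move=> xS xI; apply: (within_continuous_comp cg).
    exact: vline_continuous.
  move=> t; rewrite /= in_itv /= => tI; split => //=.
  by apply/negP => /xS /=; rewrite eqxx.
have v1 : vcont g x1 y1 y2.
  apply: vc; last by rewrite lexx.
  by move=> p /Sin[/andP[h _] _]; rewrite gt_eqF.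
have v2 : vcont g x2 y1 y2.
  apply: vc; last by rewrite xx lexx.
  by move=> p /Sin[/andP[_ h] _]; rewrite lt_eqF.
have thin u1 u2 : u1 < u2 -> y1 <= u1 -> u2 <= y2 -> u2 <= y1 + d \/ y2 - d <= u1 ->
    rint g x1 x2 u1 u2 = 0.
  move=> uu h1 h2 hh.
  have nS z : u1 <= complex.Im z <= u2 -> z \notin S.
    move=> /andP[z1 z2]; apply/negP => zS.
    have /andP[k1 k2] := ds _ (map_f (@complex.Im R) zS).
    by case: hh => ?; lra.
  apply: goursat_closed => //.
    move=> z zI /andP[z1 z2]; apply: dg => //; first by apply/andP; split; lra.
    by apply: nS; rewrite !ltW.
  apply: continuous_subspaceW cg => z [z1 /andP[z2 z3]]; split; last first.
    by apply: nS; rewrite z2.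
  by split => //; rewrite (le_trans h1 z2) (le_trans z3 h2).
have w1 : y1 <= y1 + d by lra.
have w2 : y1 + d <= y2 by lra.
have w3 : y1 + d <= y2 - d by lra.
have w4 : y2 - d <= y2 by lra.
rewrite (rint_splity w1 w2 v1 v2) thin ?add0r//; [|lra|by left].
rewrite (rint_splity w3 w4 (scont_sub w1 (lexx _) v1) (scont_sub w1 (lexx _) v2)).
rewrite [X in _ + X]thin ?addr0//; [|lra|lra|by right].
apply: rint_poles => //; split.
  by move=> p pS; have [-> _] := Sin _ pS; split => //; exact: ds (map_f _ pS).
by move=> z [z1 /andP[z2 z3]] zS; apply: dg => //; apply/andP; split; lra.
Qed.

Lemma scont_cmod_int a b (g : R -> R[i]) : scont a b g ->
  mu.-integrable `[a, b] (EFin \o (fun x => cmod (g x))).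
Proof. by move=> cg; apply: cint_on_cmod => //; exact: scont_cint. Qed.

(** The setting of the theorem, with the poles listed in [S]. The radius
    [r0] isolates them: the closed square of half-side [r0] about a pole contains
    no other pole, and it stays at distance at least [a / 2] from the real axis. *)
Record pole_strip f S (a0 a r0 : R) : Prop := PoleStrip {
  ps_uniq : uniq S;
  ps_a : 0 < a;
  ps_aa0 : a < a0;
  ps_S : forall p, p \in S -> a <= `|complex.Im p| < a0;
  ps_r0 : 0 < r0 <= a / 2;
  ps_iso : forall p z, p \in S -> square p r0 z -> z != p -> derivable f z 1;
  ps_hol : forall z, `|complex.Im z| < a0 -> z \notin S -> derivable f z 1;
  ps_cont : {within [set z | `|complex.Im z| <= a0 /\ z \notin S], continuous f};
  ps_vmp : vertical_mass f a0 x @[x --> +oo] --> 0%E;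
  ps_vmn : vertical_mass f a0 x @[x --> -oo] --> 0%E;
  ps_hmp : (horizontal_mass f a0 < +oo)%E;
  ps_hmn : (horizontal_mass f (- a0) < +oo)%E
}.

Section PoleStrip.
Variables (f : R[i] -> R[i]) (S : seq R[i]) (a0 a r0 : R).
Hypothesis ps : pole_strip f S a0 a r0.

Let vint (X : R) := \int[mu]_(eta in `[- a0, a0]) cmod (f (X +i* eta)).

Lemma vertical_small (e : R) : 0 < e -> exists X0 : R, forall X : R,
  X <= - X0 \/ X0 <= X ->
  (forall p, p \in S -> complex.Re p != X) /\ vint X <= e.
Proof.
move=> e0.
have /fine_cvgP[_ /cvgrPdist_le/(_ _ e0)[M1 [_ H1]]] := ps_vmp ps.
have /fine_cvgP[_ /cvgrPdist_le/(_ _ e0)[M2 [_ H2]]] := ps_vmn ps.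
have [B HB] : exists B : R, forall p, p \in S -> `|complex.Re p| < B.
  elim: (S) => [|p s [B HB]]; first by exists 0.
  exists (Num.max (`|complex.Re p| + 1) B) => q; rewrite inE lt_max.
  by case/predU1P => [->|/HB ->]; rewrite ?orbT// ltrDl ltr01.
have Vge X : 0 <= vint X by apply: Rintegral_ge0 => x _; exact: cmod_ge0.
have n1 := ler_norm M1; have n2 := ler_norm (- M2); rewrite normrN in n2.
exists (`|B| + `|M1| + `|M2| + 1) => X XX.
have nB := ler_norm B.
have m1 := normr_ge0 M1; have m2 := normr_ge0 M2; have mB := normr_ge0 B.
split=> [p /HB|].
  by rewrite ltr_norml => /andP[p1 p2]; apply/eqP; case: XX => ? ?; lra.
case: XX => hX.
  have := H2 X; rewrite /= sub0r normrN ger0_norm; last exact: Vge.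
  by apply; lra.
have := H1 X; rewrite /= sub0r normrN ger0_norm; last exact: Vge.
by apply; lra.
Qed.

Lemma ps_vcont X : (forall p, p \in S -> complex.Re p != X) ->
  vcont f X (- a0) a0.
Proof.
move=> XS; apply: (within_continuous_comp (ps_cont ps)).
  exact: vline_continuous.
move=> t; rewrite /= in_itv /= => tI; split; first by rewrite ler_norml.
by apply/negP => /XS /=; rewrite eqxx.
Qed.

Lemma ps_hcont y x1 x2 : `|y| <= a0 -> (forall p, p \in S -> complex.Im p != y) ->
  hcont f x1 x2 y.
Proof.
move=> ya yS; apply: (within_continuous_comp (ps_cont ps)).
  exact: hline_continuous.
move=> t _; split => //=.
by apply/negP => /yS /=; rewrite eqxx.
Qed.

Lemma vert_le (G : R[i] -> R[i]) (C X y1 y2 : R) : 0 <= C ->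
  - a0 <= y1 -> y1 <= y2 -> y2 <= a0 ->
  (forall p, p \in S -> complex.Re p != X) -> vcont G X y1 y2 ->
  (forall y, y1 <= y <= y2 -> cmod (G (X +i* y)) <= C) ->
  cmod (sint y1 y2 (fun y => f (X +i* y) * G (X +i* y))) <= C * vint X.
Proof.
move=> C0 h1 yy h2 XS cG GC; have cf := ps_vcont XS.
have cf' : vcont f X y1 y2 by apply: scont_sub cf.
apply: (le_trans (cmod_sint_le (scontM cf' cG))).
have i1 : mu.-integrable `[- a0, a0] (EFin \o (fun y => cmod (f (X +i* y)))).
  exact: scont_cmod_int.
have i2 : mu.-integrable `[y1, y2] (EFin \o (fun y => cmod (f (X +i* y)))).
  exact: scont_cmod_int.
apply: (@le_trans _ _ (\int[mu]_(y in `[y1, y2]) (C * cmod (f (X +i* y))))).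
  apply: le_Rintegral => //.
  - exact: (scont_cmod_int (scontM cf' cG)).
  - exact: (integrableZl _ C i2).
  - move=> y /=; rewrite in_itv /= => yI.
    by rewrite cmodM mulrC ler_wpM2r ?cmod_ge0// GC.
rewrite RintegralZl// ler_wpM2l//.
apply: fine_le.
- exact: integrable_fin_num.
- exact: integrable_fin_num.
apply: ge0_subset_integral => //.
- exact: measurable_int i1.
- by move=> x _ /=; rewrite lee_fin cmod_ge0.
- move=> x; rewrite /= !in_itv /= => /andP[k1 k2].
  by rewrite (le_trans h1 k1) (le_trans k2 h2).
Qed.

(** The residue theorem on a long rectangle. The vertical sides disappear in
    the limit because [G] is bounded and the mass of [f]
    on them tends to 0. *)
Lemma line_shift (G : R[i] -> R[i]) (C y1 y2 : R) : 0 <= C ->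
  - a0 <= y1 -> y1 < y2 -> y2 <= a0 ->
  (forall p, p \in S -> complex.Im p != y1 /\ complex.Im p != y2) ->
  (forall z, y1 <= complex.Im z <= y2 -> derivable G z 1) ->
  (forall p z, p \in S -> y1 < complex.Im p < y2 -> square p r0 z ->
     derivable G z 1) ->
  (forall z, y1 <= complex.Im z <= y2 -> cmod (G z) <= C) ->
  lim2 (fun X1 X2 => sint X1 X2 (fun x => f (x +i* y1) * G (x +i* y1)) -
                     sint X1 X2 (fun x => f (x +i* y2) * G (x +i* y2)))
    (\sum_(p <- S | y1 < complex.Im p < y2) sq (fun z => f z * G z) p r0).
Proof.
move=> C0 h1 yy h2 yS dG dGs GC e e0.
have C1 : 0 < 2 * (C + 1) by rewrite mulr_gt0// ltr_wpDl.
have [X0 HX0] := vertical_small (divr_gt0 e0 C1).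
exists (Num.max X0 1) => X1 X2; rewrite lerNr !ge_max => /andP[k1 k2] /andP[k3 k4].
have [r00 r0a] := andP (ps_r0 ps).
have [|XS1 V1] := HX0 X1; first by left; lra.
have [|XS2 V2] := HX0 X2; first by right.
have XS p : p \in S -> X1 < complex.Re p < X2.
  move=> pS; rewrite !ltNge -negb_or; apply/negP => /orP[pX|pX].
    have [|+ _] := HX0 (complex.Re p); first by left; lra.
    by move=> /(_ _ pS); rewrite eqxx.
  have [|+ _] := HX0 (complex.Re p); first by right; lra.
  by move=> /(_ _ pS); rewrite eqxx.
have XX : X1 <= X2 by lra.
pose S' := [seq p <- S | y1 < complex.Im p < y2].
have S'S z : y1 <= complex.Im z <= y2 -> z \notin S' -> z \notin S.
  move=> /andP[z1 z2]; rewrite mem_filter; apply: contra => zS.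
  by rewrite zS andbT !lt_neqAle z1 z2 !andbT eq_sym; have [-> ->] := yS _ zS.
rewrite -big_filter -/S'.
have cfG : {within in_rect X1 X2 y1 y2 `&` [set z | z \notin S'],
    continuous (fun z => f z * G z)}.
  apply: within_continuousM.
    apply: continuous_subspaceW (ps_cont ps) => z [[_ zI] zS'].
    split; last exact: S'S.
    by case/andP: zI => z1 z2; rewrite ler_norml; apply/andP; split; lra.
  by apply: derivable_within => z [[_ zI] _]; exact: dG.
have <- : rint (fun z => f z * G z) X1 X2 y1 y2 =
    \sum_(p <- S') sq (fun z => f z * G z) p r0.
  apply: rint_poles_closed => //.
  - exact/filter_uniq/(ps_uniq ps).
  - by move=> p; rewrite mem_filter => /andP[pI pS]; split => //; exact: XS.
  - move=> z _ /andP[z1 z2] zS'; apply: derivableM.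
      apply: (ps_hol ps); first by rewrite ltr_norml; apply/andP; split; lra.
      by apply: S'S => //; rewrite !ltW.
    by apply: dG; rewrite !ltW.
  - move=> p; rewrite mem_filter => /andP[pI pS]; exists r0 => // r rp rr0.
    apply/esym/sq_shrink => //; first exact: ltW.
    move=> z zs zp; apply: derivableM; first exact: (ps_iso ps) zs zp.
    exact: dGs zs.
have cG X : vcont G X y1 y2.
  have cG : {within [set z | y1 <= complex.Im z <= y2], continuous G}.
    by apply: derivable_within => z zI; exact: dG.
  apply: (within_continuous_comp cG); first exact: vline_continuous.
  by move=> t; rewrite /= in_itv.
have W1 := vert_le C0 h1 (ltW yy) h2 XS1 (cG X1)
  (fun y yI => GC (X1 +i* y) yI).
have W2 := vert_le C0 h1 (ltW yy) h2 XS2 (cG X2)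
  (fun y yI => GC (X2 +i* y) yI).
rewrite /rint; move: W1 W2; move: (sint _ _ _) (sint _ _ _) => V1' V2'.
move: (sint _ _ _) (sint _ _ _) => A B W1 W2.
have -> : B - A - (B - A + 'i%C * (V1' - V2')) = 'i%C * (V2' - V1') by ring.
rewrite cmodM cmod_i mul1r (le_trans (cmodB _ _))//.
have b1 X : vint X <= e / (2 * (C + 1)) -> C * vint X <= e / 2.
  move=> H; rewrite (le_trans (ler_wpM2l C0 H))// mulrA ler_pdivrMr//.
  have -> : e / 2 * (2 * (C + 1)) = C * e + e by field.
  by rewrite lerDl ltW.
by rewrite [leRHS]splitr lerD//; [exact: le_trans W1 (b1 _ V1)|
  exact: le_trans W2 (b1 _ V2)].
Qed.

End PoleStrip.
End Strip.

(** * Integrals pushed to the edge of a half-strip *)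

Section Dominated.
Context {R : realType}.
Local Notation mu := (@lebesgue_measure R).

Lemma continuous_cint_on (g : R -> R[i]) (b : R -> R) : continuous g ->
  mu.-integrable setT (EFin \o b) -> (forall x, cmod (g x) <= b x) ->
  cint_on setT g.
Proof.
move=> cg ib gb; apply: (@cmod_cint_on _ _ _ b) => //.
- have cr : continuous (fun x : R => complex.Re (g x)).
    by move=> x; apply: continuous_comp; [exact: cg|exact: Re_continuous].
  exact: continuous_measurable_fun cr.
- have cr : continuous (fun x : R => complex.Im (g x)).
    by move=> x; apply: continuous_comp; [exact: cg|exact: Im_continuous].
  exact: continuous_measurable_fun cr.
Qed.

End Dominated.

Section HalfStrip.
Context {R : realType}.
Local Notation mu := (@lebesgue_measure R).
Implicit Types (G : R[i] -> R[i]) (p z : R[i]).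
Variables (f : R[i] -> R[i]) (S : seq R[i]) (a0 a r0 : R).
Hypothesis ps : pole_strip f S a0 a r0.

(** Distance below the real axis if [sg = 1], above it if [sg = -1]. The
    sign lets both halves of the strip, hence both signs of the frequency, be
    treated at once: e^(-2 pi i sg s z) has modulus e^(-2 pi s depth). *)
Definition depth (sg : R) z := - (sg * complex.Im z).

Definition hol_half (sg t C : R) G := forall z, t <= depth sg z ->
  derivable G z 1 /\ cmod (G z) <= C.

(** The integral of [f * G] over the real line, once the line has been
    pushed across the poles to the edge of a half-strip. In this form it makes
    sense for a [G] that is singular on the real axis, such as [kern] below. *)
Definition Lhalf (sg : R) G : R[i] :=
  Cint setT (fun x : R => f (x +i* - (sg * a0)) * G (x +i* - (sg * a0))) -
  sg%:C * \sum_(p <- S | 0 < depth sg p) sq (fun z => f z * G z) p r0.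

Variable sg : R.
Hypothesis sgP : sg = 1 \/ sg = -1.

Lemma sg_norm : `|sg| = 1.
Proof. by case: sgP => ->; rewrite ?normrN normr1. Qed.

Lemma depth_pole p : p \in S -> 0 < depth sg p -> depth sg p = `|complex.Im p|.
Proof.
rewrite /depth => _; case: sgP => ->; rewrite ?mul1r ?mulN1r ?opprK => h.
  by rewrite ltr0_norm//; lra.
by rewrite gtr0_norm.
Qed.

Lemma square_depth p r z : square p r z ->
  depth sg p - r <= depth sg z.
Proof.
move=> [_ /andP[h1 h2]]; rewrite /depth.
by case: sgP => ->; rewrite ?mul1r ?mulN1r ?opprK; lra.
Qed.

Lemma square_depth_a p z : p \in S -> 0 < depth sg p -> square p r0 z ->
  a / 2 <= depth sg z.
Proof.
move=> pS dp /square_depth; rewrite depth_pole//.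
have /andP[h1 _] := ps_S ps pS; have /andP[_ h2] := ps_r0 ps; lra.
Qed.

Lemma a0_norm : `|- (sg * a0)| = a0.
Proof.
rewrite normrN normrM sg_norm mul1r gtr0_norm//.
exact: lt_trans (ps_a ps) (ps_aa0 ps).
Qed.

Lemma boundary_cont : continuous (fun x : R => f (x +i* - (sg * a0))).
Proof.
have H : {within setT, continuous (fun x : R => f (x +i* - (sg * a0)))}.
  apply: (within_continuous_comp (ps_cont ps)); first exact: hline_continuous.
  move=> x _; split; first by rewrite /= a0_norm.
  by apply/negP => /(ps_S ps) /=; rewrite a0_norm ltxx andbF.
by apply/continuous_subspace_setT.
Qed.

Lemma boundary_int :
  mu.-integrable setT (EFin \o (fun x : R => cmod (f (x +i* - (sg * a0))))).
Proof.
apply/integrableP; split.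
  apply/measurable_EFinP; apply: continuous_measurable_fun => x.
  by apply: continuous_comp; [exact: boundary_cont|exact: cmod_continuous].
have -> : (\int[mu]_x `|(EFin \o (fun x : R => cmod (f (x +i* - (sg * a0)))%R)) x| =
    horizontal_mass f (- (sg * a0))%R)%E.
  by apply: eq_integral => x _ /=; rewrite ger0_norm ?cmod_ge0.
by case: sgP => ->; rewrite ?mul1r ?mulN1r ?opprK;
  [exact: ps_hmn ps|exact: ps_hmp ps].
Qed.

Lemma depth_line x y : depth sg (x +i* - (sg * y)) = y.
Proof. by rewrite /depth /= mulrN opprK mulrA; case: sgP => ->; ring. Qed.

Lemma hline_half t C G y : t <= y -> hol_half sg t C G ->
  continuous (fun x : R => G (x +i* - (sg * y))).
Proof.
move=> ty hG x; apply: continuous_comp; first exact: hline_continuous.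
by apply: derivable_contC; apply: (proj1 (hG _ _)); rewrite depth_line.
Qed.

Lemma boundary_cint t C G : t <= a0 -> hol_half sg t C G ->
  cint_on setT (fun x : R => f (x +i* - (sg * a0)) * G (x +i* - (sg * a0))).
Proof.
move=> ta hG; have cfG : continuous
    (fun x : R => f (x +i* - (sg * a0)) * G (x +i* - (sg * a0))).
  by move=> x; apply: continuousM; [exact: boundary_cont|exact: hline_half hG x].
apply: (continuous_cint_on cfG (b := fun x => C * cmod (f (x +i* - (sg * a0))))).
- exact: (integrableZl _ C boundary_int).
- move=> x; rewrite cmodM mulrC ler_wpM2r ?cmod_ge0//.
  by apply: (proj2 (hG _ _)); rewrite depth_line.
Qed.

Lemma hol_halfW t t' C G : t <= t' -> hol_half sg t C G -> hol_half sg t' C G.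
Proof. by move=> tt hG z zt; apply: hG; exact: le_trans zt. Qed.

Lemma hol_half_ge0 t C G : hol_half sg t C G -> 0 <= C.
Proof.
move=> hG; have := proj2 (hG (0 +i* - (sg * t)) _).
by rewrite depth_line lexx => /(_ isT); apply: le_trans; exact: cmod_ge0.
Qed.

(** No pole lies at depth less than [a], so that all lines at depth at most
    [a / 2] give the same integral. *)
Lemma half_shift t C G : 0 <= t <= a / 2 -> hol_half sg t C G ->
  lim2 (fun X1 X2 => sint X1 X2
    (fun x => f (x +i* - (sg * t)) * G (x +i* - (sg * t)))) (Lhalf sg G).
Proof.
move=> /andP[t0 ta] hG; have C0 := hol_half_ge0 hG.
have pa := ps_a ps; have paa := ps_aa0 ps.
have ta0 : t <= a0 by lra.
have lim_a0 := lim2_Cint (boundary_cint ta0 hG).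
have Sab p : p \in S -> complex.Im p != - (sg * t) /\ complex.Im p != - (sg * a0).
  move=> /(ps_S ps) /andP[p1 p2]; split; apply: contraTneq isT => e.
    by move: p1; rewrite e normrN normrM sg_norm mul1r ger0_norm//; lra.
  by move: p2; rewrite e a0_norm ltxx.
have Cs p z : p \in S -> 0 < depth sg p -> square p r0 z -> derivable G z 1.
  move=> pS dp zs; apply: (proj1 (hG _ _)).
  exact: le_trans ta (square_depth_a pS dp zs).
have sumE (P : pred R[i]) : {in S, forall p, P p = (0 < depth sg p)} ->
    \sum_(p <- S | P p) sq (fun z => f z * G z) p r0 =
    \sum_(p <- S | 0 < depth sg p) sq (fun z => f z * G z) p r0.
  move=> PE; rewrite big_seq_cond [RHS]big_seq_cond; apply: eq_bigl => p.
  by apply: andb_id2l; exact: PE.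
have Sin p : p \in S -> 0 < depth sg p = (t < depth sg p < a0).
  move=> pS; have /andP[p1 p2] := ps_S ps pS.
  apply/idP/andP => [dp|[dp _]]; last exact: le_lt_trans dp.
  by rewrite depth_pole//; split => //; lra.
have dI z : (t <= depth sg z <= a0) -> derivable G z 1 /\ cmod (G z) <= C.
  by move=> /andP[z1 _]; exact: hG.
rewrite /Lhalf; move: Sab Cs sumE Sin dI lim_a0; rewrite /depth.
case: sgP => ->; rewrite ?mul1r ?mulN1r ?opprK => Sab Cs sumE Sin dI lim_a0.
- have L : lim2 (fun X1 X2 =>
      sint X1 X2 (fun x => f (x +i* - a0) * G (x +i* - a0)) -
      sint X1 X2 (fun x => f (x +i* - t) * G (x +i* - t)))
    (\sum_(p <- S | - a0 < complex.Im p < - t) sq (fun z => f z * G z) p r0).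
    apply: (line_shift ps C0); try by lra.
    + by move=> p /Sab[].
    + by move=> z zI; apply: (proj1 (dI _ _)); lra.
    + by move=> p z pS pI; apply: Cs => //; lra.
    + by move=> z zI; apply: (proj2 (dI _ _)); lra.
  rewrite sumE in L; last first.
    by move=> p pS; rewrite Sin// mul1r; apply/andP/andP => -[? ?]; split; lra.
  have := lim2B lim_a0 L.
  by apply: lim2_eq => X1 X2 _ _; rewrite subKr.
- have L : lim2 (fun X1 X2 =>
      sint X1 X2 (fun x => f (x +i* t) * G (x +i* t)) -
      sint X1 X2 (fun x => f (x +i* a0) * G (x +i* a0)))
    (\sum_(p <- S | t < complex.Im p < a0) sq (fun z => f z * G z) p r0).
    apply: (line_shift ps C0); try by lra.
    + by move=> p /Sab[].
    + by move=> z zI; apply: (proj1 (dI _ _)); lra.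
    + by move=> p z pS pI; apply: Cs => //; lra.
    + by move=> z zI; apply: (proj2 (dI _ _)); lra.
  rewrite sumE in L; last by move=> p pS; rewrite Sin// mulN1r opprK.
  have := lim2D lim_a0 L; rewrite rmorphN1 mulN1r opprK.
  by apply: lim2_eq => X1 X2 _ _; rewrite addrC subrK.
Qed.

Lemma hol_halfD t C1 C2 G1 G2 : hol_half sg t C1 G1 -> hol_half sg t C2 G2 ->
  hol_half sg t (C1 + C2) (fun z => G1 z + G2 z).
Proof.
move=> h1 h2 z zt; have [d1 b1] := h1 z zt; have [d2 b2] := h2 z zt.
split; first exact: derivableD.
by rewrite (le_trans (cmodD _ _))// lerD.
Qed.

(** Additivity is read off on the line at depth [a / 2]. *)
Lemma LhalfD C1 C2 G1 G2 : hol_half sg (a / 2) C1 G1 ->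
  hol_half sg (a / 2) C2 G2 ->
  Lhalf sg (fun z => G1 z + G2 z) = Lhalf sg G1 + Lhalf sg G2.
Proof.
move=> h1 h2; have pa := ps_a ps.
have ta : 0 <= a / 2 <= a / 2 by rewrite lexx divr_ge0// ltW.
apply: lim2_unique (half_shift ta (hol_halfD h1 h2)) _.
have := lim2D (half_shift ta h1) (half_shift ta h2).
have cf X1 X2 : hcont f X1 X2 (- (sg * (a / 2))).
  apply: (ps_hcont ps) => [|p /(ps_S ps) /andP[p1 _]].
    by rewrite normrN normrM sg_norm mul1r gtr0_norm; have := ps_aa0 ps; lra.
  apply: contraTneq isT => e; move: p1.
  by rewrite e normrN normrM sg_norm mul1r gtr0_norm; lra.
have cG C G X1 X2 : hol_half sg (a / 2) C G -> hcont G X1 X2 (- (sg * (a / 2))).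
  move=> hG; apply: continuous_scont; exact: hline_half hG.
apply: lim2_eq => X1 X2 _ _.
rewrite -(sintD (scontM (cf X1 X2) (cG _ _ X1 X2 h1))
  (scontM (cf X1 X2) (cG _ _ X1 X2 h2))).
by apply: eq_sint => x _; rewrite -mulrDr.
Qed.

Variable ord : R[i] -> nat.
Hypothesis polar : forall p, p \in S -> exists2 M : R, 0 <= M &
  forall w, square p r0 w -> w != p -> cmod (f w) <= M / cmod (w - p) ^+ ord p.

(** The square may be shrunk to half-side [r], where [f] is at most a
    multiple of 1 / r^(ord p) on a path of length 8 r. *)
Lemma sq_bound p : p \in S -> exists2 M : R, 0 <= M &
  forall r G C, 0 < r -> r <= r0 ->
    (forall z, square p r0 z -> derivable G z 1) ->
    (forall z, square p r z -> cmod (G z) <= C) ->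
    cmod (sq (fun z => f z * G z) p r0) <= M * C * (r / r ^+ ord p).
Proof.
move=> pS; have [M M0 HM] := polar pS.
exists (8 * M); first by rewrite mulr_ge0.
move=> r G C rp rr0 dG GC.
have dfG z : square p r0 z -> z != p -> derivable (fun z => f z * G z) z 1.
  move=> zs zp; apply: derivableM; last exact: dG.
  exact: (ps_iso ps) zs zp.
have sub z : square p r z -> square p r0 z.
  by move=> [/andP[z1 z2] /andP[z3 z4]]; split; apply/andP; split; lra.
rewrite (sq_shrink rp rr0 dfG) /sq.
have C0 : 0 <= C.
  apply: le_trans (GC p _); first exact: cmod_ge0.
  by split; apply/andP; split; lra.
have bnd w : square p r w -> r <= cmod (w - p) ->
    cmod (f w * G w) <= M * C / r ^+ ord p.
  move=> ws wr; have w0 : 0 < cmod (w - p) by exact: lt_le_trans wr.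
  rewrite cmodM mulrAC ler_pM ?cmod_ge0 ?GC//.
  apply: (le_trans (HM w (sub _ ws) _)).
    by rewrite -subr_eq0 -cmod_gt0.
  rewrite ler_wpM2l// lef_pV2 ?posrE ?exprn_gt0//.
  by rewrite lerXn2r// nnegrE ltW.
have -> : 8 * M * C * (r / r ^+ ord p) = M * C / r ^+ ord p *
    (2 * ((complex.Re p + r - (complex.Re p - r)) +
          (complex.Im p + r - (complex.Im p - r)))) by ring.
have far x y : `|x - complex.Re p| = r \/ `|y - complex.Im p| = r ->
    r <= cmod (x +i* y - p).
  case=> <-; [apply: le_trans (Re_le_cmod _)|apply: le_trans (Im_le_cmod _)];
  by rewrite ?ReD ?ReN ?ImD ?ImN.
have pole1 : poles_in [:: p] (fun z => f z * G z) (complex.Re p - r)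
    (complex.Re p + r) (complex.Im p - r) (complex.Im p + r).
  split=> [q|z zs].
    by rewrite inE => /eqP ->; split; apply/andP; split; lra.
  by rewrite inE; apply: dfG; exact: sub.
apply: cmod_rint_le; [lra|lra| | | | |].
- apply: (poles_bcont _ _ pole1); lra.
- move=> x xI; apply: bnd; first by split => //=; apply/andP; split; lra.
  apply: far; right; rewrite addrC addKr normrN gtr0_norm//.
- move=> x xI; apply: bnd; first by split => //=; apply/andP; split; lra.
  apply: far; right; rewrite addrC addKr gtr0_norm//.
- move=> y yI; apply: bnd; first by split => //=; apply/andP; split; lra.
  apply: far; left; rewrite addrC addKr normrN gtr0_norm//.
- move=> y yI; apply: bnd; first by split => //=; apply/andP; split; lra.
  apply: far; left; rewrite addrC addKr gtr0_norm//.
Qed.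

Lemma sum_bound (T : Type) (P : pred R[i]) (u : R[i] -> T -> R[i]) (w : T -> R)
    (D : set T) :
  (forall t, D t -> 0 <= w t) ->
  (forall p, p \in S -> P p -> exists2 M : R, 0 <= M &
     forall t, D t -> cmod (u p t) <= M * w t) ->
  exists2 M : R, 0 <= M &
    forall t, D t -> cmod (\sum_(p <- S | P p) u p t) <= M * w t.
Proof.
move=> w0; elim: (S) => [|p s IH] H.
  by exists 0 => // t Dt; rewrite big_nil cmod0 mul0r.
have [|M M0 HM] := IH; first by move=> q qs; apply: H; rewrite inE qs orbT.
have [Pp|nP] := boolP (P p); last first.
  by exists M => // t Dt; rewrite big_cons (negbTE nP) HM.
have [M' M'0 HM'] := H p (mem_head _ _) Pp.
exists (M' + M); first by rewrite addr_ge0.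
move=> t Dt; rewrite big_cons Pp mulrDl (le_trans (cmodD _ _))// lerD//.
  exact: HM'.
exact: HM.
Qed.

Lemma boundary_Cint_le C G (M : R) : hol_half sg (a / 2) M G ->
  (forall x : R, cmod (G (x +i* - (sg * a0))) <= C) ->
  cmod (Cint setT (fun x : R => f (x +i* - (sg * a0)) * G (x +i* - (sg * a0))))
  <= C * \int[mu]_x cmod (f (x +i* - (sg * a0))).
Proof.
move=> hG GC; have pa := ps_a ps; have paa := ps_aa0 ps.
have ta : a / 2 <= a0 by lra.
have ci := boundary_cint ta hG.
rewrite (le_trans (cmod_Cint_le _ ci))//.
rewrite -RintegralZl//; last exact: boundary_int.
apply: le_Rintegral => //.
- exact: cint_on_cmod.
- exact: (integrableZl _ C boundary_int).
- by move=> x _; rewrite cmodM mulrC ler_wpM2r ?cmod_ge0.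
Qed.

(** The bound is linear in the supremum of [G]; this is what makes the
    remainder of the geometric series negligible in [fourier_sum_half]. *)
Lemma Lhalf_bound : exists2 D : R, 0 <= D & forall C G,
  hol_half sg (a / 2) C G -> cmod (Lhalf sg G) <= C * D.
Proof.
pose T := (R * (R[i] -> R[i]))%type.
pose DT : set T := [set t | hol_half sg (a / 2) t.1 t.2].
have [|p pS dp|M M0 HM] := @sum_bound T (fun p => 0 < depth sg p)
  (fun p t => sq (fun z => f z * t.2 z) p r0) (fun t => t.1) DT.
- by move=> t; exact: hol_half_ge0.
- have [M M0 HM] := sq_bound pS.
  have /andP[r00 _] := ps_r0 ps.
  exists (M * (r0 / r0 ^+ ord p)).
    by rewrite mulr_ge0// divr_ge0// ?exprn_ge0// ltW.
  move=> [C G] /= hG; rewrite mulrAC; apply: HM => // z zs.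
    by apply: (proj1 (hG _ _)); exact: square_depth_a zs.
  by apply: (proj2 (hG _ _)); exact: square_depth_a zs.
exists (\int[mu]_x cmod (f (x +i* - (sg * a0))) + M).
  by rewrite addr_ge0// Rintegral_ge0// => x _; exact: cmod_ge0.
move=> C G hG; rewrite /Lhalf (le_trans (cmodB _ _))// mulrDr lerD//.
  apply: (boundary_Cint_le hG) => x; apply: (proj2 (hG _ _)).
  by rewrite depth_line; have := ps_a ps; have := ps_aa0 ps; lra.
rewrite cmodM cmod_real sg_norm mul1r mulrC.
exact: (HM (C, G)).
Qed.

End HalfStrip.

(** * Exponential decay of the Fourier transform *)

Section Decay.
Context {R : realType}.
Local Notation mu := (@lebesgue_measure R).
Implicit Types (G : R[i] -> R[i]) (p z : R[i]).

(** The character e^(-2 pi i xi z). *)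
Definition echar (xi : R) z : R[i] := cexp ((0 +i* - (2 * pi * xi)) * z).

Lemma derivable_echar xi z : derivable (echar xi) z 1.
Proof. exact: derivable_cexp. Qed.

Lemma cmod_echar xi z : cmod (echar xi z) = expR (2 * pi * xi * complex.Im z).
Proof. by rewrite cmod_cexp ReM /=; congr expR; ring. Qed.

Lemma echar_real xi (x : R) : echar xi (x +i* 0) = expi (- (2 * pi * x * xi)).
Proof.
rewrite -cexp_imag; congr cexp.
by apply: complex_eq; rewrite ?ReM ?ImM /=; ring.
Qed.

Variables (f : R[i] -> R[i]) (S : seq R[i]) (a0 a r0 : R).
Hypothesis ps : pole_strip f S a0 a r0.
Hypothesis fex : fourier_exists (fun x : R => f x%:C).
Variable sg : R.
Hypothesis sgP : sg = 1 \/ sg = -1.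

Lemma cmod_echar_depth s z :
  cmod (echar (sg * s) z) = expR (- (2 * pi * s * depth sg z)).
Proof. by rewrite cmod_echar /depth; congr expR; ring. Qed.

Lemma hol_half_echar s : 0 <= s -> hol_half sg 0 1 (echar (sg * s)).
Proof.
move=> s0 z z0; split; first exact: derivable_echar.
rewrite cmod_echar_depth expR_le1 oppr_le0 !mulr_ge0//; exact: pi_ge0.
Qed.

(** The line at depth 0 is the real line. *)
Lemma fourier_Lhalf s : 0 <= s ->
  fourier (fun x : R => f x%:C) (sg * s) = Lhalf f S a0 r0 sg (echar (sg * s)).
Proof.
move=> s0; have pa := ps_a ps.
have t0 : (0 : R) <= 0 <= a / 2 by rewrite lexx divr_ge0// ltW.
apply: lim2_unique _ (half_shift ps sgP t0 (hol_half_echar s0)).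
have := lim2_Cint (fex (sg * s)); apply: lim2_eq => X1 X2 _ _.
by apply: eq_sint => x _; rewrite mulr0 oppr0 echar_real.
Qed.

Variable ord : R[i] -> nat.
Hypothesis polar : forall p, p \in S -> exists2 M : R, 0 <= M &
  forall w, square p r0 w -> w != p -> cmod (f w) <= M / cmod (w - p) ^+ ord p.
Hypothesis ord0 : forall p, p \in S -> (0 < ord p)%N.
Variable m0 : nat.
Hypothesis ordm : forall p, p \in S -> `|complex.Im p| = a -> (ord p <= m0)%N.

Let wt (s : R) := (s ^+ m0.-1 + 1) * expR (- (2 * pi * a * s)).

Let wt_ge0 s : 0 <= s -> 0 <= wt s.
Proof. by move=> s0; rewrite mulr_ge0 ?expR_ge0// addr_ge0// exprn_ge0. Qed.

(** On the square of half-side 1/s about a pole at distance [a] from the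
    axis, the character exceeds e^(-2 pi a s) by a bounded factor only, while [f]
    is of order s^(ord p) on a path of length 8/s. This gives the power
    s^(ord p - 1). For a pole further away a fixed square at depth at least [a]
    does. *)
Lemma residue_decay p : p \in S -> 0 < depth sg p -> exists2 M : R, 0 <= M &
  forall s, Num.max 1 r0^-1 <= s ->
    cmod (sq (fun z => f z * echar (sg * s) z) p r0) <= M * wt s.
Proof.
move=> pS dp; have [M M0 HM] := sq_bound ps polar pS.
have /andP[r00 _] := ps_r0 ps; have pa := ps_a ps.
have pi2 : 0 <= 2 * pi :> R by rewrite mulr_ge0// pi_ge0.
have dpE := depth_pole sgP pS dp.
have [imE|imN] := eqVneq `|complex.Im p| a.
- exists (M * expR (2 * pi)); first by rewrite mulr_ge0// expR_ge0.
  move=> s; rewrite ge_max => /andP[s1 sr].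
  have s0 : 0 < s by exact: lt_le_trans s1.
  have rs : s^-1 <= r0 by rewrite -[r0]invrK lef_pV2 ?posrE ?invr_gt0.
  have := HM s^-1 (echar (sg * s)) (expR (2 * pi) * expR (- (2 * pi * a * s))) _ rs.
  rewrite invr_gt0 => /(_ s0 (fun z _ => @derivable_echar (sg * s) z)) H.
  apply: (le_trans (H _)).
    move=> z /(square_depth sgP); rewrite cmod_echar_depth -expRD ler_expR.
    rewrite dpE imE => zd.
    have : 2 * pi * s * (a - s^-1) <= 2 * pi * s * depth sg z.
      by rewrite ler_wpM2l// mulr_ge0// ltW.
    have -> : 2 * pi * s * (a - s^-1) = 2 * pi * a * s - 2 * pi.
      by field; rewrite gt_eqF.
    lra.
  rewrite /wt -!mulrA ler_wpM2l// ler_wpM2l ?expR_ge0// mulrC.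
  rewrite ler_wpM2r ?expR_ge0//.
  have -> : s^-1 / s^-1 ^+ ord p = s ^+ (ord p).-1.
    rewrite exprVn invrK -{1}(prednK (ord0 pS)) exprS mulKf// gt_eqF//.
  rewrite ler_wpDr// ler_weXn2l//.
  by have := ordm pS imE; have := ord0 pS; case: (ord p) => // n _; case: (m0).
(* the depth stays at least a on this square *)
pose r := Num.min r0 (`|complex.Im p| - a).
have /andP[ap _] := ps_S ps pS.
have r_0 : 0 < r by rewrite lt_min r00 subr_gt0 lt_neqAle eq_sym imN.
have rr0 : r <= r0 by rewrite ge_min lexx.
have ra : r <= `|complex.Im p| - a by rewrite ge_min lexx orbT.
exists (M * (r / r ^+ ord p)).
  by rewrite mulr_ge0// divr_ge0 ?exprn_ge0// ltW.
move=> s; rewrite ge_max => /andP[s1 sr].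
have s0 : 0 <= s by exact: le_trans s1.
apply: (le_trans (HM r (echar (sg * s)) (expR (- (2 * pi * a * s))) r_0 rr0
  (fun z _ => @derivable_echar (sg * s) z) _)).
  move=> z /(square_depth sgP); rewrite cmod_echar_depth ler_expR dpE => zd.
  rewrite lerN2 -!mulrA ler_wpM2l// ler_wpM2l ?pi_ge0// mulrC ler_wpM2l//; lra.
rewrite mulrAC; apply: ler_wpM2l.
  by rewrite mulr_ge0// divr_ge0 ?exprn_ge0// ltW.
by rewrite /wt ler_peMl ?expR_ge0// lerDr exprn_ge0.
Qed.

(** After the shift, the integral along the edge is of order
    e^(-2 pi a0 s) and the poles contribute as in [residue_decay]. This settles
    large [s]; a bounded range of [s] is covered by the L1 norm of [f]. *)
Lemma fourier_decay_half : exists2 B : R, 0 <= B & forall s, 0 <= s ->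
  cmod (fourier (fun x : R => f x%:C) (sg * s)) <= B * wt s.
Proof.
have pa := ps_a ps; have paa := ps_aa0 ps; have /andP[r00 _] := ps_r0 ps.
pose s0 := Num.max 1 r0^-1.
have s01 : 1 <= s0 by rewrite le_max lexx.
have pi0 := pi_ge0 R.
have [|p pS dp|M M0 HM] := @sum_bound R S R (fun p => 0 < depth sg p)
  (fun p s => sq (fun z => f z * echar (sg * s) z) p r0) wt [set s | s0 <= s].
- by move=> s /= ss; apply: wt_ge0; lra.
- exact: residue_decay.
pose I1 := \int[mu]_x cmod (f (x +i* - (sg * a0))).
pose I2 := \int[mu]_x cmod (f x%:C).
have I10 : 0 <= I1 by apply: Rintegral_ge0 => x _; exact: cmod_ge0.
have I20 : 0 <= I2 by apply: Rintegral_ge0 => x _; exact: cmod_ge0.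
exists (I1 + M + I2 * expR (2 * pi * a * s0)).
  by rewrite !addr_ge0// mulr_ge0// expR_ge0.
move=> s s_0; have w0 := wt_ge0 s_0.
have [ss|ss] := leP s0 s; last first.
  apply: (@le_trans _ _ (I2 * expR (2 * pi * a * s0) * wt s)); last first.
    by rewrite ler_wpM2r// lerDr addr_ge0.
  apply: (@le_trans _ _ I2).
    rewrite (le_trans (cmod_Cint_le _ (fex _)))//.
    rewrite le_eqVlt; apply/orP; left; apply/eqP; apply: eq_Rintegral => x _.
    by rewrite cmodM cmod_expi mulr1.
  rewrite -mulrA ler_peMr// /wt mulrCA -expRD.
  rewrite (@le_trans _ _ (1 * 1))//; first by rewrite mulr1.
  rewrite ler_pM//; first by rewrite lerDr exprn_ge0.
  rewrite -expR0 ler_expR -mulrBr.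
  by rewrite !mulr_ge0// ?subr_ge0 ltW.
apply: (@le_trans _ _ ((I1 + M) * wt s)); last first.
  by rewrite ler_wpM2r// lerDl mulr_ge0// expR_ge0.
rewrite fourier_Lhalf// /Lhalf (le_trans (cmodB _ _))// mulrDl lerD//; last first.
  by rewrite cmodM cmod_real (sg_norm sgP) mul1r HM.
have hh := hol_halfW (_ : 0 <= a / 2) (hol_half_echar s_0).
rewrite (le_trans (boundary_Cint_le ps sgP (hh _) (C := expR (- (2 * pi * a * s))) _))//.
- by rewrite divr_ge0// ltW.
- move=> x; rewrite cmod_echar_depth depth_line// ler_expR lerN2.
  by rewrite -!mulrA ler_wpM2l// ler_wpM2l// mulrC ler_wpM2l// ltW.
- by rewrite mulrC ler_wpM2l// /wt ler_peMl ?expR_ge0// lerDr exprn_ge0.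
Qed.

End Decay.

(** * The periodic kernel *)

Lemma derivableC_inv (R : realType) (g : R[i] -> R[i]) (z : R[i]) :
  g z != 0 -> derivable g z 1 -> derivable (fun w => (g w)^-1) z 1.
Proof. by move=> gz dg; exact: (@derivableV R[i] R[i] g z 1 gz dg). Qed.

Section Kernel.
Context {R : realType}.
Implicit Types (G : R[i] -> R[i]) (p z : R[i]).
Variable h : R.
Hypothesis h0 : 0 < h.

(** The character e^(-2 pi i sg z / h), of period [h]. *)
Definition qchar (sg : R) z : R[i] := echar (sg / h) z.

(** The sum of the geometric series of ratio [qchar], from exponent 1 on.
    Its terms are the characters of the frequencies sg n / h. *)
Definition kern (sg : R) z : R[i] := qchar sg z / (1 - qchar sg z).

Let pi2h : 0 < 2 * pi / h :> R.
Proof. by rewrite divr_gt0// mulr_gt0// pi_gt0. Qed.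

Lemma cmod_qchar sg z : cmod (qchar sg z) = expR (- (2 * pi / h * depth sg z)).
Proof. by rewrite cmod_echar /depth; congr expR; ring. Qed.

Lemma echarX xi n z : echar xi z ^+ n = echar (n%:R * xi) z.
Proof.
rewrite /echar cexpX; congr cexp.
rewrite mulrA; congr (_ * _); rewrite -[n%:R]/(n%:R : R[i]).
have -> : n%:R = n%:R%:C :> R[i] by rewrite rmorph_nat.
by apply: complex_eq; rewrite ?ReM ?ImM /=; ring.
Qed.

Lemma qcharN sg z : qchar (- sg) z = (qchar sg z)^-1.
Proof.
rewrite /qchar /echar -cexpN; congr cexp.
by apply: complex_eq; rewrite ?ReN ?ImN ?ReM ?ImM /=; ring.
Qed.

Lemma qchar_neq0 sg z : qchar sg z != 0.
Proof. exact: cexp_neq0. Qed.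

(** The geometric series in q and in 1/q add up to -1; this -1 becomes the
    frequency 0 in Poisson summation. *)
Lemma kernN sg z : qchar sg z != 1 -> kern (- sg) z = - 1 - kern sg z.
Proof.
move=> q1; rewrite /kern qcharN; have q0 := qchar_neq0 sg z.
move: (qchar sg z) q0 q1 => q q0 q1.
have q2 : 1 - q != 0 by rewrite subr_eq0 eq_sym.
by field; rewrite q2 q0 subr_eq0 q1.
Qed.

Lemma derivable_kern sg z : qchar sg z != 1 -> derivable (kern sg) z 1.
Proof.
move=> q1; have dq : derivable (qchar sg) z 1 by exact: derivable_echar.
have n0 : 1 - qchar sg z != 0 by rewrite subr_eq0 eq_sym.
have d1 : derivable (fun w => 1 - qchar sg w) z 1.
  exact: (derivableB (derivable_cst (1 : R[i]) z 1) dq).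
have d2 : derivable (fun w => (1 - qchar sg w)^-1) z 1.
  exact: (@derivableC_inv R (fun w => 1 - qchar sg w)).
exact: (derivableM dq d2).
Qed.

Lemma qchar_lt1 sg t z : 0 < t -> t <= depth sg z ->
  cmod (qchar sg z) <= expR (- (2 * pi / h * t)) < 1.
Proof.
move=> t0 tz; rewrite cmod_qchar ler_expR lerN2 ler_pM2l// tz /=.
by rewrite expR_lt1 oppr_lt0 mulr_gt0.
Qed.

Lemma qchar_neq1_depth sg z : depth sg z != 0 -> qchar sg z != 1.
Proof.
apply: contraNneq => q1.
have : expR (- (2 * pi / h * depth sg z)) = expR 0.
  by rewrite -cmod_qchar q1 cmod1 expR0.
move=> /expR_inj/eqP.
by rewrite oppr_eq0 mulf_eq0 (gt_eqF pi2h).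
Qed.

Lemma hol_half_qkern sg t n : 0 < t ->
  hol_half sg t (expR (- (2 * pi / h * t)) ^+ n *
                 (1 - expR (- (2 * pi / h * t)))^-1)
    (fun z => qchar sg z ^+ n * kern sg z).
Proof.
move=> t0 z zt; have /andP[q1 rho1] := qchar_lt1 t0 zt.
set rho := expR _ in q1 rho1 *; have rho0 : 0 <= rho by exact: expR_ge0.
have q_1 : qchar sg z != 1.
  by apply: qchar_neq1_depth; rewrite gt_eqF// (lt_le_trans t0).
split.
  apply: derivableM; last exact: derivable_kern.
  by under eq_fun do rewrite /qchar echarX; exact: derivable_echar.
rewrite cmodM cmodX ler_pM ?exprn_ge0 ?cmod_ge0//.
  by rewrite lerXn2r// nnegrE cmod_ge0.
rewrite /kern cmodM cmodV -[leRHS]mul1r ler_pM ?invr_ge0 ?cmod_ge0//.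
  exact: le_trans q1 (ltW rho1).
rewrite lef_pV2 ?posrE ?subr_gt0//; last by rewrite cmod_gt0 subr_eq0 eq_sym.
have := cmodD (1 - qchar sg z) (qchar sg z); rewrite subrK cmod1; lra.
Qed.

Lemma hol_half_kern sg t : 0 < t ->
  hol_half sg t (1 - expR (- (2 * pi / h * t)))^-1 (kern sg).
Proof.
move=> t0 z /(hol_half_qkern 0 t0); rewrite expr0 mul1r.
by under eq_fun do rewrite expr0 mul1r; rewrite expr0 mul1r.
Qed.

Lemma kern_step sg n z : qchar sg z != 1 ->
  qchar sg z ^+ n * kern sg z =
  qchar sg z ^+ n.+1 + qchar sg z ^+ n.+1 * kern sg z.
Proof.
move=> q1; rewrite /kern !exprSr; move: (qchar sg z) q1 => q q1.
have q2 : 1 - q != 0 by rewrite subr_eq0 eq_sym.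
by move: (q ^+ n) => u; field.
Qed.

Lemma qchar_shift sg z : sg = 1 \/ sg = -1 -> qchar sg (z + h%:C) = qchar sg z.
Proof.
move=> sgP; rewrite /qchar /echar mulrDr cexpD.
have -> : (0 +i* - (2 * pi * (sg / h))) * h%:C = 0 +i* - (sg * (2 * pi)).
  by apply: complex_eq; rewrite ?ReM ?ImM /=; field; rewrite gt_eqF.
rewrite cexp_imag; suff -> : expi (- (sg * (2 * pi))) = 1 :> R[i] by rewrite mulr1.
case: sgP => ->; last by rewrite mulN1r opprK expi_2pi.
by rewrite mul1r; have := @expiD R (- (2 * pi)) (2 * pi); rewrite addNr expi0 expi_2pi mulr1.
Qed.

Lemma kern_shift sg z : sg = 1 \/ sg = -1 -> kern sg (z + h%:C) = kern sg z.
Proof. by move=> sgP; rewrite /kern qchar_shift. Qed.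

Lemma qchar_shiftn sg z (n : int) : sg = 1 \/ sg = -1 ->
  qchar sg (z + (n%:~R * h)%:C) = qchar sg z.
Proof.
move=> sgP; elim/int_ind: n => [|n IH|n IH].
- by rewrite mul0r addr0.
- have -> : n.+1%:~R = n%:~R + 1 :> R by rewrite -!pmulrn natr1.
  by rewrite -[RHS]IH mulrDl mul1r rmorphD /= addrA qchar_shift.
- rewrite -[RHS]IH -[LHS](qchar_shift _ sgP); congr qchar.
  rewrite -addrA -rmorphD /=; congr (_ + _%:C).
  have -> : (- n%:Z)%:~R = (- n.+1%:Z)%:~R + 1 :> R.
    by rewrite !mulrNz -!pmulrn -natr1; ring.
  by ring.
Qed.

(** The linear term u = -2 pi i z / h dominates the quadratic remainder as
    soon as |u| <= 1/16, and half of it survives. *)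
Lemma qchar_zero z : 2 * pi / h * cmod z <= 1 / 16 ->
  pi / h * cmod z <= cmod (1 - qchar 1 z).
Proof.
move=> zs; pose u : R[i] := (0 +i* - (2 * pi * (1 / h))) * z.
have uE : cmod u = 2 * pi / h * cmod z.
  rewrite cmodM cmod_imag normrN; congr (_ * _).
  by rewrite mul1r gtr0_norm.
have u0 := cmod_ge0 u; have us : cmod u <= 1 / 16 by rewrite uE.
set c := cmod u in uE u0 us *.
have e2 : expR c <= 2.
  have e0 := expR_gt0 c; have := ler_wpM2l (ltW e0) (expR_ge1Dx (- c)).
  by rewrite expRxMexpNx_1; have := ler_wpM2l (ltW e0) us; lra.
have tay : cmod (qchar 1 z - 1 - u) <= 4 * c ^+ 2 * expR c :=
  cexp_taylor1_le u.
have tay2 : cmod (qchar 1 z - 1 - u) <= c / 2.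
  apply: (le_trans tay); apply: (@le_trans _ _ (4 * c ^+ 2 * 2)).
    by rewrite ler_wpM2l// mulr_ge0// exprn_ge0.
  by have := ler_wpM2l u0 us; rewrite expr2; lra.
have := cmodB (qchar 1 z - 1) (qchar 1 z - 1 - u).
have -> : qchar 1 z - 1 - (qchar 1 z - 1 - u) = u by ring.
rewrite -/c (cmod_distC (qchar 1 z) 1).
have -> : pi / h * cmod z = c / 2 by rewrite uE; field; rewrite gt_eqF.
by lra.
Qed.

(** Off the real axis [qchar] is not unimodular; on it, equality with 1
    forces cos (2 pi (x - n h) / h) = 1, and the angle is at most pi. *)
Lemma qchar_neq1_cell (n : int) z : `|complex.Re z - n%:~R * h| <= h / 2 ->
  z != (n%:~R * h)%:C -> qchar 1 z != 1.
Proof.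
move=> zn znh; have s1 : (1 : R) = 1 \/ (1 : R) = -1 by left.
have [Im0|Im0] := eqVneq (complex.Im z) 0; last first.
  by apply: qchar_neq1_depth; rewrite /depth mul1r oppr_eq0.
apply: contra_neq znh; case: z zn Im0 => x y /= zn -> q1.
have : qchar 1 ((x - n%:~R * h) +i* 0) = 1.
  rewrite -q1 -[LHS](@qchar_shiftn 1 _ n s1); congr qchar.
  by apply: complex_eq => /=; ring.
rewrite /qchar echar_real => /(congr1 (@complex.Re R)) /=; rewrite cosN => c1.
set t := x - n%:~R * h in zn c1.
have : `|2 * pi * t * (1 / h)| = 0.
  apply: (@cos_inj R); rewrite ?in_itv /= ?normr_ge0 ?lexx ?pi_ge0//.
    have -> : 2 * pi * t * (1 / h) = pi / (h / 2) * t by field; rewrite gt_eqF.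
    rewrite normrM ger0_norm; last by rewrite divr_ge0 ?pi_ge0// divr_ge0// ltW.
    rewrite mulrAC ler_pdivrMr ?divr_gt0// ler_wpM2l// pi_ge0.
    by [].
  by rewrite cos_norm cos0.
move=> /eqP; rewrite normr_eq0 !mulf_eq0 (gt_eqF (pi_gt0 R)) /= invr_eq0.
rewrite (gt_eqF h0) oner_eq0 !orbF pnatr_eq0 /= => /eqP t0.
by apply: complex_eq => //=; apply/eqP; rewrite -subr_eq0 -/t t0.
Qed.

End Kernel.

(** * Sampling by the periodic kernel *)

Section Cells.
Context {R : realType}.
Local Notation mu := (@lebesgue_measure R).
Implicit Types (G : R[i] -> R[i]) (p z : R[i]).
Variable h : R.
Hypothesis h0 : 0 < h.

(** The integral does not change when the contour shrinks to a square of
    half-side [r], along which it is at most 8 M r. *)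
Lemma rint_removable G p x1 x2 y1 y2 (M r0 : R) : 0 < r0 ->
  poles_in [:: p] G x1 x2 y1 y2 ->
  x1 < complex.Re p < x2 -> y1 < complex.Im p < y2 ->
  (forall z, square p r0 z -> z != p -> cmod (G z) <= M) ->
  rint G x1 x2 y1 y2 = 0.
Proof.
move=> r00 pG /andP[p1 p2] /andP[p3 p4] GM.
apply/eqP; rewrite -cmod_eq0 eq_le cmod_ge0 andbT; apply/ler_addgt0Pl => e e0.
rewrite addr0.
have M1 : 0 < 8 * (`|M| + 1) by rewrite mulr_gt0// ltr_wpDl.
pose r := Num.min (Num.min r0 (e / (8 * (`|M| + 1)))) (Num.min
    (Num.min (complex.Re p - x1) (x2 - complex.Re p))
    (Num.min (complex.Im p - y1) (y2 - complex.Im p))).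
have rp : 0 < r by rewrite !lt_min !subr_gt0 p1 p2 p3 p4 divr_gt0// r00.
have r1 : r <= r0 by rewrite !ge_min lexx.
have r2 : r <= e / (8 * (`|M| + 1)) by rewrite !ge_min lexx !orbT.
have r3 : r <= complex.Re p - x1 by rewrite !ge_min lexx !orbT.
have r4 : r <= x2 - complex.Re p by rewrite !ge_min lexx !orbT.
have r5 : r <= complex.Im p - y1 by rewrite !ge_min lexx !orbT.
have r6 : r <= y2 - complex.Im p by rewrite !ge_min lexx !orbT.
have -> : rint G x1 x2 y1 y2 = sq G p r by apply: (rint_sq rp pG); lra.
have pole1 : poles_in [:: p] G (complex.Re p - r)
    (complex.Re p + r) (complex.Im p - r) (complex.Im p + r).
  split=> [q|z [/andP[z1 z2] /andP[z3 z4]]].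
    by rewrite inE => /eqP ->; split; apply/andP; split; lra.
  by apply: (proj2 pG); split; apply/andP; split; lra.
have bnd z : square p r z -> z != p -> cmod (G z) <= `|M|.
  move=> [/andP[z1 z2] /andP[z3 z4]] zp; apply: le_trans (ler_norm M).
  by apply: GM => //; split; apply/andP; split; lra.
have neqx x y : x != complex.Re p -> x +i* y != p.
  by apply: contra_neq => <-.
have neqy x y : y != complex.Im p -> x +i* y != p.
  by apply: contra_neq => <-.
apply: (@le_trans _ _ (`|M| * (2 * ((complex.Re p + r - (complex.Re p - r)) +
          (complex.Im p + r - (complex.Im p - r)))))).
  apply: cmod_rint_le; [lra|lra| | | | |].
  - apply: (poles_bcont _ _ pole1); lra.
  - move=> x xI; apply: bnd; first by split => //=; apply/andP; split; lra.
    by apply: neqy; rewrite lt_eqF// gtrDl oppr_lt0.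
  - move=> x xI; apply: bnd; first by split => //=; apply/andP; split; lra.
    by apply: neqy; rewrite gt_eqF// ltrDl.
  - move=> y yI; apply: bnd; first by split => //=; apply/andP; split; lra.
    by apply: neqx; rewrite lt_eqF// gtrDl oppr_lt0.
  - move=> y yI; apply: bnd; first by split => //=; apply/andP; split; lra.
    by apply: neqx; rewrite gt_eqF// ltrDl.
have -> : `|M| * (2 * ((complex.Re p + r - (complex.Re p - r)) +
    (complex.Im p + r - (complex.Im p - r)))) = 8 * `|M| * r by ring.
move: r2; rewrite ler_pdivlMr// => r2; apply: le_trans r2.
by have := ltW rp; lra.
Qed.

Lemma rint_degenerate G x y1 y2 : rint G x x y1 y2 = 0.
Proof.
by rewrite /rint subrr mulr0 addr0 /sint set_itv1 /Cint !Rintegral_set1 subrr.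
Qed.

(** The vertical sides of a rectangle of width [h] cancel by periodicity. *)
Lemma period_line G x1 y1 y2 : y1 <= y2 ->
  (forall z, G (z + h%:C) = G z) ->
  (forall z, y1 <= complex.Im z <= y2 -> derivable G z 1) ->
  sint x1 (x1 + h) (fun x => G (x +i* y1)) =
  sint x1 (x1 + h) (fun x => G (x +i* y2)).
Proof.
move=> yy Gh dG; have xx : x1 <= x1 + h by rewrite lerDl ltW.
have := goursat xx yy (fun z zr => dG z (proj2 zr)).
rewrite /rint; have -> : sint y1 y2 (fun y => G ((x1 + h) +i* y)) =
    sint y1 y2 (fun y => G (x1 +i* y)).
  apply: eq_sint => y _; rewrite -[RHS]Gh; congr G.
  by apply: complex_eq => /=; ring.
by rewrite subrr mulr0 addr0 => /eqP; rewrite subr_eq0 => /eqP.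
Qed.

Lemma le0_of_exp_decay (x C c b : R) : 0 < c ->
  (forall y, b <= y -> x <= C * expR (- (c * y))) -> x <= 0.
Proof.
move=> c0 H; rewrite leNgt; apply/negP => x0.
pose y := Num.max b (C / (x * c)).
have by_ : b <= y by rewrite le_max lexx.
have Cy : C / (x * c) <= y by rewrite le_max lexx orbT.
have := H _ by_; apply/negP; rewrite -ltNge expRN ltr_pdivrMr ?expR_gt0//.
have : C <= x * (c * y).
  by move: Cy; rewrite ler_pdivrMr ?mulr_gt0// => /le_trans; apply; rewrite mulrC -mulrA.
move=> /le_lt_trans; apply; rewrite ltr_pM2l//.
by apply: lt_le_trans (expR_ge1Dx _); rewrite ltrDr.
Qed.

(** The line may be moved to infinity without changing the integral, and the
    kernel decays exponentially there. *)
Lemma kern_period sg b x1 : sg = 1 \/ sg = -1 -> 0 < b ->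
  sint x1 (x1 + h) (fun x => kern h sg (x +i* - (sg * b))) = 0.
Proof.
move=> sgP b0; have xx : x1 <= x1 + h by rewrite lerDl ltW.
have dk z : 0 < depth sg z -> derivable (kern h sg) z 1.
  by move=> dz; apply: derivable_kern => //; apply: qchar_neq1_depth; rewrite ?gt_eqF.
have same y : b <= y -> sint x1 (x1 + h) (fun x => kern h sg (x +i* - (sg * b))) =
    sint x1 (x1 + h) (fun x => kern h sg (x +i* - (sg * y))).
  move=> by_; have kh z := @kern_shift R h h0 sg z sgP.
  move: dk kh; rewrite /depth; case: sgP => ->; rewrite ?mul1r ?mulN1r ?opprK => dk kh.
    apply/esym/period_line => //; first by rewrite lerN2.
    by move=> z /andP[z1 z2]; apply: dk; rewrite mul1r; lra.
  apply: period_line => // z /andP[z1 z2]; apply: dk.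
  by rewrite mulN1r opprK; lra.
apply/eqP; rewrite -cmod_eq0 eq_le cmod_ge0 andbT.
have c0 : 0 < 2 * pi / h :> R by rewrite divr_gt0// mulr_gt0// pi_gt0.
set rho := expR (- (2 * pi / h * b)).
have rho1 : rho < 1 by rewrite expR_lt1 oppr_lt0 mulr_gt0.
apply: (@le0_of_exp_decay _ ((1 - rho)^-1 * h) (2 * pi / h) b c0) => y by_.
rewrite (same _ by_) mulrAC.
have -> : forall u : R, u * h = u * (x1 + h - x1) by move=> u; ring.
have y0 : 0 < y by exact: lt_le_trans by_.
have hk := @hol_half_qkern R h h0 sg y 0 y0.
apply: cmod_sint_leM => //.
  apply: continuous_scont => x; apply: continuous_comp; first exact: hline_continuous.
  by apply/derivable_contC/dk; rewrite depth_line.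
move=> x _; have dl := depth_line sgP x y.
have /andP[q1 _] := @qchar_lt1 R h h0 sg y (x +i* - (sg * y)) y0 ltac:(by rewrite dl).
rewrite /kern cmodM cmodV mulrC ler_pM ?invr_ge0 ?cmod_ge0//.
have nq : 0 < cmod (1 - qchar h sg (x +i* - (sg * y))).
  rewrite cmod_gt0 subr_eq0 eq_sym; apply: qchar_neq1_depth => //.
  by rewrite dl gt_eqF.
rewrite lef_pV2 ?posrE ?subr_gt0//.
have := cmodD (1 - qchar h sg (x +i* - (sg * y))) (qchar h sg (x +i* - (sg * y))).
rewrite subrK cmod1.
have : expR (- (2 * pi / h * y)) <= rho by rewrite ler_expR lerN2 ler_pM2l.
lra.
Qed.

Lemma sign_pos : (1 : R) = 1 \/ (1 : R) = -1. Proof. by left. Qed.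
Lemma sign_neg : (-1 : R) = 1 \/ (-1 : R) = -1. Proof. by right. Qed.

(** The vertical sides cancel. On the lower side the kernel has mean 0 by
    [kern_period]; on the upper side it is -1 minus the kernel of opposite sign,
    which has mean 0 there, and the constant -1, traversed backwards, gives [h]. *)
Lemma kern_cell (n : int) b : 0 < b ->
  rint (kern h 1) (n%:~R * h - h / 2) (n%:~R * h + h / 2) (- b) b = h%:C.
Proof.
move=> b0; have -> : n%:~R * h + h / 2 = n%:~R * h - h / 2 + h by field.
set x1 := _ - _; rewrite /rint.
have -> : sint (- b) b (fun y => kern h 1 ((x1 + h) +i* y)) =
    sint (- b) b (fun y => kern h 1 (x1 +i* y)).
  apply: eq_sint => y _; rewrite -[RHS](@kern_shift R h h0 1 _ sign_pos); congr kern.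
  by apply: complex_eq => /=; ring.
rewrite subrr mulr0 addr0.
have := @kern_period 1 b x1 sign_pos b0; rewrite mul1r => ->.
have e1 : sint x1 (x1 + h) (fun x => kern h 1 (x +i* b)) =
    sint x1 (x1 + h) (fun x => (-1) - kern h (-1) (x +i* - (-1 * b))).
  apply: eq_sint => x _; rewrite mulN1r opprK kernN; first by ring.
  by apply: qchar_neq1_depth; rewrite /depth //= mul1r oppr_eq0 gt_eqF.
have ck : scont x1 (x1 + h) (fun x => kern h (-1) (x +i* - (-1 * b))).
  apply: continuous_scont => x; apply: continuous_comp; first exact: hline_continuous.
  apply/derivable_contC/derivable_kern/qchar_neq1_depth => //.
  by rewrite depth_line ?gt_eqF//; exact: sign_neg.
rewrite e1 (sintB (@scont_cst R x1 (x1 + h) (-1)) ck) (@kern_period (-1) b x1 sign_neg b0).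
rewrite sint_cst ?lerDl ?(ltW h0)// subr0 sub0r mulrN1 opprK.
by congr (_%:C); ring.
Qed.

Variables (f : R[i] -> R[i]) (a : R).
Hypothesis df : forall z, `|complex.Im z| < a -> derivable f z 1.

Variable b : R.
Hypothesis b0 : 0 < b.
Hypothesis ba : b < a.

(** Subtracting the value at the sampling point from [f] compensates the
    simple zero of [1 - qchar], and [rint_removable] disposes of the difference. *)
Lemma fkern_cell (n : int) :
  rint (fun z => f z * kern h 1 z) (n%:~R * h - h / 2) (n%:~R * h + h / 2)
    (- b) b = h%:C * f (n%:~R * h)%:C.
Proof.
have aux1 (P H W L : R) : P != 0 -> H != 0 -> W != 0 ->
    (L + 1) * W * ((P / H * W)^-1 + 1) = (L + 1) * (H / P + W).
  by move=> n1 n2 n3; field; rewrite n1 n2 n3.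
have aux2 (P H : R) : P != 0 -> H != 0 -> 1 / 64 / (2 * P / H) = H / P / 128.
  by move=> n1 n2; field; rewrite n1 n2.
set x1 := n%:~R * h - h / 2; set x2 := n%:~R * h + h / 2.
set p : R[i] := (n%:~R * h)%:C.
have h2 : 0 < h / 2 by rewrite divr_gt0.
have x12 : x1 <= x2 by rewrite /x1 /x2; lra.
have b0' := b0; have ba' := ba; have b12 : - b <= b by lra.
have qn1 z : in_rect x1 x2 (- b) b z -> z != p -> qchar h 1 z != 1.
  move=> [/andP[z1 z2] _]; apply: qchar_neq1_cell => //.
  by rewrite ler_norml; move: z1 z2; rewrite /x1 /x2 => *; apply/andP; split; lra.
have dk z : in_rect x1 x2 (- b) b z -> z != p -> derivable (kern h 1) z 1.
  by move=> zr zp; apply: derivable_kern; exact: qn1.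
have dF z : in_rect x1 x2 (- b) b z -> derivable f z 1.
  by move=> [_ /andP[z1 z2]]; apply: df; rewrite ltr_norml; apply/andP; split; lra.
have pin : x1 < complex.Re p < x2 /\ - b < complex.Im p < b.
  by rewrite /x1 /x2 /=; split; apply/andP; split; lra.
pose H := fun z : R[i] => (f z - f p) * kern h 1 z.
have mkpole G : (forall z, in_rect x1 x2 (- b) b z -> z != p -> derivable G z 1) ->
    poles_in [:: p] G x1 x2 (- b) b.
  move=> dG; split=> [q|z zr]; last by rewrite inE; exact: dG.
  by rewrite inE => /eqP ->.
have pH : poles_in [:: p] H x1 x2 (- b) b.
  apply: mkpole => z zr zp; apply: derivableM; last exact: dk.
  apply: derivableB; [exact: dF|exact: derivable_cst].
have pK : poles_in [:: p] (kern h 1) x1 x2 (- b) b by exact: mkpole.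
have E : rint (fun z => f z * kern h 1 z) x1 x2 (- b) b =
    rint H x1 x2 (- b) b + f p * rint (kern h 1) x1 x2 (- b) b.
  have bH := poles_bcont x12 b12 pH; have bK := poles_bcont x12 b12 pK.
  have cc : continuous (fun _ : R[i] => f p) by move=> z; exact: cst_continuous.
  have bc := continuous_bcont x1 x2 (- b) b cc.
  rewrite -(rintZ _ bK) -(rintD bH (bcontM bc bK)).
  by apply: eq_rint => t _; rewrite /H; ring.
rewrite E kern_cell// [f p * _]mulrC.
suff -> : rint H x1 x2 (- b) b = 0 by rewrite add0r.
have /derivableC_cmod[l /(_ 1 ltr01)[d d0 dl]] : derivable f p 1.
  by apply: df; rewrite /= normr0 (lt_trans b0).
have pih : 0 < 2 * pi / h :> R by rewrite divr_gt0// mulr_gt0// pi_gt0.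
(* points of the square are at distance at most 2 r: 1/64 meets the condition
   of [qchar_zero] *)
pose r := Num.min (d / 4) (1 / 64 / (2 * pi / h)).
have r0 : 0 < r.
  rewrite lt_min; apply/andP; split; first exact: divr_gt0.
  by apply: divr_gt0 => //; exact: divr_gt0.
have rd : r <= d / 4 by rewrite ge_min lexx.
have rp : r <= 1 / 64 / (2 * pi / h) by rewrite ge_min lexx orbT.
apply: (@rint_removable H p x1 x2 (- b) b ((cmod l + 1) * (h / pi) * 2) r r0 pH
  (proj1 pin) (proj2 pin)).
move=> z [/andP[z1 z2] /andP[z3 z4]] zp; pose w := z - p.
have w2r : cmod w <= 2 * r.
  rewrite (le_trans (cmod_le_ReIm _))// mulr_natl mulr2n lerD//.
    by rewrite ReD ReN ler_norml; apply/andP; split; lra.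
  by rewrite ImD ImN ler_norml; apply/andP; split; lra.
have w0 : 0 < cmod w by rewrite cmod_gt0 subr_eq0.
have fz : cmod (f z - f p) <= (cmod l + 1) * cmod w.
  have := dl z; rewrite -/w => /(_ _)H1.
  have {}H1 : cmod (f z - f p - l * w) <= 1 * cmod w by apply: H1; lra.
  have := cmodD (f z - f p - l * w) (l * w); rewrite subrK cmodM.
  by lra.
have wsmall : 2 * pi / h * cmod w <= 1 / 16.
  move: rp; rewrite ler_pdivlMr// => rp.
  have := ler_wpM2l (ltW pih) w2r; lra.
have qw : qchar h 1 z = qchar h 1 w.
  rewrite -(@qchar_shiftn R h h0 1 w n sign_pos); congr qchar.
  by rewrite /w -/p subrK.
have zl := qchar_zero h0 wsmall; rewrite -qw in zl.
have pw : 0 < pi / h * cmod w by rewrite mulr_gt0// divr_gt0// pi_gt0.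
have q10 : 0 < cmod (1 - qchar h 1 z) by exact: lt_le_trans zl.
have kb : cmod (kern h 1 z) <= (pi / h * cmod w)^-1 + 1.
  rewrite /kern cmodM cmodV.
  apply: (@le_trans _ _ ((1 + cmod (1 - qchar h 1 z)) / cmod (1 - qchar h 1 z))).
    rewrite ler_wpM2r ?invr_ge0 ?(ltW q10)//.
    have := cmodB 1 (1 - qchar h 1 z); rewrite subKr cmod1; lra.
  rewrite mulrDl mul1r divff ?gt_eqF// lerD2r.
  by rewrite lef_pV2 ?posrE.
rewrite /H cmodM.
apply: (@le_trans _ _ ((cmod l + 1) * cmod w * ((pi / h * cmod w)^-1 + 1))).
  by rewrite ler_pM ?cmod_ge0.
have n1 : pi != 0 :> R by rewrite gt_eqF// pi_gt0.
have n2 : h != 0 by rewrite gt_eqF.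
have n3 : cmod w != 0 by rewrite gt_eqF.
have -> : (cmod l + 1) * cmod w * ((pi / h * cmod w)^-1 + 1) =
    (cmod l + 1) * (h / pi + cmod w).
  exact: aux1.
have hp0 : 0 < h / pi :> R by rewrite divr_gt0// pi_gt0.
rewrite -mulrA ler_wpM2l//; first by rewrite addr_ge0// cmod_ge0.
have rE : 1 / 64 / (2 * pi / h) = h / pi / 128 :> R.
  exact: aux2.
by rewrite rE in rp; lra.
Qed.

(** Halfway between two sampling points [qchar] is real and negative, so that
    the denominator of the kernel is the larger. *)
Lemma kern_half (n : int) y :
  cmod (kern h 1 ((n%:~R * h + h / 2) +i* y)) <= 1 /\
  derivable (kern h 1) ((n%:~R * h + h / 2) +i* y) 1.
Proof.
set z := _ +i* _; pose E := expR (2 * pi / h * y).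
have E0 : 0 < E := expR_gt0 _.
have qE : qchar h 1 z = - E%:C.
  have -> : z = (h / 2) +i* y + (n%:~R * h)%:C by apply: complex_eq => /=; ring.
  rewrite qchar_shiftn//; last exact: sign_pos.
  rewrite /qchar /echar.
  have -> : (0 +i* - (2 * pi * (1 / h))) * ((h / 2) +i* y) =
      (2 * pi / h * y)%:C + (0 +i* - pi) :> R[i].
    by apply: complex_eq; rewrite ?ReM ?ImM /=; field; rewrite gt_eqF.
  rewrite cexpD cexp_imag /cexp /= expi0 mulr1 -/E.
  suff -> : expi (- pi) = -1 :> R[i] by rewrite mulrN1.
  by rewrite /expi cosN sinN cospi sinpi oppr0; apply: complex_eq => //=; rewrite oppr0.
have q1 : 1 - qchar h 1 z = (1 + E)%:C.
  by rewrite qE opprK rmorphD.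
split; last first.
  apply: derivable_kern => //; apply/eqP => e; move: q1; rewrite e subrr.
  by move=> /(congr1 (@complex.Re R)) /=; lra.
rewrite /kern q1 qE cmodM cmodV cmodN !cmod_real gtr0_norm//.
by rewrite gtr0_norm ?addr_gt0// ler_pdivrMr ?addr_gt0// mul1r lerDr.
Qed.

Lemma fkern_hcont x1 x2 y : y = b \/ y = - b ->
  hcont (fun z => f z * kern h 1 z) x1 x2 y.
Proof.
move=> yb; have b0' := b0; have ba' := ba.
have yn : y != 0 by case: yb => ->; lra.
have dA z : [set z : R[i] | complex.Im z = y] z ->
    derivable (fun z => f z * kern h 1 z) z 1.
  move=> /= zy; apply: derivableM.
    by apply: df; rewrite zy; case: yb => ->; rewrite ltr_norml; apply/andP; split; lra.
  apply: derivable_kern => //; apply: qchar_neq1_depth => //.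
  by rewrite /depth zy mul1r oppr_eq0.
apply: (within_continuous_comp (derivable_within dA)) => //.
exact: hline_continuous.
Qed.

Lemma fkern_cells_right (N : nat) :
  rint (fun z => f z * kern h 1 z) (- (h / 2)) (N%:R * h - h / 2) (- b) b =
  h%:C * \sum_(k < N) f (k%:R * h)%:C.
Proof.
have h0' := h0; elim: N => [|N IH].
  by rewrite big_ord0 mulr0 mul0r sub0r rint_degenerate.
rewrite big_ord_recr /= mulrDr -IH -[RHS]/(_ + h%:C * f (N%:~R * h)%:C).
rewrite -fkern_cell.
have -> : N.+1%:R * h - h / 2 = N%:~R * h + h / 2.
  by rewrite -natr1 -pmulrn; field.
apply: rint_splitx; [|by lra|by apply: fkern_hcont; right|by apply: fkern_hcont; left].
have : 0 <= N%:R * h by rewrite mulr_ge0// ltW.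
by lra.
Qed.

Lemma fkern_cells_left (M : nat) :
  rint (fun z => f z * kern h 1 z) (- (M%:R * h) - h / 2) (- (h / 2)) (- b) b =
  h%:C * \sum_(k < M) f ((- k.+1%:Z)%:~R * h)%:C.
Proof.
have h0' := h0; elim: M => [|M IH].
  by rewrite big_ord0 mulr0 mul0r oppr0 sub0r rint_degenerate.
rewrite big_ord_recr /= mulrDr -IH -fkern_cell [RHS]addrC.
have nE : (- M.+1%:Z)%:~R = - M.+1%:R :> R by rewrite mulrNz -pmulrn.
have -> : - (M.+1%:R * h) - h / 2 = (- M.+1%:Z)%:~R * h - h / 2.
  by rewrite nE mulNr.
have -> : - (M%:R * h) - h / 2 = (- M.+1%:Z)%:~R * h + h / 2.
  by rewrite nE -natr1; field.
have M0 : 0 <= M%:R * h by rewrite mulr_ge0// ltW.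
apply: rint_splitx; [by lra| |by apply: fkern_hcont; right|by apply: fkern_hcont; left].
by rewrite nE -natr1; lra.
Qed.

End Cells.

(** * Poisson summation *)

Section Poisson.
Context {R : realType}.
Local Notation mu := (@lebesgue_measure R).
Implicit Types (G : R[i] -> R[i]) (p z : R[i]).
Variables (f : R[i] -> R[i]) (S : seq R[i]) (a0 a r0 : R).
Hypothesis ps : pole_strip f S a0 a r0.
Hypothesis fex : fourier_exists (fun x : R => f x%:C).
Variable ord : R[i] -> nat.
Hypothesis polar : forall p, p \in S -> exists2 M : R, 0 <= M &
  forall w, square p r0 w -> w != p -> cmod (f w) <= M / cmod (w - p) ^+ ord p.
Variable h : R.
Hypothesis h0 : 0 < h.

Local Notation F := (fourier (fun x : R => f x%:C)).
Local Notation L sg G := (Lhalf f S a0 r0 sg G).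

(** [Lhalf] is a limit of integrals along the line at depth [a / 2]. *)
Lemma Lhalf_ext sg C1 C2 G1 G2 : sg = 1 \/ sg = -1 ->
  hol_half sg (a / 2) C1 G1 -> hol_half sg (a / 2) C2 G2 ->
  (forall z, a / 2 <= depth sg z -> G1 z = G2 z) -> L sg G1 = L sg G2.
Proof.
move=> sgP h1 h2 e; have a2 : 0 <= a / 2 <= a / 2.
  by rewrite lexx divr_ge0// ltW// (ps_a ps).
apply: lim2_unique (half_shift ps sgP a2 h1) _.
apply: lim2_eq (half_shift ps sgP a2 h2) => X1 X2 _ _.
by apply: eq_sint => x _; rewrite e// depth_line.
Qed.

(** Each step of the geometric series splits off one value of the
    transform. *)
Lemma fourier_sum_tail sg N : sg = 1 \/ sg = -1 ->
  L sg (kern h sg) = \sum_(k < N) F (sg * (k.+1%:R / h)) +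
    L sg (fun z => qchar h sg z ^+ N * kern h sg z).
Proof.
move=> sgP; have a20 : 0 < a / 2 by rewrite divr_gt0// (ps_a ps).
have hq n := @hol_half_qkern R h h0 sg (a / 2) n a20.
have q1 z : a / 2 <= depth sg z -> qchar h sg z != 1.
  by move=> zd; apply: qchar_neq1_depth => //; rewrite gt_eqF// (lt_le_trans a20).
elim: N => [|N ->].
  rewrite big_ord0 add0r; have h1 := hq 0%N.
  have h2 := @hol_half_kern R h h0 sg (a / 2) a20.
  by apply: (Lhalf_ext sgP h2 h1) => z _; rewrite expr0 mul1r.
rewrite big_ord_recr /= -addrA; congr (_ + _).
have N0 : 0 <= N.+1%:R / h by rewrite divr_ge0// ltW.
rewrite (fourier_Lhalf ps fex sgP N0).
have he := hol_halfW (ltW a20) (@hol_half_echar R sg _ N0).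
rewrite -(LhalfD ps sgP he (hq N.+1)).
apply: (Lhalf_ext sgP (hq N) (hol_halfD he (hq N.+1))) => z zd.
rewrite (kern_step N (q1 z zd)); congr (_ + _).
by rewrite /qchar echarX mulrCA.
Qed.

Lemma fourier_sum_half sg : sg = 1 \/ sg = -1 -> forall e : R, 0 < e ->
  exists N0 : nat, forall N, (N0 <= N)%N ->
    cmod (\sum_(k < N) F (sg * (k.+1%:R / h)) - L sg (kern h sg)) <= e.
Proof.
move=> sgP e e0; have a20 : 0 < a / 2 by rewrite divr_gt0// (ps_a ps).
have [D D0 HD] := Lhalf_bound ps sgP polar.
set rho := expR (- (2 * pi / h * (a / 2))).
have rho1 : rho < 1.
  by rewrite expR_lt1 oppr_lt0 !mulr_gt0 ?invr_gt0 ?pi_gt0// (ps_a ps).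
have rho0 : 0 < rho by exact: expR_gt0.
pose E := (1 - rho)^-1 * D.
have E0 : 0 <= E by rewrite mulr_ge0// invr_ge0 subr_ge0 ltW.
have : rho ^+ n @[n --> \oo] --> (0 : R) by apply: cvg_expr; rewrite gtr0_norm.
have eE : 0 < e / (E + 1) by rewrite divr_gt0// ltr_wpDl.
move=> /cvgrPdist_le/(_ _ eE)[N0 _ HN]; exists N0 => N N0N.
rewrite (fourier_sum_tail N sgP) opprD addNKr cmodN.
apply: (le_trans (HD _ _ (hol_half_qkern h0 N a20))).
rewrite -/rho -mulrA -/E; have := HN N N0N.
rewrite sub0r normrN ger0_norm ?exprn_ge0 ?(ltW rho0)// ler_pdivlMr ?ltr_wpDl//.
by apply: le_trans; rewrite ler_wpM2l ?exprn_ge0 ?(ltW rho0)// lerDl.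
Qed.

Let b := a / 2.
Lemma half_a_gt0 : 0 < b. Proof. by rewrite divr_gt0// (ps_a ps). Qed.
Lemma half_a_lt : b < a. Proof. by rewrite ltr_pdivrMr// ltr_pMr ?ltr1n// (ps_a ps). Qed.

Lemma strip_derivable z : `|complex.Im z| < a -> derivable f z 1.
Proof.
move=> za; apply: (ps_hol ps); first exact: lt_trans za (ps_aa0 ps).
by apply/negP => /(ps_S ps) /andP[]; rewrite leNgt za.
Qed.

(** What the samples of [f] should add up to: the sum of all F (n / h). *)
Let transform_sum := L 1 (kern h 1) + (L (-1) (kern h (-1)) + F 0).

Lemma poisson_rint (M N : nat) :
  let X1 := - (M%:R * h) - h / 2 in let X2 := N%:R * h - h / 2 in
  h%:C * (\sum_(k < N) f (k%:R * h)%:C +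
          \sum_(k < M) f ((- k.+1%:Z)%:~R * h)%:C) =
  rint (fun z => f z * kern h 1 z) X1 X2 (- b) b.
Proof.
move=> X1 X2; have h0' := h0.
rewrite mulrDr -(fkern_cells_right h0 strip_derivable half_a_gt0 half_a_lt).
rewrite -(fkern_cells_left h0 strip_derivable half_a_gt0 half_a_lt) addrC.
have M0 : 0 <= M%:R * h by rewrite mulr_ge0// ltW.
have N0 : 0 <= N%:R * h by rewrite mulr_ge0// ltW.
apply/esym/rint_splitx.
- by rewrite /X1; lra.
- by rewrite /X2; lra.
- by apply: (fkern_hcont h0 strip_derivable half_a_gt0 half_a_lt); right.
- by apply: (fkern_hcont h0 strip_derivable half_a_gt0 half_a_lt); left.
Qed.

(** The vertical sides are placed halfway between sampling points, where the
    kernel is bounded by 1. *)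
Lemma kern_vertical (n : int) (e : R) X : X = n%:~R * h + h / 2 ->
  (forall p, p \in S -> complex.Re p != X) ->
  \int[mu]_(eta in `[- a0, a0]) cmod (f (X +i* eta)) <= e ->
  cmod (sint (- b) b (fun y => f (X +i* y) * kern h 1 (X +i* y))) <= e.
Proof.
move=> XE XS Ve; have pb := half_a_gt0; have pba := half_a_lt; have paa := ps_aa0 ps.
have h1 : - a0 <= - b by lra.
have h2 : - b <= b by lra.
have h3 : b <= a0 by lra.
have ck : vcont (kern h 1) X (- b) b.
  have dk z : [set z : R[i] | complex.Re z = X] z -> derivable (kern h 1) z 1.
    by case: z => x y /= ->; rewrite XE; exact: (proj2 (kern_half h0 n y)).
  by apply: (within_continuous_comp (derivable_within dk)) => //; exact: vline_continuous.
have := vert_le ps ler01 h1 h2 h3 XS ck.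
rewrite mul1r => H; apply: le_trans Ve; apply: H => y _.
by rewrite XE; exact: (proj1 (kern_half h0 n y)).
Qed.

(** The contour integral of [f * kern] around the strip |Im z| < a/2 is [h]
    times the sum of the samples. Its lower side tends to [Lhalf] of the kernel.
    On the upper side, traversed backwards, the kernel is -1 minus the kernel of
    opposite sign, which yields F 0 and the other [Lhalf]. *)
Lemma poisson_joint (e : R) : 0 < e -> exists N0 : nat, forall M N : nat,
  (N0 <= M)%N -> (N0 <= N)%N ->
  cmod (h%:C * (\sum_(k < N) f (k%:R * h)%:C +
          \sum_(k < M) f ((- k.+1%:Z)%:~R * h)%:C) - transform_sum) <= e.
Proof.
move=> e0; have e4 : 0 < e / 4 by rewrite divr_gt0.
have pb := half_a_gt0; have pba := half_a_lt; have paa := ps_aa0 ps.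
have b2 : 0 <= b <= a / 2 by rewrite lexx ltW.
have hk sg := @hol_half_kern R h h0 sg b pb.
have l1 := half_shift ps sign_pos b2 (hk 1).
have l2 := half_shift ps sign_neg b2 (hk (-1)).
have he := hol_halfW (ltW pb) (@hol_half_echar R (-1) 0 (lexx 0)).
have l3 := half_shift ps sign_neg b2 he.
rewrite -(fourier_Lhalf ps fex sign_neg (lexx _)) mulr0 in l3; rewrite mulr0 in he.
have e2 : 0 < e / 2 by rewrite divr_gt0.
have [X0 HX0] := lim2D l1 (lim2D l2 l3) e2.
have [Y0 HY0] := vertical_small ps e4.
have h0' := h0.
pose B := (`|X0| + `|Y0|) / h + 2.
have B0 : 0 <= B by rewrite addr_ge0// divr_ge0 ?addr_ge0// ltW.
exists (Num.bound B) => M N NM NN.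
have big (k : nat) : (Num.bound B <= k)%N -> `|X0| + `|Y0| + 2 * h <= k%:R * h.
  move=> Bk; rewrite -ler_pdivrMr// mulrDl mulfK ?gt_eqF//.
  by rewrite (le_trans (ltW (archi_boundP B0)))// ler_nat.
have bM := big _ NM; have bN := big _ NN.
have nX := ler_norm X0; have nY := ler_norm Y0.
have nX0 := normr_ge0 X0; have nY0 := normr_ge0 Y0.
rewrite poisson_rint; set X1 := - (M%:R * h) - h / 2; set X2 := N%:R * h - h / 2.
have [|XS1 V1] := HY0 X1; first by left; rewrite /X1; lra.
have [|XS2 V2] := HY0 X2; first by right; rewrite /X2; lra.
have E1 : X1 = (- M.+1%:Z)%:~R * h + h / 2.
  have -> : (- M.+1%:Z)%:~R = - (M%:R + 1) :> R by rewrite mulrNz -pmulrn natr1.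
  by rewrite /X1; field.
have E2 : X2 = (N%:Z - 1)%:~R * h + h / 2.
  have -> : (N%:Z - 1)%:~R = N%:R - 1 :> R by rewrite rmorphB /= -pmulrn.
  by rewrite /X2; field.
have W1 := kern_vertical E1 XS1 V1; have W2 := kern_vertical E2 XS2 V2.
have := HX0 X1 X2; rewrite -/transform_sum => H.
have {}H := H ltac:(rewrite /X1; lra) ltac:(rewrite /X2; lra).
have hcf y : `|y| < a -> hcont f X1 X2 y.
  move=> ya; have dA z : [set z : R[i] | complex.Im z = y] z -> derivable f z 1.
    by move=> /= zy; apply: strip_derivable; rewrite zy.
  by apply: (within_continuous_comp (derivable_within dA)) => //; exact: hline_continuous.
have cl sg C G : sg = 1 \/ sg = -1 -> hol_half sg b C G ->
    scont X1 X2 (fun x => f (x +i* - (sg * b)) * G (x +i* - (sg * b))).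
  move=> sgP hG; apply: scontM.
    by apply: hcf; rewrite normrN normrM sg_norm// mul1r gtr0_norm.
  by apply: continuous_scont; exact: hline_half sgP _ _ _ _ (lexx b) hG.
have top : sint X1 X2 (fun x => f (x +i* b) * kern h 1 (x +i* b)) =
    - (sint X1 X2 (fun x => f (x +i* - (-1 * b)) * kern h (-1) (x +i* - (-1 * b))) +
       sint X1 X2 (fun x => f (x +i* - (-1 * b)) * echar 0 (x +i* - (-1 * b)))).
  have c1 := cl _ _ _ sign_neg (hk (-1)); have c2 := cl _ _ _ sign_neg he.
  rewrite -(sintD c1 c2) -[RHS]mulN1r -(sintZ (-1) (scontD c1 c2)).
  apply: eq_sint => x _; rewrite mulN1r opprK kernN//; last first.
    by apply: qchar_neq1_depth => //; rewrite /depth /= mul1r oppr_eq0 gt_eqF.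
  by rewrite /echar mulr0 oppr0 mul0r cexp0; ring.
move: H; rewrite mul1r /rint top opprK; move: W1 W2.
set A1 := sint X1 X2 _; set A2 := _ + sint X1 X2 _.
move: (sint _ _ _) (sint _ _ _) => V2' V1' W1 W2 H.
have -> : A1 + A2 + 'i%C * (V2' - V1') - transform_sum = (A1 + A2 - transform_sum) + 'i%C * (V2' - V1').
  by ring.
rewrite (le_trans (cmodD _ _))// cmodM cmod_i mul1r.
have := cmodB V2' V1'; lra.
Qed.

End Poisson.

(** * Convergence and size of the sums *)

Section JointLimit.
Context {R : realType}.
Implicit Types (P Q : nat -> R[i]).

Lemma cauchy_seqC P : (forall e : R, 0 < e -> exists N0 : nat, forall N, (N0 <= N)%N ->
    cmod (P N - P N0) <= e) -> exists s : R[i], P @ \oo --> s.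
Proof.
move=> H.
have real (u : R[i] -> R) : (forall z, `|u z| <= cmod z) ->
    (forall z w, u (z - w) = u z - u w) -> cvg ((u \o P) @ \oo).
  move=> uc uB; apply: cauchy_cvg; apply: cauchy_exP => e e0.
  have e2 : 0 < e / 2 by rewrite divr_gt0.
  have [N0 HN] := H _ e2; exists (u (P N0)); exists N0 => // N /= N0N.
  rewrite -ball_normE /= -uB (le_lt_trans (uc _))// cmod_distC.
  by rewrite (le_lt_trans (HN _ N0N))// ltr_pdivrMr// ltr_pMr// ltr1n.
have /cvg_ex[x xP] := real _ (@Re_le_cmod R) (fun z w => etrans (ReD z (- w))
  (congr1 (fun t => complex.Re z + t) (ReN w))).
have /cvg_ex[y yP] := real _ (@Im_le_cmod R) (fun z w => etrans (ImD z (- w))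
  (congr1 (fun t => complex.Im z + t) (ImN w))).
exists (x +i* y); apply/cvgC_cmod => e e0; have e2 : 0 < e / 2 by rewrite divr_gt0.
have /cvgrPdist_lt/(_ _ e2)[N1 _ H1] := xP.
have /cvgrPdist_lt/(_ _ e2)[N2 _ H2] := yP.
exists (maxn N1 N2) => // N /=; rewrite geq_max => /andP[n1 n2].
rewrite (le_lt_trans (cmod_le_ReIm _))// (splitr e) ltrD//.
  by rewrite ReD ReN /= distrC; exact: H1.
by rewrite ImD ImN /= distrC; exact: H2.
Qed.

(** Fixing one index shows that the other sequence is Cauchy: convergence of
    the joint sums implies that of both halves. *)
Lemma joint_limit P Q T :
  (forall e : R, 0 < e -> exists N0 : nat, forall M N, (N0 <= M)%N -> (N0 <= N)%N ->
     cmod (P N + Q M - T) <= e) ->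
  exists s1 s2 : R[i], [/\ P @ \oo --> s1, Q @ \oo --> s2 & T = s1 + s2].
Proof.
move=> H.
have [|s1 Ps1] := @cauchy_seqC P.
  move=> e e0; have e2 : 0 < e / 2 by rewrite divr_gt0.
  have [N0 HN] := H _ e2; exists N0 => N N0N.
  have -> : P N - P N0 = (P N + Q N0 - T) - (P N0 + Q N0 - T) by ring.
  by rewrite (le_trans (cmodB _ _))// [leRHS]splitr lerD// HN.
have [|s2 Qs2] := @cauchy_seqC Q.
  move=> e e0; have e2 : 0 < e / 2 by rewrite divr_gt0.
  have [N0 HN] := H _ e2; exists N0 => N N0N.
  have -> : Q N - Q N0 = (P N0 + Q N - T) - (P N0 + Q N0 - T) by ring.
  by rewrite (le_trans (cmodB _ _))// [leRHS]splitr lerD// HN.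
exists s1, s2; split => //; apply/eqP; rewrite -subr_eq0 -cmod_eq0.
rewrite eq_le cmod_ge0 andbT; apply/ler_addgt0Pl => e e0; rewrite addr0.
have e3 : 0 < e / 3 by rewrite divr_gt0.
have [N0 HN] := H _ e3.
have /cvgC_cmod/(_ _ e3)[N1 _ H1] := Ps1; have /cvgC_cmod/(_ _ e3)[N2 _ H2] := Qs2.
pose N := maxn N0 (maxn N1 N2).
have n0 : (N0 <= N)%N by rewrite leq_maxl.
have n1 : (N1 <= N)%N by rewrite /N !leq_max leqnn orbT.
have n2 : (N2 <= N)%N by rewrite /N !leq_max leqnn !orbT.
have -> : T - (s1 + s2) = (P N - s1) + (Q N - s2) - (P N + Q N - T) by ring.
have := H1 N n1; have := H2 N n2; have := HN N N n0 n0.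
have := cmodB ((P N - s1) + (Q N - s2)) (P N + Q N - T).
have := cmodD (P N - s1) (Q N - s2); rewrite /=; lra.
Qed.

End JointLimit.

Section NonzeroIntegers.
Context {R : realType}.
Implicit Types (g : int -> R).

Definition nz_ints (N : nat) : seq int :=
  [seq k.+1%:Z | k <- iota 0 N] ++ [seq - k.+1%:Z | k <- iota 0 N].

Lemma nz_ints_sum g N : \sum_(n <- nz_ints N) g n =
  \sum_(k < N) g k.+1%:Z + \sum_(k < N) g (- k.+1%:Z).
Proof.
have E (u : nat -> R) : \sum_(k <- iota 0 N) u k = \sum_(k < N) u k.
  by rewrite -(big_mkord xpredT u) /index_iota subn0.
by rewrite big_cat !big_map (E (fun k => g k.+1%:Z)) (E (fun k => g (- k.+1%:Z))).
Qed.

Lemma nz_ints_uniq N : uniq (nz_ints N).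
Proof.
rewrite cat_uniq !map_inj_uniq ?iota_uniq//= ?andbT.
- by apply/hasPn => _ /mapP[k _ ->]; apply/negP => /mapP[l _]; lia.
- by move=> k l; lia.
- by move=> k l; lia.
Qed.

Lemma nz_ints_mem N (n : int) : (n \in nz_ints N) = (n != 0) && (`|n| <= N)%N.
Proof.
apply/idP/andP => [|[n0 nN]].
  by rewrite mem_cat => /orP[] /mapP[k]; rewrite mem_iota => kN ->; lia.
rewrite mem_cat; apply/orP; case: n n0 nN => [[|k]|k] //= _ nN.
  by left; apply/mapP; exists k => //; rewrite mem_iota; lia.
by right; apply/mapP; exists k; rewrite ?NegzE// mem_iota; lia.
Qed.

Lemma esum_nz_ge g N : (forall n, 0 <= g n) ->
  ((\sum_(k < N) g k.+1%:Z + \sum_(k < N) g (- k.+1%:Z))%:E <=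
   \esum_(n in [set n : int | n != 0%R]) (g n)%:E)%E.
Proof.
move=> g0; apply: esum_ge; exists [set` nz_ints N].
  split; first exact: finite_seq.
  by move=> n /=; rewrite nz_ints_mem => /andP[].
by rewrite -fsbig_seq ?nz_ints_uniq// sumEFin nz_ints_sum.
Qed.

Lemma esum_nz_le g (C : R) : (forall n, 0 <= g n) ->
  (forall N, \sum_(k < N) g k.+1%:Z + \sum_(k < N) g (- k.+1%:Z) <= C) ->
  (\esum_(n in [set n : int | n != 0%R]) (g n)%:E <= C%:E)%E.
Proof.
move=> g0 gC; apply: ge_ereal_sup => _ [X [finX Xsub] <-].
have /finite_seqP[s sX] := finX.
pose N := \max_(n <- s) `|n|%N.
apply: (@le_trans _ _ (\sum_(n \in [set` nz_ints N]) (g n)%:E)%E); last first.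
  by rewrite -fsbig_seq ?nz_ints_uniq// sumEFin nz_ints_sum lee_fin gC.
apply: lee_fsum_nneg_subset => //; first exact: finite_seq.
  move=> n /set_mem Xn; apply/mem_set; rewrite /= nz_ints_mem.
  have := Xsub _ Xn; rewrite /= => ->; move: Xn; rewrite sX /= => ns.
  exact: (@leq_bigmax_seq _ s xpredT (fun n : int => `|n|%N) n ns isT).
by move=> n _; rewrite lee_fin.
Qed.

End NonzeroIntegers.

Section PowerGeometric.
Context {R : realType}.
Implicit Types (q x y : R).

Lemma exprS_sub_le x y p : 0 <= y -> y <= x -> x - y = 1 ->
  x ^+ p.+1 - y ^+ p.+1 <= p.+1%:R * x ^+ p.
Proof.
move=> y0 yx xy; have x0 := le_trans y0 yx.
elim: p => [|p IH]; first by rewrite !expr1 expr0 mulr1 xy.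
have -> : x ^+ p.+2 - y ^+ p.+2 = x * (x ^+ p.+1 - y ^+ p.+1) + (x - y) * y ^+ p.+1.
  by rewrite !exprS; ring.
rewrite xy mul1r -[p.+2%:R]natr1 mulrDl mul1r lerD//; last by rewrite lerXn2r// nnegrE.
by rewrite (le_trans (ler_wpM2l x0 IH))// mulrCA -exprS.
Qed.

(** Abel summation: multiplying by [1 - q] lowers the power of [k + 1] by
    one, at the cost of the factor [p + 1]. *)
Lemma sum_expn_geometric q p N : 0 <= q < 1 ->
  \sum_(k < N) k.+1%:R ^+ p * q ^+ k <= p`!%:R / (1 - q) ^+ p.+1.
Proof.
move=> /andP[q0 q1]; have q2 : 0 < 1 - q by rewrite subr_gt0.
rewrite ler_pdivlMr ?exprn_gt0//.
elim: p => [|p IH].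
  under eq_bigr do rewrite expr0 mul1r.
  rewrite expr1 fact0 (_ : _ * _ = 1 - q ^+ N); last first.
    elim: N => [|N IH]; first by rewrite big_ord0 mul0r expr0 subrr.
    by rewrite big_ord_recr /= mulrDl IH exprSr; ring.
  by rewrite lerBlDr lerDl exprn_ge0.
have step : (1 - q) * \sum_(k < N) k.+1%:R ^+ p.+1 * q ^+ k + N%:R ^+ p.+1 * q ^+ N
    <= p.+1%:R * \sum_(k < N) k.+1%:R ^+ p * q ^+ k.
  clear IH; elim: N => [|N IH].
    by rewrite !big_ord0 !mulr0 expr0n /= mul0r addr0.
  rewrite !big_ord_recr /= !mulrDr.
  apply: le_trans (lerD IH (lexx _)).
  rewrite -!addrA lerD2l.
  have := @exprS_sub_le N.+1%:R N%:R p (ler0n _ _) _ _.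
  rewrite ler_nat leqnSn -natr1 addrAC subrr add0r => /(_ isT erefl) H.
  have := ler_wpM2r (exprn_ge0 N q0) H; rewrite mulrBl [q ^+ N.+1]exprSr.
  move: ((_ + 1) ^+ p.+1) (N%:R ^+ p.+1) (q ^+ N) ((_ + 1) ^+ p) => u v w t; lra.
have Nq : 0 <= N%:R ^+ p.+1 * q ^+ N by rewrite mulr_ge0// exprn_ge0.
rewrite exprS mulrA [_ * (1 - q)]mulrC.
apply: (@le_trans _ _ (p.+1%:R * (\sum_(k < N) k.+1%:R ^+ p * q ^+ k) * (1 - q) ^+ p.+1)).
  by rewrite ler_wpM2r ?exprn_ge0 ?(ltW q2)//; lra.
by rewrite -mulrA factS natrM ler_wpM2l.
Qed.

Lemma one_sub_expR_ge (u : R) : 0 < u -> (1 - expR (- u))^-1 <= 1 + u^-1.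
Proof.
move=> u0; have e0 := expR_gt0 u; have h := expR_ge1Dx u.
have e1 : expR (- u) <= (1 + u)^-1 by rewrite expRN lef_pV2 ?posrE// addr_gt0.
have -> : 1 + u^-1 = (u / (1 + u))^-1.
  by rewrite invf_div; field; rewrite gt_eqF.
have -> : u / (1 + u) = 1 - (1 + u)^-1 by field; rewrite gt_eqF// addr_gt0.
rewrite lef_pV2 ?posrE ?subr_gt0 ?lerD2l ?lerN2//.
  by rewrite expR_lt1 oppr_lt0.
by rewrite invf_lt1 ?addr_gt0// ltrDl.
Qed.

(** With q = e^(-c/h) the constant 1 of the weight contributes the geometric
    series, and the power at most p! h^-p q / (1 - q)^(p+1), where 1/(1 - q) is at
    most 1 + h/c. The maximum on the right distinguishes h <= 1, where h/c is at
    most 1/c, from h > 1, where (1 + h/c)^(p+1) is of order h^(p+1). *)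
Lemma weighted_sum_le (B c h : R) (p N : nat) : 0 <= B -> 0 < c -> 0 < h ->
  \sum_(k < N) B * ((k.+1%:R / h) ^+ p + 1) * expR (- (c * (k.+1%:R / h))) <=
  B / (expR (c / h) - 1) +
  B * p`!%:R * (1 + c^-1) ^+ p.+1 * Num.max (1 / h ^+ p) h * expR (- (c / h)).
Proof.
move=> B0 c0 h0; set q := expR (- (c / h)).
have ch : 0 < c / h by rewrite divr_gt0.
have q0 : 0 < q := expR_gt0 _.
have q1 : q < 1 by rewrite expR_lt1 oppr_lt0.
have q01 : 0 <= q < 1 by rewrite ltW.
have term (k : nat) : B * ((k.+1%:R / h) ^+ p + 1) * expR (- (c * (k.+1%:R / h))) =
    B * q / h ^+ p * (k.+1%:R ^+ p * q ^+ k) + B * q * q ^+ k.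
  have -> : - (c * (k.+1%:R / h)) = k.+1%:R * - (c / h) by ring.
  by rewrite expRM_natl -/q exprS expr_div_n; ring.
under eq_bigr do rewrite term.
rewrite big_split /= -!mulr_sumr addrC lerD//.
  have -> : B / (expR (c / h) - 1) = B * q * (1 - q)^-1.
    have n1 : expR (c / h) - 1 != 0 by rewrite gt_eqF// subr_gt0 expR_gt1.
    have n2 : expR (c / h) != 0 by rewrite gt_eqF// expR_gt0.
    by rewrite /q expRN; field; rewrite n1 n2.
  rewrite ler_wpM2l ?mulr_ge0 ?(ltW q0)//.
  have := sum_expn_geometric 0 N q01; rewrite fact0 expr1 mul1r.
  by under eq_bigr do rewrite expr0 mul1r.
have hp : 0 < h ^+ p by rewrite exprn_gt0.
apply: (@le_trans _ _ (B * q / h ^+ p * (p`!%:R * (1 + h / c) ^+ p.+1))).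
  apply: ler_wpM2l; first by rewrite !mulr_ge0 ?invr_ge0 ?(ltW q0) ?(ltW hp).
  apply: (le_trans (sum_expn_geometric p N q01)); rewrite ler_wpM2l//.
  rewrite -exprVn lerXn2r ?nnegrE ?invr_ge0 ?subr_ge0 ?(ltW q1)//.
    by rewrite addr_ge0// divr_ge0// ltW.
  by have := one_sub_expR_ge ch; rewrite invf_div.
have -> : B * q / h ^+ p * (p`!%:R * (1 + h / c) ^+ p.+1) =
    B * p`!%:R * q * ((1 + h / c) ^+ p.+1 / h ^+ p) by ring.
have -> : B * p`!%:R * (1 + c^-1) ^+ p.+1 * Num.max (1 / h ^+ p) h * q =
    B * p`!%:R * q * ((1 + c^-1) ^+ p.+1 * Num.max (1 / h ^+ p) h) by ring.
apply: ler_wpM2l; first by rewrite !mulr_ge0 ?(ltW q0).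
have c1 : 0 <= 1 + c^-1 by rewrite addr_ge0// invr_ge0 ltW.
have hc : 0 <= 1 + h / c by rewrite addr_ge0// divr_ge0// ltW.
have [h1|h1] := leP h 1.
  apply: (@le_trans _ _ ((1 + c^-1) ^+ p.+1 * (1 / h ^+ p))).
    rewrite mul1r ler_wpM2r ?invr_ge0 ?(ltW hp)// lerXn2r// lerD2l.
    by rewrite -[leRHS]mul1r ler_wpM2r// invr_ge0 ltW.
  by rewrite ler_wpM2l ?exprn_ge0// le_max lexx.
apply: (@le_trans _ _ ((1 + c^-1) ^+ p.+1 * h)).
  rewrite ler_pdivrMr// -mulrA -exprS -exprMn lerXn2r ?nnegrE//.
    by rewrite mulr_ge0// ltW.
  by rewrite mulrDl mul1r [c^-1 * h]mulrC lerD2r ltW.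
by rewrite ler_wpM2l ?exprn_ge0// le_max lexx orbT.
Qed.

End PowerGeometric.

(** * Holomorphic extension from a decaying transform *)

Section ExpDecay.
Context {R : realType}.
Local Notation mu := (@lebesgue_measure R).

Lemma continuous_expR_norm (c : R) : continuous (fun x : R => expR (- (c * `|x|))).
Proof.
move=> x; apply: (@continuous_comp _ _ _ (fun x => - (c * `|x|)) (@expR R)).
  apply: cvgN; apply: cvgM; first exact: cvg_cst.
  exact: norm_continuous.
exact: continuous_expR.
Qed.

Lemma integrable_expR_norm (c : R) : 0 < c ->
  mu.-integrable setT (EFin \o (fun x => expR (- (c * `|x|)))).
Proof.
move=> c0; apply/integrableP; split.
  apply/measurable_EFinP; exact: continuous_measurable_fun (@continuous_expR_norm c).
under eq_integral => x _ do rewrite /= (ger0_norm (expR_ge0 _)).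
rewrite ge0_symfun_integralT; last 3 first.
- by move=> x; exact: expR_ge0.
- exact: continuous_expR_norm.
- by move=> x /=; rewrite normrN.
rewrite -set_itvcy lte_mul_pinfty//.
have mI : measurable (`[0%R, +oo[ : set (measurableTypeR R)) by [].
have ii := integrableS measurableT mI (@subsetT _ _)
  (integrable_exponential_pdf c0).
have /integrableP[_] := integrableZl mI c^-1 ii.
apply: le_lt_trans.
rewrite le_eqVlt; apply/orP; left; apply/eqP.
apply: eq_integral => x /set_mem; rewrite /= in_itv /= andbT => x0.
rewrite exponential_pdfE// mulKf ?gt_eqF// !ger0_norm ?expR_ge0//.
by rewrite mulNr.
Qed.

(** Half of the exponential absorbs the power, since y^k <= k! e^y. *)
Lemma expn_expR_le (c x : R) k : 0 < c -> 0 <= x ->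
  x ^+ k * expR (- (c * x)) <= k`!%:R * (2 / c) ^+ k * expR (- (c / 2 * x)).
Proof.
move=> c0 x0; have cx0 : 0 <= c / 2 * x by rewrite mulr_ge0// ltW// divr_gt0.
have -> : - (c * x) = - (c / 2 * x) + - (c / 2 * x) by field.
rewrite expRD mulrA ler_wpM2r ?expR_ge0// expRN ler_pdivrMr ?expR_gt0//.
have k0 : 0 < (k`!%:R : R) by rewrite ltr0n fact_gt0.
have h : (c / 2 * x) ^+ k <= k`!%:R * expR (c / 2 * x).
  case: k k0 => [|k] k0; first by rewrite expr0 fact0 mul1r (le_trans _ (expR_ge1Dx _))// lerDl.
  rewrite -ler_pdivrMl// mulrC.
  by apply: le_trans (expR_ge1Dxn k cx0); rewrite lerDr.
have -> : x ^+ k = (2 / c) ^+ k * (c / 2 * x) ^+ k.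
  by rewrite -exprMn; congr (_ ^+ _); field; rewrite gt_eqF.
rewrite (mulrC k`!%:R) -[leRHS]mulrA ler_wpM2l// exprn_ge0// divr_ge0//; exact: ltW.
Qed.

Lemma continuous_normX k : continuous (fun x : R => `|x| ^+ k).
Proof.
move=> x; elim: k => [|k IH]; first by under eq_fun do rewrite expr0; exact: cvg_cst.
by under eq_fun do rewrite exprS; apply: cvgM => //; exact: norm_continuous.
Qed.

Lemma integrable_expn_expR (c : R) k : 0 < c ->
  mu.-integrable setT (EFin \o (fun x => `|x| ^+ k * expR (- (c * `|x|)))).
Proof.
move=> c0; have c2 : 0 < c / 2 by rewrite divr_gt0.
have := integrableZl measurableT (k`!%:R * (2 / c) ^+ k) (integrable_expR_norm c2).
apply: le_integrable => //.
- have cr : continuous (fun x : R => `|x| ^+ k * expR (- (c * `|x|))).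
    move=> x; apply: cvgM; last exact: (@continuous_expR_norm c).
    exact: continuous_normX.
  by apply/measurable_EFinP; exact: (continuous_measurable_fun cr).
- move=> x _; rewrite lee_fin [leLHS]ger0_norm; last first.
    by rewrite mulr_ge0 ?exprn_ge0 ?expR_ge0.
  by rewrite (le_trans (expn_expR_le _ c0 (normr_ge0 x)))// ler_norm.
Qed.

End ExpDecay.

Section Holomorphic.
Context {R : realType}.
Local Notation mu := (@lebesgue_measure R).

(** At x = 0 the integrand of the inversion formula is the transform
    itself. *)
Lemma fourier_inversion_measurable (f : R -> R[i]) : fourier_inversion f ->
  measurable_fun setT (fun xi : measurableTypeR R => complex.Re (fourier f xi)) /\
  measurable_fun setT (fun xi : measurableTypeR R => complex.Im (fourier f xi)).
Proof.
move=> /(_ 0)[[i1 i2] _]; move: i1 i2.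
under eq_fun do rewrite !mulr0 mul0r expi0 mulr1.
move=> /integrableP[/measurable_EFinP m1 _].
under eq_fun do rewrite !mulr0 mul0r expi0 mulr1.
by move=> /integrableP[/measurable_EFinP m2 _].
Qed.

(** The integrable majorant that is left when a factor growing like
    |xi|^k e^(b |xi|) uses up part of the decay of the transform. *)
Definition expdom (p k : nat) (c xi : R) : R :=
  `|xi| ^+ (p + k) * expR (- (c * `|xi|)) + `|xi| ^+ k * expR (- (c * `|xi|)).

Lemma expdomE p k c xi : expdom p k c xi =
  (`|xi| ^+ p + 1) * `|xi| ^+ k * expR (- (c * `|xi|)).
Proof. by rewrite /expdom exprD; ring. Qed.

Lemma integrable_expdom p k c : 0 < c ->
  mu.-integrable setT (EFin \o expdom p k c).
Proof.
move=> c0.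
exact: (integrableD measurableT (@integrable_expn_expR R c (p + k) c0)
  (@integrable_expn_expR R c k c0)).
Qed.

Variables (F : R -> R[i]) (K a : R) (p : nat).
Hypothesis mRe : measurable_fun setT (fun xi : measurableTypeR R => complex.Re (F xi)).
Hypothesis mIm : measurable_fun setT (fun xi : measurableTypeR R => complex.Im (F xi)).
Hypothesis K0 : 0 <= K.
Hypothesis Fdecay : forall xi,
  cmod (F xi) <= K * (`|xi| ^+ p + 1) * expR (- (2 * pi * a * `|xi|)).

(** The decay rate 2 pi a pays for the growth rate [b] of [E] and leaves a
    rate [c > 0]. *)
Lemma decay_mul (E : R -> R[i]) M b c k : continuous E ->
  0 <= M -> 0 < c -> c + b = 2 * pi * a ->
  (forall xi, cmod (E xi) <= M * `|xi| ^+ k * expR (b * `|xi|)) ->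
  cint_on setT (fun xi => F xi * E xi) /\
  cmod (Cint setT (fun xi => F xi * E xi)) <=
    K * M * \int[mu]_xi (expdom p k c xi).
Proof.
move=> cE M0 c0 cb Eb.
have idom := integrable_expdom p k c0.
have iKM := integrableZl measurableT (K * M) idom.
have bound xi : cmod (F xi * E xi) <= K * M * expdom p k c xi.
  rewrite cmodM.
  apply: (le_trans (ler_pM (cmod_ge0 _) (cmod_ge0 _) (Fdecay xi) (Eb xi))).
  rewrite -cb expdomE mulrDl opprD expRD.
  have -> : expR (- (b * `|xi|)) = (expR (b * `|xi|))^-1 by rewrite expRN.
  have := expR_gt0 (b * `|xi|); move: (expR (b * _)) => e e0.
  by rewrite le_eqVlt; apply/orP; left; apply/eqP; field; rewrite gt_eqF.
have ci : cint_on setT (fun xi => F xi * E xi).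
  have mEr : measurable_fun setT (fun xi : measurableTypeR R => complex.Re (E xi)).
    have cr : continuous (fun x : R => complex.Re (E x)).
      by move=> x; apply: continuous_comp; [exact: cE|exact: Re_continuous].
    exact: continuous_measurable_fun cr.
  have mEi : measurable_fun setT (fun xi : measurableTypeR R => complex.Im (E xi)).
    have cr : continuous (fun x : R => complex.Im (E x)).
      by move=> x; apply: continuous_comp; [exact: cE|exact: Im_continuous].
    exact: continuous_measurable_fun cr.
  apply: (cmod_cint_on measurableT _ _ iKM) => //.
  - under eq_fun do rewrite ReM.
    by apply: measurable_funB; apply: measurable_funM.
  - under eq_fun do rewrite ImM.
    by apply: measurable_funD; apply: measurable_funM.
split => //; apply: (le_trans (cmod_Cint_le measurableT ci)).
rewrite -RintegralZl//; apply: le_Rintegral => //; exact: cint_on_cmod.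
Qed.

(** The character e^(2 pi i xi z). *)
Definition ichar (z : R[i]) (xi : R) : R[i] := cexp ((0 +i* (2 * pi * xi)) * z).

Lemma continuous_imul (c : R) : continuous (fun xi : R => 0 +i* (c * xi)).
Proof.
move=> x; apply: (@continuous_comp _ _ _ (fun xi : R => c * xi) (fun y : R => 0 +i* y)).
  by apply: cvgM; [exact: cvg_cst|exact: cvg_id].
exact: vline_continuous.
Qed.

Lemma continuous_ichar z : continuous (ichar z).
Proof.
rewrite /ichar => x; under eq_fun do rewrite mulrC.
apply: (@continuous_comp _ _ _ (fun xi : R => 0 +i* (2 * pi * xi)) (fun w => cexp (z * w))).
  exact: continuous_imul.
exact: continuous_cexp.
Qed.

Lemma cmod_ichar z xi : cmod (ichar z xi) <= expR (2 * pi * `|complex.Im z| * `|xi|).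
Proof.
rewrite cmod_cexp ReM /= ler_expR mul0r sub0r.
rewrite (le_trans (ler_norm _))// normrN !normrM (ger0_norm (pi_ge0 R)) ger0_norm//.
by rewrite le_eqVlt; apply/orP; left; apply/eqP; ring.
Qed.

Lemma ichar_remainder z w xi d : cmod (w - z) <= d ->
  cmod (ichar w xi - ichar z xi - ((0 +i* (2 * pi * xi)) * (w - z)) * ichar z xi) <=
  16 * pi ^+ 2 * cmod (w - z) ^+ 2 * `|xi| ^+ 2 *
    expR (2 * pi * (`|complex.Im z| + d) * `|xi|).
Proof.
set h := w - z => hd; set u := (0 +i* (2 * pi * xi)) * h.
have -> : ichar w xi - ichar z xi - u * ichar z xi = ichar z xi * (cexp u - 1 - u).
  have -> : w = z + h by rewrite /h; ring.
  by rewrite /ichar mulrDr cexpD -/u; ring.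
have p0 : 0 <= pi :> R := pi_ge0 R.
have cu : cmod u = 2 * pi * `|xi| * cmod h.
  by rewrite cmodM cmod_imag !normrM (ger0_norm p0) (@ger0_norm _ 2).
have h0 := cmod_ge0 h; have x0 := normr_ge0 xi.
rewrite cmodM (le_trans (ler_pM (cmod_ge0 _) (cmod_ge0 _) (cmod_ichar z xi)
  (cexp_taylor1_le u)))//.
have -> : 2 * pi * (`|complex.Im z| + d) * `|xi| =
  2 * pi * `|complex.Im z| * `|xi| + 2 * pi * d * `|xi| by ring.
rewrite expRD mulrC [leRHS]mulrCA [leRHS]mulrC ler_wpM2r ?expR_ge0//.
have -> : 16 * pi ^+ 2 * cmod h ^+ 2 * `|xi| ^+ 2 = 4 * cmod u ^+ 2 by rewrite cu; ring.
rewrite ler_wpM2l ?mulr_ge0 ?exprn_ge0 ?cmod_ge0// ler_expR cu.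
rewrite -!mulrA ler_wpM2l// ler_wpM2l// mulrC ler_wpM2r//.
Qed.

(** The inversion integral at a complex argument. *)
Definition inversion_ext z : R[i] := Cint setT (fun xi => F xi * ichar z xi).

(** Differentiation under the integral sign: with [d] half the distance to
    the edge of the strip, the linear remainder of the character is |w - z|^2
    times a function that the decay of the transform makes integrable, uniformly
    for |w - z| <= d. *)
Lemma derivable_inversion_ext z : `|complex.Im z| < a -> derivable inversion_ext z 1.
Proof.
move=> za; set y := `|complex.Im z| in za.
have y0 : 0 <= y := normr_ge0 _.
have pi0 : 0 < pi :> R := pi_gt0 R.
(* discs of radius d about z stay in the strip, with d to spare *)
pose d := (a - y) / 2; have d0 : 0 < d by rewrite divr_gt0// subr_gt0.
pose c := 2 * pi * d; have c0 : 0 < c by apply: mulr_gt0 => //; apply: mulr_gt0.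
pose b := 2 * pi * (y + d).
have cb : c + b = 2 * pi * a by rewrite /c /b /d; field.
pose L xi := (0 +i* (2 * pi * xi)) : R[i].
have iE w : `|complex.Im w| <= y + d -> cint_on setT (fun xi => F xi * ichar w xi).
  move=> wd; apply: (proj1 (@decay_mul (ichar w) 1 b c 0 _ _ c0 cb _)) => //.
    exact: continuous_ichar.
  move=> xi; rewrite expr0 !mul1r (le_trans (cmod_ichar w xi))// ler_expR.
  by rewrite ler_wpM2r// /b ler_wpM2l// mulr_ge0// ltW.
have iL : cint_on setT (fun xi => F xi * (L xi * ichar z xi)).
  apply: (proj1 (@decay_mul _ (2 * pi) b c 1 _ _ c0 cb _)) => //.
  - move=> xi; apply: cvgM; [exact: continuous_imul|exact: continuous_ichar].
  - by rewrite mulr_ge0// ltW.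
  - move=> xi; rewrite cmodM cmod_imag !normrM (gtr0_norm pi0) (@ger0_norm _ 2)//.
    rewrite expr1 ler_wpM2l ?mulr_ge0 ?pi_ge0// (le_trans (cmod_ichar z xi))//.
    rewrite ler_expR ler_wpM2r// /b ler_wpM2l ?mulr_ge0 ?pi_ge0// -/y.
    by rewrite lerDl ltW.
apply/derivableC_cmod; exists (Cint setT (fun xi => F xi * (L xi * ichar z xi))) => e e0.
pose J := \int[mu]_xi (expdom p 2 c xi).
pose C := K * (16 * pi ^+ 2) * `|J|.
have C0 : 0 <= C by rewrite !mulr_ge0 ?pi_ge0.
exists (Num.min d (e / (C + 1))); first by rewrite lt_min d0 divr_gt0// ltr_wpDl.
move=> w; set h := w - z; rewrite lt_min => /andP[/ltW hd he].
have h0 := cmod_ge0 h.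
have wy : `|complex.Im w| <= y + d.
  have -> : w = z + h by rewrite /h; ring.
  rewrite ImD (le_trans (ler_normD _ _))// lerD2l.
  exact: le_trans (Im_le_cmod h) hd.
have zy : `|complex.Im z| <= y + d by rewrite -/y; lra.
have -> : inversion_ext w - inversion_ext z - Cint setT (fun xi => F xi * (L xi * ichar z xi)) * h =
    Cint setT (fun xi => F xi * (ichar w xi - ichar z xi - (L xi * h) * ichar z xi)).
  rewrite mulrC -CintZ// /inversion_ext -CintB//; [|exact: iE|exact: iE].
  rewrite -CintB//; last 2 first.
  - by apply: cint_onB => //; exact: iE.
  - exact: cint_onZ.
  by apply: eq_Cint => xi _; ring.
have [|||_ bnd] := @decay_mul
    (fun xi => ichar w xi - ichar z xi - (L xi * h) * ichar z xi)
    (16 * pi ^+ 2 * cmod h ^+ 2) b c 2 _ _ c0 cb _.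
- move=> xi; apply: (@cvgB _ R[i]).
    exact: (cvgB (@continuous_ichar w xi) (@continuous_ichar z xi)).
  apply: (cvgM _ (@continuous_ichar z xi)).
  exact: (cvgM (@continuous_imul (2 * pi) xi) (cvg_cst _)).
- by rewrite !mulr_ge0 ?pi_ge0.
- by move=> xi; exact: ichar_remainder.
apply: (le_trans bnd); rewrite -/J.
apply: (@le_trans _ _ (C * cmod h ^+ 2)).
  rewrite /C.
  have -> : K * (16 * pi ^+ 2) * `|J| * cmod h ^+ 2 =
    K * (16 * pi ^+ 2 * cmod h ^+ 2) * `|J| by ring.
  by rewrite ler_wpM2l ?ler_norm// !mulr_ge0 ?pi_ge0.
rewrite expr2 mulrA ler_wpM2r//.
rewrite (le_trans (_ : _ <= (C + 1) * cmod h))//.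
  by rewrite ler_wpM2r// lerDl.
by rewrite mulrC -ler_pdivlMr ?ltr_wpDl// ltW.
Qed.

End Holomorphic.

Theorem fourier_decay_extension {R : realType} (f : R -> R[i]) (a K : R) (p : nat) :
  fourier_inversion f -> 0 <= K ->
  (forall xi, cmod (fourier f xi) <=
    K * (`|xi| ^+ p + 1) * expR (- (2 * pi * a * `|xi|))) ->
  exists g : R[i] -> R[i],
    holomorphic_on (strip a) g /\ (forall x : R, g x%:C = f x).
Proof.
move=> finv K0 Fd; have [mRe mIm] := fourier_inversion_measurable finv.
exists (inversion_ext (fourier f)); split.
  by move=> z; exact: (derivable_inversion_ext mRe mIm K0 Fd).
move=> x; rewrite (proj2 (finv x)); apply: eq_Cint => xi _.
rewrite /ichar -cexp_imag; congr (_ * cexp _).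
by apply: complex_eq; rewrite ?ReM ?ImM /=; ring.
Qed.

(** * Local bounds at the poles *)

Section PoleData.
Context {R : realType}.
Implicit Types (f : R[i] -> R[i]) (p w : R[i]).

Lemma common_radius (T : eqType) (s : seq T) (Q : T -> R -> Prop) :
  (forall t r r', r' <= r -> Q t r -> Q t r') ->
  (forall t, t \in s -> exists2 r, 0 < r & Q t r) ->
  exists2 r, 0 < r & forall t, t \in s -> Q t r.
Proof.
move=> mono; elim: s => [|u s IH] H; first by exists 1.
have [|r1 r10 H1] := IH; first by move=> t ts; apply: H; rewrite inE ts orbT.
have [r2 r20 H2] := H u (mem_head _ _).
exists (Num.min r1 r2); first by rewrite lt_min r10.
move=> t; rewrite inE => /predU1P[->|ts].
  by apply: mono H2; rewrite ge_min lexx orbT.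
by apply: mono (H1 _ ts); rewrite ge_min lexx.
Qed.

(** The numerator is continuous at the pole, hence bounded nearby. *)
Lemma has_pole_bound f p (j : nat) : has_pole f p j ->
  exists2 M : R, 0 <= M & exists2 r : R, 0 < r & forall w, cmod (w - p) < r ->
    w != p -> cmod (f w) <= M / cmod (w - p) ^+ j.
Proof.
move=> [j0 [g [gd _ fg]]].
have gp : {for p, continuous g} := derivable_contC (nbhs_singleton gd).
have /cvgC_cmod/(_ 1 ltr01) gb := gp.
exists (cmod (g p) + 1); first by rewrite addr_ge0 ?cmod_ge0.
have /nbhsC_cmod[r1 r10 H1] := gb; have /nbhsC_cmod[r2 r20 H2] := fg.
exists (Num.min r1 r2); first by rewrite lt_min r10.
move=> w; rewrite lt_min => /andP[/H1 g1 /H2].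
move=> /[swap] wp /(_ wp) ->.
rewrite cmodM cmodV cmodX ler_wpM2r ?invr_ge0 ?exprn_ge0 ?cmod_ge0//.
have -> : g w = g p + (g w - g p) by ring.
by rewrite (le_trans (cmodD _ _))// lerD2l ltW.
Qed.

Lemma square_cmod p r w : square p r w -> cmod (w - p) <= 2 * r.
Proof.
move=> [/andP[w1 w2] /andP[w3 w4]].
rewrite (le_trans (cmod_le_ReIm _))// mulr_natl mulr2n ReD ReN ImD ImN.
by rewrite lerD// ler_norml; apply/andP; split; lra.
Qed.

Lemma pole_strip_of_poles f (a0 a : R) (m : nat) (z : 'I_m -> R[i])
    (j : 'I_m -> nat) :
  0 < a -> a < a0 -> injective z ->
  (forall k, strip a0 (z k)) ->
  (forall k, has_pole f (z k) (j k)) ->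
  holomorphic_on (strip a0 `\` range z) f ->
  {within closed_strip a0 `\` range z, continuous f} ->
  (forall k, a <= `|complex.Im (z k)|) ->
  vertical_mass f a0 x @[x --> +oo] --> 0%E ->
  vertical_mass f a0 x @[x --> -oo] --> 0%E ->
  (horizontal_mass f a0 < +oo)%E ->
  (horizontal_mass f (- a0) < +oo)%E ->
  exists (S : seq R[i]) (ord : R[i] -> nat) (r0 : R),
    [/\ pole_strip f S a0 a r0,
        forall p, p \in S -> exists2 k, p = z k & ord p = j k
      & forall p, p \in S -> exists2 M : R, 0 <= M &
          forall w, square p r0 w -> w != p ->
            cmod (f w) <= M / cmod (w - p) ^+ ord p].
Proof.
move=> a_gt0 aa0 zinj zin zpole hol cont za vp vm hp hm.
pose S := [seq z k | k <- enum 'I_m].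
pose ord p := (\max_(k < m | z k == p) j k)%N.
have SP w : w \in S <-> range z w.
  split=> [/mapP[k _ ->]|[k _ <-]]; first by exists k.
  by apply: map_f; rewrite mem_enum.
have ordE k : ord (z k) = j k.
  by rewrite /ord (big_pred1 k)// => l; rewrite inj_eq.
have Sz p : p \in S -> exists2 k, p = z k & ord p = j k.
  by move=> /mapP[k _ ->]; exists k.
pose Q p r := (forall w, cmod (w - p) < r -> w != p ->
     `|complex.Im w| < a0 /\ w \notin S) /\
  exists2 M : R, 0 <= M & forall w, cmod (w - p) < r -> w != p ->
     cmod (f w) <= M / cmod (w - p) ^+ ord p.
have [|p /Sz[k -> ok]|rho rho0 HQ] := @common_radius _ S Q.
- move=> p r r' rr [H1 [M M0 H2]]; split.
    by move=> w wr; apply: H1; exact: lt_le_trans rr.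
  by exists M => // w wr; apply: H2; exact: lt_le_trans rr.
- have [M M0 [r1 r10 H1]] := has_pole_bound (zpole k).
  have [|q /Sz[l -> _]|r2 r20 H2] := @common_radius _ S
    (fun q r => forall w, cmod (w - z k) < r -> w = q -> w = z k).
  + by move=> q r r' rr H w wr; apply: H; exact: lt_le_trans rr.
  + have [->|kl] := eqVneq (z l) (z k); first by exists 1.
    exists (cmod (z l - z k)); first by rewrite cmod_gt0 subr_eq0.
    by move=> w + we; rewrite we ltxx.
  have r30 : 0 < a0 - `|complex.Im (z k)| by rewrite subr_gt0; exact: zin.
  exists (Num.min r1 (Num.min r2 (a0 - `|complex.Im (z k)|))).
    by rewrite !lt_min r10 r20.
  split.
    move=> w; rewrite !lt_min => /and3P[_ w2 w3] wz; split; last first.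
      by apply: contra_neqN wz => wS; exact: H2 wS _ w2 erefl.
    have -> : w = z k + (w - z k) by ring.
    rewrite ImD (le_lt_trans (ler_normD _ _))//.
    by rewrite -ltrBrDl (le_lt_trans (Im_le_cmod _)).
  exists M => // w; rewrite lt_min => /andP[w1 _] wz.
  by rewrite ok; exact: H1.
(* a square of half-side r0 lies in the disc of radius 2 r0, hence within rho *)
pose r0 := Num.min (rho / 4) (a / 2).
have r00 : 0 < r0 by rewrite lt_min !divr_gt0.
have near_sq p w : square p r0 w -> cmod (w - p) < rho.
  move=> /square_cmod wr; have : r0 <= rho / 4 by rewrite ge_min lexx.
  by lra.
exists S, ord, r0; split => //; last first.
  move=> p /HQ[_ [M M0 HM]]; exists M => // w ws; apply: HM; exact: near_sq.
have holS w : `|complex.Im w| < a0 -> w \notin S -> derivable f w 1.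
  by move=> wa wS; apply: hol; split => // /SP; exact/negP.
split => //.
- by rewrite map_inj_uniq ?enum_uniq.
- by move=> p /Sz[k -> _]; rewrite za; exact: zin.
- by rewrite r00 ge_min lexx orbT.
- move=> p w pS ws wp; have [H _] := HQ _ pS.
  by have [w1 w2] := H w (near_sq _ _ ws) wp; exact: holS.
- have -> : [set w | `|complex.Im w| <= a0 /\ w \notin S] =
      closed_strip a0 `\` range z; last exact: cont.
  apply/seteqP; split => w [w1 w2]; split => //.
    by move=> /SP; exact/negP.
  by apply/negP => /SP.
Qed.

End PoleData.

(** * The trapezoidal rule *)

Lemma bilateral_sum_ord {R : realType} (u : int -> R[i]) (s1 s2 : R[i]) :
  (fun N => \sum_(k < N) u k%:Z) @ \oo --> s1 ->
  (fun N => \sum_(k < N) u (- k.+1%:Z)) @ \oo --> s2 ->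
  is_bilateral_sum u (s1 + s2).
Proof.
move=> u1 u2; exists s1, s2.
have -> : series (fun k : nat => u k%:Z) = (fun N => \sum_(k < N) u k%:Z).
  by apply/funext => N; rewrite /series /= big_mkord.
have -> : series (fun k : nat => u (- k.+1%:Z)) = (fun N => \sum_(k < N) u (- k.+1%:Z)).
  by apply/funext => N; rewrite /series /= big_mkord.
exact: (And3 u1 u2 erefl).
Qed.

Section Assembly.
Context {R : realType}.
Local Notation mu := (@lebesgue_measure R).
Variables (f : R[i] -> R[i]) (S : seq R[i]) (a0 a r0 : R).
Hypothesis ps : pole_strip f S a0 a r0.
Hypothesis fex : fourier_exists (fun x : R => f x%:C).
Variable ord : R[i] -> nat.
Hypothesis polar : forall p, p \in S -> exists2 M : R, 0 <= M &
  forall w, square p r0 w -> w != p -> cmod (f w) <= M / cmod (w - p) ^+ ord p.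

Local Notation F := (fourier (fun x : R => f x%:C)).
Local Notation L sg G := (Lhalf f S a0 r0 sg G).

Lemma fourier_decay (m0 : nat) : (forall p, p \in S -> (0 < ord p)%N) ->
  (forall p, p \in S -> `|complex.Im p| = a -> (ord p <= m0)%N) ->
  exists2 B : R, 0 <= B & forall xi : R,
    cmod (F xi) <= B * (`|xi| ^+ m0.-1 + 1) * expR (- (2 * pi * a * `|xi|)).
Proof.
move=> ord0 ordm.
have [B1 B10 H1] := fourier_decay_half ps fex (or_introl erefl) polar ord0 ordm.
have [B2 B20 H2] := fourier_decay_half ps fex (or_intror erefl) polar ord0 ordm.
exists (B1 + B2); first exact: addr_ge0.
move=> xi; rewrite -mulrA.
have w0 : 0 <= (`|xi| ^+ m0.-1 + 1) * expR (- (2 * pi * a * `|xi|)).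
  by rewrite mulr_ge0 ?expR_ge0// addr_ge0// exprn_ge0.
have [x0|x0] := leP 0 xi.
  have := H1 _ (normr_ge0 xi); rewrite mul1r {1}ger0_norm// => /le_trans; apply.
  by rewrite ler_wpM2r// lerDl.
have := H2 _ (normr_ge0 xi); rewrite mulN1r {1}ltr0_norm// opprK => /le_trans; apply.
by rewrite ler_wpM2r// lerDr.
Qed.

Variable h : R.
Hypothesis h0 : 0 < h.

Lemma fourier0 : F 0 = cintegral (fun x : R => f x%:C).
Proof. by apply: eq_Cint => x _; rewrite mulr0 oppr0 expi0 mulr1. Qed.

(** By [poisson_joint] the trapezoidal sum differs from the integral F 0 by
    the two [Lhalf] of the kernels, which are the sums of the F (n / h) over
    positive and over negative [n]. *)
Lemma trapezoidal_error : exists T : R[i],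
  is_bilateral_sum (fun n : int => f (n%:~R * h)%:C) T /\
  ((cmod (cintegral (fun x : R => f x%:C) - h%:C * T))%:E
     <= \esum_(n in [set n : int | n != 0%R]) (cmod (F (n%:~R / h)))%:E)%E.
Proof.
have hC : h%:C != 0 by rewrite -cmod_gt0 cmod_real gtr0_norm.
pose transform_sum := L 1 (kern h 1) + (L (-1) (kern h (-1)) + F 0).
have joint := poisson_joint ps fex h0; rewrite -/transform_sum in joint.
have [|s1 [s2 [P1 P2 Ts]]] := @joint_limit R (fun N => \sum_(k < N) f (k%:R * h)%:C)
  (fun M => \sum_(k < M) f ((- k.+1%:Z)%:~R * h)%:C) (transform_sum / h%:C).
  move=> e e0; have [N0 HN] := joint _ (mulr_gt0 h0 e0).
  exists N0 => M N NM NN; have := HN M N NM NN.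
  have -> : forall u, h%:C * u - transform_sum = h%:C * (u - transform_sum / h%:C).
    by move=> u; rewrite mulrBr mulrCA mulfV// mulr1.
  by rewrite cmodM cmod_real gtr0_norm// ler_pM2l.
exists (transform_sum / h%:C); split.
  by rewrite Ts; apply: bilateral_sum_ord; [exact: P1|exact: P2].
have -> : cintegral (fun x : R => f x%:C) - h%:C * (transform_sum / h%:C) =
    - (L 1 (kern h 1) + L (-1) (kern h (-1))).
  by rewrite mulrCA mulfV// mulr1 -fourier0 /transform_sum addrA opprD addrCA subrr addr0.
rewrite cmodN; apply/lee_addgt0Pr => e e0.
have e2 : 0 < e / 2 by rewrite divr_gt0.
have [N1 H1] := fourier_sum_half ps fex polar h0 (or_introl erefl) e2.
have [N2 H2] := fourier_sum_half ps fex polar h0 (or_intror erefl) e2.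
pose N := maxn N1 N2.
have {}H1 := H1 N (leq_maxl _ _); have {}H2 := H2 N (leq_maxr _ _).
have tri (u v : R[i]) d : cmod (u - v) <= d -> cmod v <= cmod u + d.
  move=> uv; have -> : v = u - (u - v) by ring.
  by rewrite (le_trans (cmodB _ _))// lerD2l.
have sumc (u : 'I_N -> R[i]) : cmod (\sum_(k < N) u k) <= \sum_(k < N) cmod (u k).
  elim/big_rec2: _ => [|k x y _ H]; first by rewrite cmod0.
  by rewrite (le_trans (cmodD _ _))// lerD2l.
apply: (le_trans _ (leeD2r e%:E (@esum_nz_ge R (fun n => cmod (F (n%:~R / h))) N
  (fun n => cmod_ge0 _)))).
rewrite -EFinD lee_fin (le_trans (cmodD _ _))//.
have S1 : \sum_(k < N) cmod (F (1 * (k.+1%:R / h))) =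
    \sum_(k < N) cmod (F (k.+1%:Z%:~R / h)).
  by apply: eq_bigr => k _; rewrite mul1r.
have S2 : \sum_(k < N) cmod (F (-1 * (k.+1%:R / h))) =
    \sum_(k < N) cmod (F ((- k.+1%:Z)%:~R / h)).
  by apply: eq_bigr => k _; rewrite mulN1r mulrNz mulNr.
rewrite [e]splitr addrACA; apply: lerD.
  by rewrite (le_trans (tri _ _ _ H1))// lerD2r (le_trans (sumc _)) ?S1.
by rewrite (le_trans (tri _ _ _ H2))// lerD2r (le_trans (sumc _)) ?S2.
Qed.

Lemma decay_sum_le (p : nat) (B : R) : 0 <= B ->
  (forall xi : R, cmod (F xi) <=
    B * (`|xi| ^+ p + 1) * expR (- (2 * pi * a * `|xi|))) ->
  (\esum_(n in [set n : int | n != 0%R]) (cmod (F (n%:~R / h)))%:E <=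
   (2 * B / (expR (2 * a * pi / h) - 1)
     + 2 * B * p`!%:R * (1 + (2 * pi * a)^-1) ^+ p.+1 * Num.max (1 / h ^+ p) h
       * expR (- (2 * a * pi / h)))%:E)%E.
Proof.
move=> B0 FB; have c0 : 0 < 2 * pi * a.
  by rewrite !mulr_gt0 ?pi_gt0// (ps_a ps).
apply: (@esum_nz_le R (fun n => cmod (F (n%:~R / h)))) => [n|N].
  exact: cmod_ge0.
have term (n : int) (k : nat) : `|n| = k.+1%:Z -> cmod (F (n%:~R / h)) <=
    B * ((k.+1%:R / h) ^+ p + 1) * expR (- (2 * pi * a * (k.+1%:R / h))).
  move=> nk; apply: (le_trans (FB _)).
  have -> : `|n%:~R / h| = k.+1%:R / h :> R.
    by rewrite normrM normfV (gtr0_norm h0) -intr_norm nk.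
  by [].
have W := @weighted_sum_le R B (2 * pi * a) h p N B0 c0 h0.
have -> : 2 * a * pi / h = 2 * pi * a / h by ring.
have s1 : \sum_(k < N) cmod (F (k.+1%:Z%:~R / h)) <= 
   \sum_(k < N) B * ((k.+1%:R / h) ^+ p + 1) * expR (- (2 * pi * a * (k.+1%:R / h))).
  by apply: ler_sum => k _; apply: term.
have s2 : \sum_(k < N) cmod (F ((- k.+1%:Z)%:~R / h)) <= 
   \sum_(k < N) B * ((k.+1%:R / h) ^+ p + 1) * expR (- (2 * pi * a * (k.+1%:R / h))).
  by apply: ler_sum => k _; apply: term; rewrite normrN.
apply: (le_trans (lerD (le_trans s1 W) (le_trans s2 W))).
by rewrite le_eqVlt; apply/orP; left; apply/eqP; ring.
Qed.

End Assembly.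

Theorem theorem4p3 (R : realType) :
  (forall (f : R[i] -> R[i]) (a0 a : R)
          (m : nat) (z : 'I_m -> R[i]) (j : 'I_m -> nat) (m0 : nat),
    let fR := fun x : R => f x%:C in
    fourier_exists fR ->
    fourier_inversion fR ->
    0 < a -> a < a0 ->
    injective z ->
    (forall k : 'I_m, strip a0 (z k)) ->
    (forall k : 'I_m, has_pole f (z k) (j k)) ->
    holomorphic_on (strip a0 `\` range z) f ->
    {within closed_strip a0 `\` range z, continuous f} ->
    (forall k : 'I_m, a <= `|complex.Im (z k)|) ->
    (exists k : 'I_m, `|complex.Im (z k)| = a) ->
    m0 = (\max_(k < m | (`|complex.Im (z k)| == a)%R) j k)%N ->
    vertical_mass f a0 x @[x --> +oo] --> 0%E ->
    vertical_mass f a0 x @[x --> -oo] --> 0%E ->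
    (horizontal_mass f a0 < +oo)%E ->
    (horizontal_mass f (- a0) < +oo)%E ->
    exists B : R,
      (forall xi : R,
         cmod (fourier fR xi)
         <= B * (`|xi| ^+ m0.-1 + 1) * expR (- (2 * pi * a * `|xi|))) /\
      exists Bt : R, forall h : R, 0 < h ->
        exists S : R[i],
          [/\ is_bilateral_sum (fun n : int => fR (n%:~R * h)) S,
              ((cmod (cintegral fR - h%:C * S))%:E
               <= \esum_(n in [set n : int | n != 0%R])
                    (cmod (fourier fR (n%:~R / h)))%:E)%E
            & (\esum_(n in [set n : int | n != 0%R])
                  (cmod (fourier fR (n%:~R / h)))%:E
               <= (2 * B / (expR (2 * a * pi / h) - 1)
                   + Bt * Num.max (1 / h ^+ m0.-1) h
                       * expR (- (2 * a * pi / h)))%:E)%E])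
  /\
  (forall (f : R -> R[i]) (a B : R) (m0 : nat),
    fourier_inversion f ->
    continuous f ->
    moderate_decrease f ->
    0 < a -> 0 < B -> (0 < m0)%N ->
    (forall xi : R,
       cmod (fourier f xi)
       <= 2 * B * (`|xi| ^+ m0.-1 + 1) * expR (- (2 * pi * a * `|xi|))) ->
    exists g : R[i] -> R[i],
      holomorphic_on (strip a) g /\ (forall x : R, g x%:C = f x)).
Proof.
split.
- move=> f a0 a m z j m0 fR fex _ a_gt0 aa0 zinj zin zpole hol cont za _ m0E vp vm hp hm.
  have [S [ord [r0 [ps Sz polar]]]] := pole_strip_of_poles a_gt0 aa0 zinj zin zpole
    hol cont za vp vm hp hm.
  have ord0 p : p \in S -> (0 < ord p)%N by move=> /Sz[k _ ->]; case: (zpole k).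
  have ordm p : p \in S -> `|complex.Im p| = a -> (ord p <= m0)%N.
    by move=> /Sz[k -> ->] /eqP ka; rewrite m0E; exact: leq_bigmax_cond.
  have [B B0 HB] := fourier_decay ps fex polar ord0 ordm.
  exists B; split => //.
  exists (2 * B * (m0.-1)`!%:R * (1 + (2 * pi * a)^-1) ^+ m0.-1.+1) => h h0.
  have [T [sumT errT]] := trapezoidal_error ps fex polar h0.
  exists T; split => //; exact: (decay_sum_le ps h0 B0 HB).
- move=> f a B m0 finv _ _ _ B0 _ Fd.
  by apply: (fourier_decay_extension finv _ Fd); rewrite mulr_ge0// ltW.
Qed.
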